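(* Consider the network revenue management problem described in the context, and let $v^{\mathrm{IRT}}$ be the expected revenue of the Infrequent Re-solving with Thresholding (IRT) policy. There exist constants $M>0$ and $T_1$, depending only on the arrival rates $\lambda_1,\dots,\lambda_n$, the revenues $r_1,\dots,r_n$ and the matrix $A$ (and not on the horizon $T$ or on the capacity vector $C$), such that for every integer horizon $T\ge T_1$ and every capacity vector $C\in\mathbb{R}^m_{\ge 0}$, \[ v^{\mathrm{HO}}-v^{\mathrm{IRT}}\le M. \] In particular $v^*-v^{\mathrm{IRT}}\le M$ and $v^{\mathrm{HO}}-v^*\le M$.
   Context: Network revenue management (NRM) problem: a horizon $[0,T]$ with $T$ a positive integer; $n$ customer classes $j\in[n]=\{1,\dots,n\}$; class-$j$ customers arrive according to a Poisson process $\{\Lambda_j(t)\}$ of rate $\lambda_j>0$, independent across classes; write $\Lambda_j(t_1,t_2)=\Lambda_j(t_2)-\Lambda_j(t_1)$. There are $m$ resources with initial capacities $C=(C_1,\dots,C_m)^\top$. Accepting a class-$j$ customer earns revenue $r_j$ and consumes $a_{lj}\ge 0$ units of resource $l$; $A_j=(a_{1j},\dots,a_{mj})^\top$ and $A=(a_{lj})\in\mathbb{R}^{m\times n}$. Each arriving customer must be accepted or rejected irrevocably upon arrival; a policy is admissible if it is non-anticipating, the number $z_j^\pi(t_1,t_2)$ of class-$j$ customers it admits in $(t_1,t_2]$ satisfies $z_j^\pi(t_1,t_2)\le\Lambda_j(t_1,t_2)$ a.s., and $\sum_j A_j z_j^\pi(0,T)\le C$ a.s. Its expected revenue is $v^\pi=\mathrm{E}[\sum_j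 r_j z_j^\pi(0,T)]$ and $v^*=\sup_\pi v^\pi$ over admissible policies. The hindsight optimum is $v^{\mathrm{HO}}=\mathrm{E}[V^{\mathrm{HO}}]$ with $V^{\mathrm{HO}}=\max\{\sum_j r_j z_j: \sum_j A_j z_j\le C,\ 0\le z_j\le\Lambda_j(T)\ \forall j\}$. IRT policy: let $K=\lceil \log\log T/\log(6/5)\rceil$, $\tau_u=T^{(5/6)^u}$ and $t_u^*=T-\tau_u$ for $u=0,1,\dots,K$ (so $t_0^*=0$), and $t^*_{K+1}=T$. For each epoch $u=0,\dots,K$: with $C(t_u^* )$ the remaining capacity at time $t_u^*$, let $x^u$ be an optimal solution of $\max\{\sum_j r_jx_j:\sum_j A_jx_j\le C(t_u^* )/\tau_u,\ 0\le x_j\le\lambda_j\ \forall j\}$. If $u<K$, set $p^u_j=0$ if $x^u_j<\lambda_j\tau_u^{-1/4}$, $p^u_j=1$ if $x^u_j>\lambda_j(1-\tau_u^{-1/4})$, and $p^u_j=x^u_j/\lambda_j$ otherwise; if $u=K$, set $p^K_j=x^K_j/\lambda_j$. During $[t_u^*,t_{u+1}^* )$, an arriving class-$j$ customer is rejected if $A_j$ is not componentwise at most the current remaining capacity, and otherwise is accepted independently with probability $p^u_j$ (consuming $A_j$). *)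

(* Defs.v *)
From HB Require Import structures.
From mathcomp Require Import all_boot all_order all_algebra.
From mathcomp Require Import all_classical all_reals all_analysis.
Set Implicit Arguments.
Unset Strict Implicit.
Unset Printing Implicit Defensive.
Import Order.TTheory GRing.Theory Num.Theory.
Local Open Scope classical_set_scope.
Local Open Scope ring_scope.

Definition mut_indep d (Omega : measurableType d) (R : realType)
    (P : probability Omega R) (I : eqType) (X : I -> Omega -> R) : Prop :=
  (forall i, measurable_fun setT (X i)) /\
  forall (s : seq I) (B : I -> set R), uniq s -> (forall i, measurable (B i)) ->
    P (\big[setI/setT]_(i <- s) (X i @^-1` B i))
    = (\prod_(i <- s) P (X i @^-1` B i))%E.

(* Probabilistic model.  Class-j customers arrive according to a Poisson    *)
(* process of rate lam j, given by its i.i.d. Exp(lam j) inter-arrival      *)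
(* times E j 0, E j 1, ...; U j k is the Uniform[0,1] coin used by the      *)
(* policy for the k-th class-j arrival (randomized acceptance).  All the    *)
(* E's and U's are mutually independent.                                     *)
Definition nrm_model d (Omega : measurableType d) (R : realType)
    (P : probability Omega R) (n : nat) (lam : 'I_n -> R)
    (E U : 'I_n -> nat -> Omega -> R) : Prop :=
  [/\ forall j k V, measurable V ->
        P (E j k @^-1` V) = exponential_prob (lam j) V,
      forall j k V, measurable V ->
        P (U j k @^-1` V) = uniform_prob (@ltr01 R) V
    & mut_indep P (fun i : 'I_n * nat * bool =>
                     if i.2 then E i.1.1 i.1.2 else U i.1.1 i.1.2)].

Definition arr_time (R : realType) n (E : 'I_n -> nat -> R) (j : 'I_n) (k : nat) : R :=
  \sum_(i < k.+1) E j i.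

(* an index beyond which no arrival (of any class) occurs by time t         *)
(* (any such index gives the same arrivals; 0 on the null event where none) *)
Definition arr_bound (R : realType) n (E : 'I_n -> nat -> R) (t : R) : nat :=
  xget 0%N [set N : nat | forall j k, (N <= k)%N -> t < arr_time E j k].

Definition Lam (R : realType) n (E : 'I_n -> nat -> R) (j : 'I_n) (t : R) : nat :=
  count (fun k => arr_time E j k <= t) (iota 0 (arr_bound E t)).

Definition arrivals (R : realType) n (E : 'I_n -> nat -> R) (T : R) : seq ('I_n * nat) :=
  sort (fun a b => arr_time E a.1 a.2 <= arr_time E b.1 b.2)
    [seq (j, k) | j <- enum 'I_n,
                  k <- [seq k <- iota 0 (arr_bound E T) | arr_time E j k <= T]].

Definition ho_feasible (R : realType) m n (A : 'M[R]_(m, n)) (C : 'I_m -> R)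
    (ub : 'I_n -> R) (z : 'I_n -> R) : Prop :=
  (forall l, \sum_j A l j * z j <= C l) /\ (forall j, 0 <= z j <= ub j).

Definition V_HO (R : realType) m n (r lam : 'I_n -> R) (A : 'M[R]_(m, n))
    (C : 'I_m -> R) (T : nat) (E : 'I_n -> nat -> R) : R :=
  sup [set v | exists z, ho_feasible A C (fun j => (Lam E j T%:R)%:R) z
                         /\ v = \sum_j r j * z j].

Definition lp_optimal (R : realType) m n (r lam : 'I_n -> R) (A : 'M[R]_(m, n))
    (b : 'I_m -> R) (x : 'I_n -> R) : Prop :=
  ho_feasible A b lam x /\
  forall y, ho_feasible A b lam y -> \sum_j r j * y j <= \sum_j r j * x j.

Definition lp_selector (R : realType) m n (r lam : 'I_n -> R) (A : 'M[R]_(m, n))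
    (sol : nat -> ('I_m -> R) -> 'I_n -> R) : Prop :=
  forall u b, (forall l, 0 <= b l) -> lp_optimal r lam A b (sol u b).

(* K = ceil(log log T / log(6/5))  (clipped at 0; only relevant for tiny T) *)
Definition K_irt (R : realType) (T : nat) : nat :=
  let c := Num.ceil (ln (ln (T%:R : R)) / ln (6 / 5 : R)) in
  if (0 <= c)%R then `|c|%N else 0%N.

Definition tau_irt (R : realType) (T : nat) (u : nat) : R :=
  (T%:R : R) `^ ((5 / 6 : R) ^+ u).

Definition tstar (R : realType) (T : nat) (u : nat) : R := T%:R - tau_irt R T u.

Definition epoch (R : realType) (T : nat) (s : R) : nat :=
  \max_(u < (K_irt R T).+1 | tstar R T u <= s) val u.

Definition p_irt (R : realType) n (lam : 'I_n -> R) (T u : nat) (x : 'I_n -> R)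
    (j : 'I_n) : R :=
  if (u < K_irt R T)%N then
    let th := tau_irt R T u `^ (- (1 / 4)) in
    if x j < lam j * th then 0
    else if lam j * (1 - th) < x j then 1
    else x j / lam j
  else x j / lam j.

Definition irt_step (R : realType) m n (r lam : 'I_n -> R) (A : 'M[R]_(m, n))
    (sol : nat -> ('I_m -> R) -> 'I_n -> R) (T : nat)
    (E U : 'I_n -> nat -> R)
    (st : ('I_m -> R) * R * option nat * ('I_n -> R)) (a : 'I_n * nat)
    : ('I_m -> R) * R * option nat * ('I_n -> R) :=
  let: (cap, rev, cur, p) := st in
  let: (j, k) := a in
  let u := epoch T (arr_time E j k) in
  let p' := if cur == Some u then p
            else p_irt lam T u (sol u (fun l => cap l / tau_irt R T u)) in
  let acc := [forall l, A l j <= cap l] && (U j k < p' j) in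
  (if acc then (fun l => cap l - A l j) else cap,
   rev + (if acc then r j else 0),
   Some u, p').

Definition V_IRT (R : realType) m n (r lam : 'I_n -> R) (A : 'M[R]_(m, n))
    (C : 'I_m -> R) (sol : nat -> ('I_m -> R) -> 'I_n -> R) (T : nat)
    (E U : 'I_n -> nat -> R) : R :=
  (foldl (irt_step r lam A sol T E U) (C, 0, None, fun _ => 0)
         (arrivals E T%:R)).1.1.2.

(* Main.v *)
(** Along every sample path the hindsight value is at most the revenue of the policy
plus a sum of losses, one per epoch.  In a good epoch, where the arrival counts and
the counts of accepting coins are close to their means, the loss is zero: by
Lipschitz stability of linear programs some hindsight-optimal solution for the
remaining problem is close to the fluid solution, and since the thresholds leave a
margin larger than the fluctuations, it can accept exactly what the policy accepts
during the epoch and make up for the rest with later arrivals.  In a bad epoch the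
loss is at most a multiple of the number of remaining arrivals.

With [sigma = tau_u ^ (1/12)], an epoch is bad with probability exponentially small
in [sigma^2]: by memorylessness the arrivals after [t_u] have exponential moments
independent of the past, and the coins are controlled uniformly over all acceptance
probabilities.  The expected loss of epoch [u] is thus [O(1 / sigma)], and these
bounds are summable because [tau_u] is doubly exponential in [K - u]. *)
Require Import Defs.
From HB Require Import structures.
From mathcomp Require Import all_boot all_order all_algebra.
From mathcomp Require Import all_classical all_reals all_analysis.
From mathcomp Require Import measurable_realfun lra ring zify.
Import Order.TTheory GRing.Theory Num.Theory.
Import numFieldNormedType.Exports.
Local Open Scope classical_set_scope.
Local Open Scope ring_scope.
Set Implicit Arguments.
Unset Strict Implicit.
Unset Printing Implicit Defensive.

(** * Stability of linear programs *)

Section Conformal.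
Context (R : realFieldType) (I : finType).
Implicit Types (v w g : I -> R) (L : (I -> R) -> Prop).

(** The capacity vector is arbitrary, so no constant may depend on it: the Lipschitz constant [k] of
    [lp_stability] depends on [A] alone, because it comes from the finitely many supports of
    elementary vectors of the graph of [A]. The powers of [sigma] fit as follows. Counts fluctuate
    on the scale [sigma ^ 6], so a deviation of order [sigma ^ 7] has Chernoff exponent [sigma ^ 2].
    An acceptance rate that is not thresholded stays [lam * sigma ^ -3] away from both ends; over
    the [sigma ^ 10] units of time after the epoch this is a margin [lam * sigma ^ 7], and the
    allowed deviation is a small multiple of it. Since [t_u] is a fixed time and not an arrival,
    probabilities are estimated on the events that arrival [a] is the first one after [t_u]; these
    are almost surely disjoint, so bounds relative to each of them add up without loss. In a bad
    epoch the number of remaining arrivals is correlated with the bad event; what exceeds about four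
    times its mean is charged separately, through a geometric tail. The last epoch, of length at
    most [4], always counts as bad. *)

Definition lin_closed L :=
  forall v w a b, L v -> L w -> L (fun i => a * v i + b * w i).

Definition supp v : {set I} := [set i | v i != 0]%SET.

(** The conformal order on sign vectors with magnitudes. *)
Definition between0 g v := forall i, (0 <= g i <= v i) || (v i <= g i <= 0).

Lemma between0_trans g v w : between0 g v -> between0 v w -> between0 g w.
Proof.
move=> gv vw i; have /orP[/andP[g0 gvi]|/andP[gvi g0]] := gv i;
have /orP[/andP[v0 vwi]|/andP[vwi v0]] := vw i; apply/orP.
- left; lra.
- right; lra.
- left; lra.
- right; lra.
Qed.

(** Take for [i0] the coordinate where [|w i| / |v i|] is largest. The multiple of [w] that cancels
    [v] at [i0] is then too small to reverse a sign of [v] elsewhere. *)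
Lemma supp_ratio_max v w : (exists i, w i != 0) -> supp w \subset supp v ->
  exists2 i0, w i0 != 0 & forall i, `|w i * (v i0 / w i0)| <= `|v i|.
Proof.
move=> [i1 wi1] swv.
have vn0 i : w i != 0 -> v i != 0.
  by move=> wi; have /fintype.subsetP/(_ i) := swv; rewrite !inE; apply.
case: (@arg_maxP _ _ _ i1 (fun i => w i != 0) (fun i => `|w i| / `|v i|) wi1).
move=> i0 wi0 Hmax; exists i0 => // i.
have [->|wi] := eqVneq (w i) 0; first by rewrite mul0r normr0.
have vi0 := vn0 _ wi0; have vi := vn0 _ wi.
have /= := Hmax i wi; rewrite ler_pdivrMr ?normr_gt0// => H.
rewrite normrM normrM normfV mulrA ler_pdivrMr ?normr_gt0//.
have := ler_wpM2r (normr_ge0 (v i0)) H.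
rewrite mulrAC divfK ?normr_eq0// => {}H.
by rewrite (le_trans H)// mulrC.
Qed.

(** Subtracting from [v] the multiple of [w] supplied by [supp_ratio_max] gives a vector [g] that
    vanishes somewhere on the support of [v], keeps the signs of [v] and is nonzero at [k].
    Rescaling [g] until it touches [v] yields the first part; the remainder vanishes at the point of
    contact, so each part loses a coordinate. *)
Lemma conformal_split L v w : lin_closed L -> L v -> L w ->
  (exists i, w i != 0) -> supp w \proper supp v ->
  exists v1 v2, [/\ L v1, L v2, forall i, v i = v1 i + v2 i,
    between0 v1 v /\ between0 v2 v & supp v1 \proper supp v /\ supp v2 \proper supp v].
Proof.
move=> Llin Lv Lw wn0 /properP[swv [k kv kw]].
rewrite !inE in kv; rewrite inE negbK in kw.
have [i0 wi0 Hi0] := supp_ratio_max wn0 swv.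
set t := v i0 / w i0 in Hi0.
pose g i := v i - w i * t.
have Lg : L g.
  have -> : g = (fun i => 1 * v i + (- t) * w i).
    by apply/funext => i; rewrite /g; ring.
  exact: Llin.
have gk : g k = v k by rewrite /g (eqP kw) mul0r subr0.
have gi0 : g i0 = 0 by rewrite /g /t; field.
have vi0 : v i0 != 0 by have /fintype.subsetP/(_ i0) := swv; rewrite !inE; apply.
have sgv : supp g \subset supp v.
  apply/fintype.subsetP => i; rewrite !inE; apply: contraNN => /eqP vi.
  have := Hi0 i; rewrite /g vi normr0 normr_le0 => /eqP ->.
  by rewrite subrr.
have gn0 : exists i, g i != 0 by exists k; rewrite gk.
have [i1 gi1 Hi1] := supp_ratio_max gn0 sgv.
have vi1 : v i1 != 0 by have /fintype.subsetP/(_ i1) := sgv; rewrite !inE; apply.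
have gv_ge0 i : 0 <= g i * v i.
  have := Hi0 i; rewrite /g; set x := w i * t; set y := v i.
  have [y0|y0] := leP 0 y; rewrite ?(ger0_norm y0) ?(ltr0_norm y0) ler_norml => /andP[]; nra.
set s := v i1 / g i1 in Hi1.
have s_gt0 : 0 < s.
  have p : 0 < g i1 * v i1 by rewrite lt_def gv_ge0 mulf_neq0.
  have -> : s = g i1 * v i1 / (g i1 ^+ 2) by rewrite /s; field.
  by rewrite divr_gt0// exprn_even_gt0.
have sg i : exists2 c, 0 <= c <= 1 & g i * s = c * v i.
  have [vi|vi] := eqVneq (v i) 0.
    exists 0 => //; first by rewrite lexx ler01.
    have := Hi1 i; rewrite vi normr0 normr_le0 => /eqP ->.
    by rewrite mulr0.
  exists (g i * s / v i); last by field.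
  have vi2 : 0 < v i ^+ 2 by rewrite exprn_even_gt0.
  have -> : g i * s / v i = (g i * v i) * s / v i ^+ 2 by field.
  rewrite divr_ge0 ?(mulr_ge0 (gv_ge0 i)) ?(ltW s_gt0) ?(ltW vi2)//=.
  have H := Hi1 i.
  have : `|g i * v i * s| <= v i ^+ 2.
    have -> : v i ^+ 2 = `|v i| * `|v i| by rewrite -normrM -expr2 ger0_norm ?sqr_ge0.
    by rewrite mulrAC normrM ler_wpM2r.
  rewrite ler_pdivrMr// mul1r; apply: le_trans; exact: ler_norm.
exists (fun i => g i * s), (fun i => v i - g i * s); split.
- have -> : (fun i => g i * s) = (fun i => s * g i + 0 * g i).
    by apply/funext => i; ring.
  exact: Llin.
- have -> : (fun i => v i - g i * s) = (fun i => 1 * v i + (- s) * g i).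
    by apply/funext => i; ring.
  exact: Llin.
- by move=> i; ring.
- split => i; have [c /andP[c0 c1] ->] := sg i.
    by have [v0|v0] := leP 0 (v i); apply/orP; [left|right]; nra.
  by have [v0|v0] := leP 0 (v i); apply/orP; [left|right]; nra.
- split; apply/properP; split.
  + apply/fintype.subsetP => i; rewrite !inE; apply: contraNN => /eqP vi.
    by have [c _ ->] := sg i; rewrite vi mulr0.
  + by exists i0; rewrite !inE ?gi0 ?mul0r ?eqxx.
  + apply/fintype.subsetP => i; rewrite !inE; apply: contraNN => /eqP vi.
    by have [c _ ->] := sg i; rewrite vi mulr0 subrr.
  + exists i1; rewrite !inE// negbK /s; apply/eqP; field.
    by rewrite gi1.
Qed.

Definition elementary L v :=
  forall w, L w -> (exists i, w i != 0) -> ~~ (supp w \proper supp v).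

(** Two elementary vectors with the same support are proportional: a combination cancelling one
    coordinate would otherwise be nonzero with smaller support. The ratios between entries are thus
    determined by the support, and one representative fixes the constant. *)
Lemma elementary_ratio L (S : {set I}) : lin_closed L ->
  exists2 k : R, 0 < k & forall v, L v -> elementary L v -> supp v = S ->
    forall i j, v j != 0 -> `|v i| <= k * `|v j|.
Proof.
move=> Llin.
have [[v0 [Lv0 ev0 sv0]]|nex] := pselect (exists v, [/\ L v, elementary L v & supp v = S]); last first.
  by exists 1 => // v Lv ev sv; case: nex; exists v.
pose k0 := \sum_i \sum_(j | v0 j != 0) (`|v0 i| / `|v0 j|).
have k0_ge0 : 0 <= k0.
  by apply: sumr_ge0 => i _; apply: sumr_ge0 => j _; rewrite divr_ge0.
exists (1 + k0); first by rewrite ltr_pwDl.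
move=> v Lv ev sv i j vj.
have sE l : (v l != 0) = (v0 l != 0).
  by have := erefl (l \in S); rewrite -{1}sv -sv0 !inE.
have v0j : v0 j != 0 by rewrite -sE.
have prop l : v l = v j / v0 j * v0 l.
  apply/eqP; rewrite -subr_eq0; apply: contraT => H.
  have Lw : L (fun l => 1 * v l + (- (v j / v0 j)) * v0 l) by exact: Llin.
  have Hl : exists l, 1 * v l + (- (v j / v0 j)) * v0 l != 0.
    by exists l; rewrite mul1r mulNr.
  case/negP: (ev _ Lw Hl).
  apply/properP; split.
    apply/fintype.subsetP => x; rewrite !inE; apply: contraNN => vx.
    have /eqP v0x : v0 x == 0 by apply: contraTT vx; rewrite sE.
    by rewrite (eqP vx) v0x !mulr0 addr0.
  by exists j; rewrite !inE// negbK; apply/eqP; field.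
have v0i : `|v0 i| <= k0 * `|v0 j|.
  rewrite -ler_pdivrMr ?normr_gt0//.
  rewrite /k0 (bigD1 i)//= (bigD1 j)//= -addrA lerDl addr_ge0//.
    by apply: sumr_ge0 => ? _; rewrite divr_ge0.
  by apply: sumr_ge0 => ? _; apply: sumr_ge0 => ? _; rewrite divr_ge0.
rewrite (prop i) [in X in _ <= X](prop j).
set c := v j / v0 j; rewrite (normrM c (v0 i)) (normrM c (v0 j)).
rewrite mulrCA ler_wpM2l//.
by rewrite (le_trans v0i)// ler_wpM2r// lerDr.
Qed.

(** An elementary [v] serves as its own [g]. Otherwise one of the two conformal parts keeps at least
    half of the entry [v i] and has smaller support. The number of coordinates limits the number of
    halvings, so [k] depends on [L] only. *)
Lemma conformal_large L : lin_closed L ->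
  exists2 k : R, 1 <= k & forall v i, L v -> v i != 0 ->
    exists g, [/\ L g, between0 g v, exists j, g j != 0 &
      forall j, g j != 0 -> `|v i| <= k * `|g j|].
Proof.
move=> Llin.
have [kS kS0 kSP] := fin_all_exists2 (fun S => elementary_ratio S Llin).
pose k0 := 1 + \sum_S kS S.
have k0_ge1 : 1 <= k0 by rewrite lerDl sumr_ge0// => S _; rewrite ltW.
have kSle S : kS S <= k0.
  rewrite /k0 (bigD1 S)//= addrCA lerDl addr_ge0// sumr_ge0// => ? _.
  by rewrite ltW.
suff H : forall N, exists2 k : R, 1 <= k & forall v i, L v -> v i != 0 ->
    (#|supp v| <= N)%N ->
    exists g, [/\ L g, between0 g v, exists j, g j != 0 &
      forall j, g j != 0 -> `|v i| <= k * `|g j|].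
  have [k k1 kP] := H #|I|; exists k => // v i Lv vi.
  by apply: kP => //; exact: max_card.
elim => [|N [k k1 IH]].
  exists 1 => // v i _ vi; rewrite leqn0 cards_eq0 => /eqP sv.
  by have := finset.in_set0 i; rewrite -sv inE vi.
(* [2 * k] pays for one more halving, [k0] covers the elementary vectors of every support. *)
exists (2 * k + k0); first by lra.
move=> v i Lv vi svN.
have [[w [Lw wn0 swv]]|nel] := pselect
    (exists w, [/\ L w, exists i, w i != 0 & supp w \proper supp v]); last first.
  exists v; split => //.
  - by move=> j; have [v0|v0] := leP 0 (v j); apply/orP; [left|right]; lra.
  - by exists i.
  - move=> j vj; apply: le_trans (_ : kS (supp v) * `|v j| <= _).
      apply: (kSP _ v Lv) => // w Lw wn0; apply/negP => swv.
      by apply: nel; exists w.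
    by rewrite ler_wpM2r// (le_trans (kSle _))// lerDr; lra.
have [v1 [v2 [Lv1 Lv2 vE [b1 b2] [s1 s2]]]] := conformal_split Llin Lv Lw wn0 swv.
have half x : L x -> between0 x v -> supp x \proper supp v -> `|v i| <= 2 * `|x i| ->
    exists g, [/\ L g, between0 g v, exists j, g j != 0 &
      forall j, g j != 0 -> `|v i| <= (2 * k + k0) * `|g j|].
  move=> Lx bx sx hx.
  have xi : x i != 0.
    apply: contraNneq vi => xi; move: hx; rewrite xi normr0 mulr0 normr_le0.
    by [].
  have sxN : (#|supp x| <= N)%N by rewrite -ltnS (leq_trans (proper_card sx)).
  have [g [Lg bg gn0 gP]] := IH x i Lx xi sxN.
  exists g; split => //; first exact: between0_trans bx.
  move=> j gj; have := gP j gj => gj1.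
  have := normr_ge0 (g j).
  by nra.
have : `|v i| <= `|v1 i| + `|v2 i| by rewrite vE ler_normD.
have [h|h] := leP (`|v2 i|) (`|v1 i|) => hv.
  by apply: (half v1) => //; lra.
by apply: (half v2) => //; lra.
Qed.

End Conformal.

Section Stability.
Context (R : realType) (m n : nat) (A : 'M[R]_(m, n)).

(* The first coordinates are a vector [z], the others the consumption [A z]. *)
Definition mx_graph (v : 'I_n + 'I_m -> R) : Prop :=
  forall l, v (inr l) = \sum_j A l j * v (inl j).

Lemma mx_graph_lin : lin_closed mx_graph.
Proof.
move=> v w a b Lv Lw l; rewrite Lv Lw !mulr_sumr -big_split/=.
by apply: eq_bigr => j _; ring.
Qed.

Lemma sum_shift (f y g : 'I_n -> R) (t : R) :
  \sum_j f j * (y j + t * g j) = \sum_j f j * y j + t * \sum_j f j * g j.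
Proof.
by rewrite mulr_sumr -big_split/=; apply: eq_bigr => j _; ring.
Qed.

(* If [y] is far from [X] in some coordinate, the difference dominates a vector
   [g] all of whose nonzero entries exceed [d]; both [y + t g] and [X - t g]
   are then feasible, so moving [y] along [g] does not decrease the value. *)
Lemma lp_stability : exists2 k : R, 1 <= k &
  forall (r U U' : 'I_n -> R) (c : 'I_m -> R) (d : R) (X y : 'I_n -> R),
    0 <= d -> lp_optimal r U A c X -> ho_feasible A c U' y ->
    (forall j, `|U j - U' j| <= d) ->
    exists y', [/\ ho_feasible A c U' y',
      \sum_j r j * y j <= \sum_j r j * y' j & forall j, `|y' j - X j| <= k * d].
Proof.
have [k k1 kP] := conformal_large mx_graph_lin.
exists k => // r U U' c d X y d0 [[XA XU] Xopt] yfeas UU'.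
(* The two programs may differ by [d] in their upper bounds but share the capacity: a coordinate of
   [z] is far beyond [d], a consumption as soon as it differs at all. *)
pose th (i : 'I_n + 'I_m) : R := if i is inl _ then d else 0.
pose ext (x : 'I_n -> R) (i : 'I_n + 'I_m) : R :=
  match i with inl j => x j | inr l => \sum_j A l j * x j end.
pose df x := ext (fun j => X j - x j).
pose far x := [set i | th i < `|df x i|]%SET.
have [N] := ubnP #|far y|; elim: N y yfeas => // N IH y [yA yU] farN.
have [ok|] := pselect (forall j, `|X j - y j| <= k * d).
  by exists y; split => // j; rewrite distrC.
move=> /existsNP[i0 /negP]; rewrite -ltNge => vi0.
set v := df y.
have vE i : v (inl i) = X i - y i by [].
have vR l : v (inr l) = \sum_j A l j * X j - \sum_j A l j * y j.
  by rewrite /v /df /= -sumrB; apply: eq_bigr => j _; ring.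
have Lv : mx_graph v by [].
have vn0 : v (inl i0) != 0.
  by rewrite vE -normr_gt0; apply: le_lt_trans vi0; rewrite mulr_ge0//; lra.
have [g [Lg bg [i1 gi1] gP]] := kP v (inl i0) Lv vn0.
have gbig i : g i != 0 -> d < `|g i|.
  move=> gi; have := gP i gi; rewrite vE => h.
  by rewrite -(@ltr_pM2l _ k) ?(lt_le_trans vi0)//; lra.
have gth i : g i != 0 -> th i < `|g i|.
  by move=> gi; case: i gi => [j|l] gi /=; [exact: gbig|rewrite normr_gt0].
have gv i : `|g i| <= `|v i|.
  have /orP[/andP[h1 h2]|/andP[h1 h2]] := bg i.
    by rewrite !ger0_norm//; lra.
  by rewrite !ler0_norm//; lra.
(* The step [t] ends when the first coordinate in the support of [g] reaches its threshold. The
   slack [d] that remains absorbs the difference between [U] and [U'], so both shifted vectors are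
   feasible; one far coordinate disappears and none is created. *)
case: (@arg_minP _ _ _ i1 (fun i => g i != 0) (fun i => (`|v i| - th i) / `|g i|) gi1).
move=> i2 gis Hmin.
set t := (`|v i2| - th i2) / `|g i2| in Hmin.
have t0 : 0 < t.
  by rewrite divr_gt0 ?normr_gt0// subr_gt0 (lt_le_trans (gth _ gis)).
have tg i : g i != 0 -> t * `|g i| <= `|v i| - th i.
  by move=> gi; rewrite -ler_pdivlMr ?normr_gt0//; exact: Hmin.
have tpos i : 0 < g i -> 0 < v i /\ t * g i <= v i - th i.
  move=> gi; have := tg i; rewrite gt_eqF// (gtr0_norm gi) => /(_ isT).
  have := bg i => /orP[|]/andP[] h1 h2; last by lra.
  by rewrite ger0_norm; lra.
have tneg i : g i < 0 -> v i < 0 /\ v i + th i <= t * g i.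
  move=> gi; have := tg i; rewrite lt_eqF// (ltr0_norm gi) => /(_ isT).
  have := bg i => /orP[|]/andP[] h1 h2; first by lra.
  by rewrite ler0_norm; lra.
have tpos' i : 0 < g i -> 0 < t * g i by exact: mulr_gt0.
have tneg' i : g i < 0 -> t * g i < 0 by move=> ?; rewrite pmulr_rlt0.
have UU'2 j : U j - U' j <= d /\ U' j - U j <= d.
  by have := UU' j; rewrite ler_norml => /andP[]; lra.
pose y' j := y j + t * g (inl j).
pose X' j := X j + (- t) * g (inl j).
have y'feas : ho_feasible A c U' y'.
  split => [l|j].
    rewrite sum_shift -Lg; have := yA l; have := XA l; have := vR l.
    have [gl|gl|->] := ltrgt0P (g (inr l)); last by lra.
      by have := tpos _ gl; rewrite /th; lra.
    by have := tneg' _ gl; lra.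
  have /andP[y0 y1] := yU j; have /andP[X0 X1] := XU j; have := vE j.
  have [h1 h2] := UU'2 j; rewrite /y'.
  have [gj|gj|->] := ltrgt0P (g (inl j)); last by lra.
    by have := tpos' _ gj; have := tpos _ gj; rewrite /th; lra.
  by have := tneg' _ gj; have := tneg _ gj; rewrite /th; lra.
have X'feas : ho_feasible A c U X'.
  split => [l|j].
    rewrite sum_shift -Lg; have := yA l; have := XA l; have := vR l.
    have [gl|gl|->] := ltrgt0P (g (inr l)); last by lra.
      by have := tpos' _ gl; lra.
    by have := tneg' _ gl; have := tneg _ gl; rewrite /th; lra.
  have /andP[y0 y1] := yU j; have /andP[X0 X1] := XU j; have := vE j.
  have [h1 h2] := UU'2 j; rewrite /X'.
  have [gj|gj|->] := ltrgt0P (g (inl j)); last by lra.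
    by have := tpos' _ gj; have := tpos _ gj; rewrite /th; lra.
  by have := tneg' _ gj; have := tneg _ gj; rewrite /th; lra.
have rg : \sum_j r j * y j <= \sum_j r j * y' j.
  by have := Xopt _ X'feas; rewrite !sum_shift; lra.
have dfE i : df y' i = v i - t * g i.
  case: i => [j|l]; first by rewrite vE /df /= /y'; ring.
  rewrite vR Lg /df /= mulr_sumr -!sumrB; apply: eq_bigr => j _; rewrite /y'; ring.
have farlt : (#|far y'| < #|far y|)%N.
  apply: proper_card; apply/properP; split.
    apply/fintype.subsetP => i; rewrite !inE dfE => /lt_le_trans; apply.
    rewrite -/v; have [gi|gi|->] := ltrgt0P (g i); last by rewrite mulr0 subr0.
      have [v1 h1] := tpos _ gi; have h2 := tpos' _ gi.
      have th0 : 0 <= th i by case: (i).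
      by rewrite !ger0_norm; lra.
    have [v1 h1] := tneg _ gi; have h2 := tneg' _ gi.
    have th0 : 0 <= th i by case: (i).
    by rewrite !ler0_norm; lra.
  exists i2; rewrite !inE -?/v; first by rewrite (lt_le_trans (gth _ gis)).
  rewrite -leNgt dfE.
  have tE : t * `|g i2| = `|v i2| - th i2 by rewrite /t divfK// normr_eq0.
  have th0 : 0 <= th i2 by case: (i2).
  have [gi|gi|gi] := ltrgt0P (g i2); last by rewrite gi eqxx in gis.
    have [v1 h1] := tpos _ gi; rewrite (gtr0_norm gi) (gtr0_norm v1) in tE.
    by rewrite ger0_norm; lra.
  have [v1 h1] := tneg _ gi; rewrite (ltr0_norm gi) (ltr0_norm v1) in tE.
  by rewrite ler0_norm; lra.
have [z [zf zr zX]] := IH y' y'feas (leq_trans farlt farN).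
by exists z; split => //; exact: le_trans zr.
Qed.

End Stability.

(** * One epoch of the policy *)

Section Hindsight.
Context (R : realType) (m n : nat) (r : 'I_n -> R) (A : 'M[R]_(m, n)).
Hypothesis A0 : forall l j, 0 <= A l j.

Definition VH (c : 'I_m -> R) (D : 'I_n -> R) : R :=
  sup [set v | exists z, ho_feasible A c D z /\ v = \sum_j r j * z j]%classic.

Lemma ho_value_le c D z : ho_feasible A c D z ->
  \sum_j r j * z j <= \sum_j `|r j| * D j.
Proof.
move=> [_ zD]; apply: ler_sum => j _.
have /andP[z0 z1] := zD j.
by apply: le_trans (ler_norm _) _; rewrite normrM (ger0_norm z0) ler_wpM2l.
Qed.

Lemma VH_ge c D z : ho_feasible A c D z -> \sum_j r j * z j <= VH c D.
Proof.
move=> zf; apply: ub_le_sup; last by exists z.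
by exists (\sum_j `|r j| * D j) => v [z' [z'f ->]]; exact: ho_value_le z'f.
Qed.

Lemma ho_feasible0 (c : 'I_m -> R) (D : 'I_n -> R) :
  (forall l, 0 <= c l) -> (forall j, 0 <= D j) ->
  ho_feasible A c D (fun=> 0).
Proof.
move=> c0 D0; split=> [l|j]; last by rewrite lexx D0.
by rewrite big1// => j _; rewrite mulr0.
Qed.

Lemma VH_le c D B : (forall l, 0 <= c l) -> (forall j, 0 <= D j) ->
  (forall z, ho_feasible A c D z -> \sum_j r j * z j <= B) -> VH c D <= B.
Proof.
move=> c0 D0 H; apply: ge_sup; last by move=> v [z [zf ->]]; exact: H.
by exists (\sum_j r j * 0), (fun=> 0); split=> //; exact: ho_feasible0.
Qed.

Lemma VH_ge0 c D : (forall l, 0 <= c l) -> (forall j, 0 <= D j) -> 0 <= VH c D.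
Proof.
move=> c0 D0; apply: le_trans (VH_ge (ho_feasible0 c0 D0)).
by rewrite big1// => j _; rewrite mulr0.
Qed.

(** The policy solves a program in rates; the stability bound is applied to it in counts over the
    remaining time [t]. *)
Lemma lp_optimal_scale (lam : 'I_n -> R) (c : 'I_m -> R) (t : R) x : 0 < t ->
  lp_optimal r lam A (fun l => c l / t) x ->
  lp_optimal r (fun j => lam j * t) A c (fun j => t * x j).
Proof.
move=> t0 [[xA xl] xopt]; split.
  split=> [l|j].
    under eq_bigr do rewrite mulrCA.
    by rewrite -mulr_sumr mulrC -ler_pdivlMr.
  have /andP[x0 x1] := xl j.
  by rewrite mulr_ge0 ?(ltW t0)//= mulrC ler_wpM2r// ltW.
move=> y [yA yl].
have yf : ho_feasible A (fun l => c l / t) lam (fun j => y j / t).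
  split=> [l|j].
    under eq_bigr do rewrite mulrA.
    by rewrite -mulr_suml ler_pM2r ?invr_gt0.
  have /andP[y0 y1] := yl j.
  by rewrite divr_ge0 ?(ltW t0)//= ler_pdivrMr.
have E1 : \sum_j r j * (y j / t) = (\sum_j r j * y j) / t.
  by rewrite mulr_suml; apply: eq_bigr => j _; rewrite mulrA.
have E2 : \sum_j r j * (t * x j) = t * \sum_j r j * x j.
  by rewrite mulr_sumr; apply: eq_bigr => j _; rewrite mulrCA.
by have := xopt _ yf; rewrite E1 E2 ler_pdivrMr// mulrC.
Qed.

(* On the good event the unconstrained IRT acceptances [z] can be completed,
   using only later arrivals, to a solution at least as good as any given one. *)
Lemma epoch_complete (k : R) (lam : 'I_n -> R) (c : 'I_m -> R)
    (sg d : R) (x D Lm z y : 'I_n -> R) :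
  (forall (U U' : 'I_n -> R) (c : 'I_m -> R) (d : R) (X y : 'I_n -> R),
    0 <= d -> lp_optimal r U A c X -> ho_feasible A c U' y ->
    (forall j, `|U j - U' j| <= d) ->
    exists y', [/\ ho_feasible A c U' y',
      \sum_j r j * y j <= \sum_j r j * y' j & forall j, `|y' j - X j| <= k * d]) ->
  2 <= sg -> 0 <= d -> (forall j, 0 < lam j) ->
  (forall j, (k + 3) * d <= lam j * sg ^+ 7) ->
  lp_optimal r lam A (fun l => c l / sg ^+ 12) x ->
  (forall j, `|D j - lam j * sg ^+ 12| <= d) ->
  (forall j, `|Lm j - lam j * (sg ^+ 12 - sg ^+ 10)| <= d) ->
  (forall j, [\/ x j < lam j * sg ^- 3 /\ z j = 0,
     lam j * (1 - sg ^- 3) < x j /\ z j = Lm j |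
     lam j * sg ^- 3 <= x j <= lam j * (1 - sg ^- 3) /\
       `|z j - x j * (sg ^+ 12 - sg ^+ 10)| <= d]) ->
  ho_feasible A c D y ->
  exists y', [/\ ho_feasible A c D y', \sum_j r j * y j <= \sum_j r j * y' j &
    forall j, z j <= y' j /\ y' j - z j <= D j - Lm j].
Proof.
move=> stab sg2 d0 lam0 kd xopt HD HL Hz yf.
have s0 : 0 < sg by lra.
have s12 : 0 < sg ^+ 12 by rewrite exprn_gt0.
have Xopt := lp_optimal_scale s12 xopt.
have [|y' [y'f ry y'X]] := stab _ D c d _ y d0 Xopt yf.
  by move=> j; rewrite distrC.
exists y'; split=> // j.
have /andP[y'0 y'D] := y'f.2 j.
have /andP[x0 x1] := xopt.1.2 j.
have sV : sg ^+ 3 * sg ^- 3 = 1 by rewrite mulfV// gt_eqF// exprn_gt0.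
have E9 : sg ^+ 12 * sg ^- 3 = sg ^+ 9 by rewrite (exprD sg 9 3) -mulrA sV mulr1.
have E7 : sg ^+ 10 * sg ^- 3 = sg ^+ 7 by rewrite (exprD sg 7 3) -mulrA sV mulr1.
(* In the two thresholded cases the fluid count is within [lam j * sg ^ 9] of [0] or of the full
   demand. The later arrivals, about [lam j * sg ^ 10], absorb this together with the deviations as
   soon as [2 <= sg]. *)
have H97 : sg ^+ 9 + sg ^+ 7 <= sg ^+ 10.
  have h1 : sg ^+ 7 <= sg ^+ 9 by apply: ler_weXn2l => //; lra.
  have h2 : 2 * sg ^+ 9 <= sg ^+ 10 by rewrite [sg ^+ 10]exprS ler_wpM2r// exprn_ge0// ltW.
  lra.
have lH : lam j * sg ^+ 9 + lam j * sg ^+ 7 <= lam j * sg ^+ 10.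
  by rewrite -mulrDr ler_wpM2l// ltW.
have := kd j; have := y'X j; have := HD j; have := HL j.
rewrite !ler_norml => /andP[L1 L2] /andP[D1 D2] /andP[Y1 Y2] kdj.
case: (Hz j) => [[xs ->]|[xs ->]|[/andP[xs1 xs2] ]].
- have : sg ^+ 12 * x j <= sg ^+ 12 * (lam j * sg ^- 3) by rewrite ler_wpM2l ?ltW.
  by rewrite mulrCA E9 => H; split => //; lra.
- have : sg ^+ 12 * (lam j * (1 - sg ^- 3)) <= sg ^+ 12 * x j by rewrite ler_wpM2l ?ltW.
  by rewrite mulrCA mulrBr E9 mulr1 => H; split; lra.
(* Here [y' j - z j] is [x j * sg ^ 10] up to [(k + 1) * d], and [D j - Lm j] is [lam j * sg ^ 10]
   up to [2 * d]. The thresholds leave the margin [lam j * sg ^ 7] on both sides, whence the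
   requirement on [(k + 3) * d]. *)
- rewrite ler_norml => /andP[Z1 Z2].
  have : sg ^+ 10 * (lam j * sg ^- 3) <= sg ^+ 10 * x j.
    by rewrite ler_wpM2l// exprn_ge0// ltW.
  have : sg ^+ 10 * x j <= sg ^+ 10 * (lam j * (1 - sg ^- 3)).
    by rewrite ler_wpM2l// exprn_ge0// ltW.
  rewrite mulrCA mulrBr E7 mulr1 [X in _ -> X <= _ -> _]mulrCA E7 => H1 H2.
  by split; lra.
Qed.

End Hindsight.

Section Fold.
Context (R : realType) (m n : nat) (r lam : 'I_n -> R) (A : 'M[R]_(m, n)).
Variable sol : nat -> ('I_m -> R) -> 'I_n -> R.
Variables (T : nat) (E U : 'I_n -> nat -> R).
Hypothesis A0 : forall l j, 0 <= A l j.

Local Notation step := (irt_step r lam A sol T E U).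
Local Notation ep a := (epoch T (arr_time E a.1 a.2)).

(** The acceptances of the block at fixed probabilities [q] if capacity were unlimited. *)
Definition coins (s : seq ('I_n * nat)) (q : 'I_n -> R) (j : 'I_n) : nat :=
  count (fun a => (a.1 == j) && (U a.1 a.2 < q a.1)) s.

Definition class_count (s : seq ('I_n * nat)) (j : 'I_n) : nat :=
  count (fun a => a.1 == j) s.

Arguments coins : simpl never.
Arguments class_count : simpl never.

Lemma sum_delta (f : 'I_n -> R) (z : 'I_n -> nat) i :
  \sum_j f j * ((j == i) + z j)%:R = f i + \sum_j f j * (z j)%:R.
Proof.
under eq_bigr do rewrite natrD mulrDr.
rewrite big_split/=; congr (_ + _).
rewrite (bigD1 i)//= eqxx mulr1 big1 ?addr0// => j /negbTE ->.
by rewrite mulr0.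
Qed.

(** For the last clause: consumption is nonnegative, so if all customers with a successful coin fit
    together, each of them fits on arrival and the capacity test never rejects one. *)
Lemma irt_block_in (s : seq ('I_n * nat)) u q c rho :
  (forall a, a \in s -> ep a = u) -> (forall l, 0 <= c l) ->
  exists z : 'I_n -> nat,
  [/\ foldl step (c, rho, Some u, q) s =
      (fun l => c l - \sum_j A l j * (z j)%:R, rho + \sum_j r j * (z j)%:R, Some u, q),
     forall l, 0 <= c l - \sum_j A l j * (z j)%:R,
     forall j, (z j <= class_count s j)%N &
     (forall l, \sum_j A l j * (coins s q j)%:R <= c l) -> forall j, z j = coins s q j].
Proof.
elim: s c rho => [|[i k] s IH] c rho Hs c0.
  exists (fun=> 0%N); split=> //=.
  - congr (_, _, _, _); last by rewrite big1 ?addr0// => j _; rewrite mulr0.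
    by apply/funext => l; rewrite big1 ?subr0// => j _; rewrite mulr0.
  - by move=> l; rewrite big1 ?subr0// => j _; rewrite mulr0.
have Hs' a : a \in s -> ep a = u by move=> as_; apply: Hs; rewrite inE as_ orbT.
have epi : epoch T (arr_time E i k) = u by apply: (Hs (i, k)); rewrite mem_head.
have coinsE j : coins ((i, k) :: s) q j = ((j == i) && (U i k < q i)%R + coins s q j)%N.
  by rewrite /coins/= eq_sym.
have ccE j : class_count ((i, k) :: s) j = ((j == i) + class_count s j)%N.
  by rewrite /class_count/= eq_sym.
rewrite /= epi eqxx.
have [/andP[/forallP fits coin]|nacc] := boolP (_ && _).
  have [|z [Hf Hc Hz Hcoin]] := IH (fun l => c l - A l i) (rho + r i) Hs'.
    by move=> l; rewrite subr_ge0.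
  exists (fun j => ((j == i) + z j)%N); rewrite Hf; split.
  - by congr (_, _, _, _); [apply/funext => l|]; rewrite sum_delta; ring.
  - by move=> l; have := Hc l; rewrite sum_delta opprD addrA.
  - by move=> j; rewrite ccE leq_add2l.
  - move=> H j; rewrite coinsE coin andbT Hcoin// => l.
    have := H l; under eq_bigr do rewrite coinsE coin andbT.
    by rewrite sum_delta; lra.
have [z [Hf Hc Hz Hcoin]] := IH c (rho + 0) Hs' c0.
exists z; rewrite Hf; split => //.
- by rewrite addr0.
- by move=> j; rewrite ccE (leq_trans (Hz j))// leq_addl.
- move=> H j; rewrite coinsE.
(* A rejected customer with a successful coin would not fit, against the assumption that all
   successful coins fit together. *)
have ncoin : (U i k < q i)%R = false.
  apply/negP => coin; case/negP: nacc; rewrite coin andbT; apply/forallP => l.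
  apply: le_trans (H l); under eq_bigr do rewrite coinsE coin andbT.
  by rewrite sum_delta lerDl sumr_ge0// => ? _; rewrite mulr_ge0.
rewrite ncoin andbF Hcoin// => l.
by have := H l; under eq_bigr do rewrite coinsE ncoin andbF.
Qed.

(** The first arrival of a block triggers the re-solving; from then on [irt_block_in] applies. An
    empty block leaves the recorded epoch untouched, whence the alternative for [cur']. *)
Lemma irt_block (s : seq ('I_n * nat)) u c rho cur p :
  (forall a, a \in s -> ep a = u) -> (forall l, 0 <= c l) -> cur != Some u ->
  let q := p_irt lam T u (sol u (fun l => c l / tau_irt R T u)) in
  exists (z : 'I_n -> nat) cur' p',
  [/\ foldl step (c, rho, cur, p) s =
      (fun l => c l - \sum_j A l j * (z j)%:R, rho + \sum_j r j * (z j)%:R, cur', p'),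
     (cur' = cur \/ cur' = Some u) /\ forall l, 0 <= c l - \sum_j A l j * (z j)%:R,
     forall j, (z j <= class_count s j)%N &
     (forall l, \sum_j A l j * (coins s q j)%:R <= c l) -> forall j, z j = coins s q j].
Proof.
move=> Hs c0 curu q.
have [z [Hf Hc Hz Hcoin]] := irt_block_in q rho Hs c0.
case: s Hs Hf Hc Hz Hcoin => [|[i k] s] Hs Hf Hc Hz Hcoin.
  exists z, cur, p; split=> //; last by split=> //; left.
  by move: Hf => /= [<- <-].
exists z, (Some u), q; split=> //; last by split=> //; right.
rewrite -Hf /=.
have epi : epoch T (arr_time E i k) = u by apply: (Hs (i, k)); rewrite mem_head.
by rewrite epi eqxx (negbTE curu).
Qed.

End Fold.

(** * Independence and exponential moments *)

Section Independence.
Context d (Omega : measurableType d) (R : realType) (P : probability Omega R).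
Context (I : eqType) (X : I -> Omega -> R).

(** [W] stands for a function of the variables indexed by [S]. All that is kept of this is its
    independence from finite families of the others, tested on rectangles, a property that is stable
    under adjoining one variable at a time. *)
Definition indep_off (S : pred I) (W : Omega -> R) : Prop :=
  measurable_fun setT W /\
  forall (s : seq I) (B : I -> set R) (B0 : set R), uniq s ->
    (forall i, i \in s -> ~~ S i) -> (forall i, measurable (B i)) ->
    measurable B0 ->
    P (W @^-1` B0 `&` \big[setI/setT]_(i <- s) (X i @^-1` B i)) =
    (P (W @^-1` B0) * P (\big[setI/setT]_(i <- s) (X i @^-1` B i)))%E.

Hypothesis indX : mut_indep P X.

Let mX i : measurable_fun setT (X i). Proof. by have [] := indX. Qed.

Lemma measurable_bigpre (s : seq I) (B : I -> set R) :
  (forall i, measurable (B i)) ->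
  measurable (\big[setI/setT]_(i <- s) (X i @^-1` B i)).
Proof.
move=> mB; elim: s => [|i s IH]; first by rewrite big_nil; exact: measurableT.
rewrite big_cons; apply: measurableI => //.
by rewrite -[X in measurable X]setTI; exact: mX.
Qed.

Lemma indep_off_cst (S : pred I) (c : R) : indep_off S (fun=> c).
Proof.
split; first exact: measurable_cst.
move=> s B B0 _ _ mB mB0.
have [B0c|B0c] := pselect (B0 c).
  have -> : (fun=> c) @^-1` B0 = [set: Omega].
    by apply/seteqP; split.
  by rewrite setTI probability_setT mul1e.
have -> : (fun=> c) @^-1` B0 = set0 :> set Omega.
  by apply/seteqP; split.
by rewrite set0I measure0 mul0e.
Qed.

Section Step.
Variables (S : pred I) (W : Omega -> R) (i : I).
Hypothesis indW : indep_off S W.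
Hypothesis Si : ~~ S i.

Let mW : measurable_fun setT W. Proof. by have [] := indW. Qed.

Let WX (w : Omega) : R * R := (W w, X i w).
Let Xi (w : Omega) : R := X i w.

Let mWX : measurable_fun setT WX.
Proof. exact: measurable_fun_pair. Qed.

Let pW : {mfun Omega >-> R} := HB.pack W (isMeasurableFun.Build _ _ _ _ W mW).
Let pX : {mfun Omega >-> R} :=
  HB.pack Xi (isMeasurableFun.Build _ _ _ _ Xi (@mX i)).
Let pWX : {mfun Omega >-> (R * R)%type} :=
  HB.pack WX (isMeasurableFun.Build _ _ _ _ WX mWX).

Lemma joint_rect (s : seq I) (B : I -> set R) (B0 B1 : set R) :
  uniq s -> (forall k, k \in s -> ~~ S k && (k != i)) ->
  (forall i, measurable (B i)) -> measurable B0 -> measurable B1 ->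
  P (W @^-1` B0 `&` X i @^-1` B1 `&` \big[setI/setT]_(k <- s) (X k @^-1` B k)) =
  (P (W @^-1` B0) * P (X i @^-1` B1) * P (\big[setI/setT]_(k <- s) (X k @^-1` B k)))%E.
Proof.
move=> us sS mB mB0 mB1.
pose B' k := if k == i then B1 else B k.
have B'i : B' i = B1 by rewrite /B' eqxx.
have mB' k : measurable (B' k) by rewrite /B'; case: ifP.
have is_ : i \notin s.
  by apply/negP => /sS; rewrite eqxx andbF.
have eqs : \big[setI/setT]_(k <- s) (X k @^-1` B k) =
           \big[setI/setT]_(k <- s) (X k @^-1` B' k).
  rewrite !big_seq; apply: eq_bigr => k ks.
  by rewrite /B' ifF//; apply/negbTE; have /andP[] := sS _ ks.
have [_ indB] := indX.
have := proj2 indW (i :: s) B' B0 _ _ mB' mB0.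
rewrite big_cons -eqs B'i setIA => ->.
- rewrite -muleA; congr (_ * _)%E.
  have := indB (i :: s) B' _ mB'; rewrite !big_cons -eqs B'i => ->.
    by rewrite -(indB s B' us mB') -eqs.
  by rewrite /= is_.
- by rewrite /= is_.
- move=> k; rewrite inE => /orP[/eqP ->//|/sS /andP[]//].
Qed.

Lemma joint_law (D : set (R * R)) : measurable D ->
  (distribution P pW \x distribution P pX)%E D =
  P ((fun w => (W w, X i w)) @^-1` D).
Proof.
move=> mD.
apply: (product_measure_unique
  (m' := distribution P pWX)) => //= B0 B1 mB0 mB1.
rewrite /distribution /pushforward.
have := @joint_rect [::] (fun=> setT) B0 B1 isT _ (fun=> measurableT) mB0 mB1.
by rewrite big_nil setIT probability_setT mule1 => <-.
Qed.

(** Let [F] be the event on the other variables. The restriction of [P] to [F] and the multiple of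
    [P] by [P F] push forward to measures on the plane that agree on rectangles, hence both equal
    the same product measure. *)
Lemma joint_indep (s : seq I) (B : I -> set R) (D : set (R * R)) :
  uniq s -> (forall k, k \in s -> ~~ S k && (k != i)) ->
  (forall i, measurable (B i)) -> measurable D ->
  P ((fun w => (W w, X i w)) @^-1` D `&` \big[setI/setT]_(k <- s) (X k @^-1` B k)) =
  (P ((fun w => (W w, X i w)) @^-1` D) * P (\big[setI/setT]_(k <- s) (X k @^-1` B k)))%E.
Proof.
move=> us sS mB mD.
set F := \big[setI/setT]_(k <- s) _.
have mF : measurable F by exact: measurable_bigpre.
have pF0 : 0 <= fine (P F) by rewrite fine_ge0.
pose c := NngNum pF0.
have cE : (c%:num%:E = P F)%E by rewrite /= fineK// fin_num_measure.
pose m1 := mscale c (distribution P pW).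
have H1 := product_measure_unique
  (m1 := m1) (m2 := distribution P pX)
  (m' := mscale c (distribution P pWX)).
have H2 := product_measure_unique
  (m1 := m1) (m2 := distribution P pX)
  (m' := pushforward (mrestr P mF) pWX).
rewrite muleC -cE.
transitivity ((pushforward (mrestr P mF) pWX) D); first by [].
transitivity ((mscale c (distribution P pWX)) D); last by [].
rewrite -H1// -?H2// => B0 B1 mB0 mB1.
- rewrite /= /pushforward /mrestr /m1 /mscale cE /distribution /pushforward.
  have := joint_rect us sS mB mB0 mB1.
  by rewrite -/F => ->; rewrite muleC muleA.
- rewrite /= /m1 /mscale /distribution /pushforward cE -muleA; congr (_ * _)%E.
  have := @joint_rect [::] (fun=> setT) B0 B1 isT _ (fun=> measurableT) mB0 mB1.
  by rewrite big_nil setIT probability_setT mule1 => <-.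
Qed.

Lemma indep_off_step (g : R * R -> R) : measurable_fun setT g ->
  indep_off (fun k => S k || (k == i)) (fun w => g (W w, X i w)).
Proof.
move=> mg; split; first exact: measurableT_comp.
move=> s B B0 us sS mB mB0.
have mD : measurable (g @^-1` B0) by rewrite -[X in measurable X]setTI; exact: mg.
apply: (joint_indep us _ mB mD) => k /sS.
by rewrite negb_or.
Qed.

(** Tonelli for the product law: [X i] may be integrated out first with [W] frozen. *)
Lemma joint_expectation (f : R * R -> R) : measurable_fun setT f ->
  (forall z, 0 <= f z) ->
  (\int[P]_w (f (W w, X i w))%:E =
   \int[P]_w \int[P]_w' (f (W w, X i w'))%:E)%E.
Proof.
move=> mf f0.
have /measurable_EFinP mEf := mf.
have Ef0 z : (0 <= (EFin \o f) z)%E by rewrite /= lee_fin.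
transitivity (\int[distribution P pWX]_z (EFin \o f) z)%E.
  by rewrite ge0_integral_distribution.
transitivity (\int[(distribution P pW \x distribution P pX)%E]_z (EFin \o f) z)%E.
  by apply: eq_measure_integral => D mD _; apply: esym; exact: joint_law.
rewrite fubini_tonelli1// /fubini_F.
rewrite (@ge0_integral_distribution _ _ _ _ _ P pW)//.
- apply: eq_integral => w _ /=.
  rewrite (@ge0_integral_distribution _ _ _ _ _ P pX (fun y => (EFin \o f) (W w, y)))//.
  exact: measurableT_comp.
- exact: measurable_fun_fubini_tonelli_F.
- by move=> y; apply: integral_ge0.
Qed.

End Step.
End Independence.

(** * Densities and the moments of the exponential law *)

Section Density.
Context d (T : measurableType d) (R : realType).
Variables (mu m : {measure set T -> \bar R}) (phi : T -> R).
Hypothesis phi0 : forall x, 0 <= phi x.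
Hypothesis mphi : measurable_fun setT phi.
Hypothesis mE : forall V, measurable V -> m V = (\int[mu]_(x in V) (phi x)%:E)%E.
Local Open Scope ereal_scope.

Let mEphi : measurable_fun setT (fun x => (phi x)%:E).
Proof. exact/measurable_EFinP. Qed.

Let density_indic E : measurable E ->
  \int[m]_x (\1_E x)%:E = \int[mu]_x ((\1_E x)%:E * (phi x)%:E).
Proof.
move=> mE'; rewrite integral_indic//= setIT mE// integral_mkcond/=.
apply: eq_integral => x _; rewrite patchE indicE.
by case: ifPn => xE; rewrite /= ?mul1e ?mul0e.
Qed.

Import HBNNSimple.

Let density_nnsfun (f : {nnsfun T >-> R}) :
  \int[m]_x (f x)%:E = \int[mu]_x ((f x)%:E * (phi x)%:E).
Proof.
under [LHS]eq_integral do rewrite fimfunE -fsumEFin//.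
rewrite [LHS]ge0_integral_fsum//; last 2 first.
  - by move=> r; exact/measurable_EFinP/measurableT_comp.
  - by move=> n x _; rewrite EFinM nnfun_muleindic_ge0.
under [RHS]eq_integral.
  move=> x xD; rewrite fimfunE -fsumEFin// muleC ge0_mule_fsumr; last first.
    by move=> r; rewrite EFinM nnfun_muleindic_ge0.
  over.
rewrite [RHS]ge0_integral_fsum//; last 2 first.
  - move=> r; apply: emeasurable_funM => //.
    exact/measurable_EFinP/measurableT_comp.
  - by move=> n x _; rewrite mule_ge0 ?lee_fin//; rewrite -lee_fin EFinM nnfun_muleindic_ge0.
apply: eq_fsbigr => r rf.
have r0 : (0 <= r)%R by move: rf; rewrite inE => -[x _ <-].
under eq_integral do rewrite EFinM.
rewrite ge0_integralZl//; last exact/measurable_EFinP.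
rewrite density_indic//.
under [RHS]eq_integral do rewrite muleC EFinM -muleA.
rewrite ge0_integralZl//.
- by apply: emeasurable_funM => //; exact/measurable_EFinP.
- by move=> x _; rewrite -EFinM lee_fin mulr_ge0.
Qed.

(** The model gives the law of an inter-arrival time on sets; simple functions and monotone
    convergence turn this into integrals against the density. *)
Lemma ge0_integral_density (f : T -> R) : measurable_fun setT f ->
  (forall x, 0 <= f x)%R ->
  \int[m]_x (f x)%:E = \int[mu]_x (f x * phi x)%:E.
Proof.
move=> mf f0.
have mEf : measurable_fun setT (fun x => (f x)%:E) by exact/measurable_EFinP.
pose f_ := nnsfun_approx measurableT mEf.
have f_cvg x : (f_ n x)%:E @[n --> \oo] --> (f x)%:E.
  by apply: (@cvg_nnsfun_approx _ _ _ _ measurableT _ mEf) => // y _; rewrite lee_fin.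
transitivity (lim (\int[m]_x (f_ n x)%:E @[n --> \oo])).
  rewrite -monotone_convergence//=.
  - by apply: eq_integral => x _; apply/esym/cvg_lim.
  - by move=> n; exact/measurable_EFinP/measurable_funTS.
  - by move=> n ? _; rewrite lee_fin.
  - by move=> ? _ ? ? mn; rewrite lee_fin; exact/lefP/nd_nnsfun_approx.
under eq_fun do rewrite density_nnsfun.
rewrite -monotone_convergence//=.
- apply: eq_integral => x _; apply/cvg_lim => //; rewrite EFinM.
  by apply: cvgeZr.
- by move=> n; apply: emeasurable_funM => //; exact/measurable_EFinP/measurable_funTS.
- by move=> n ? _; rewrite mule_ge0// lee_fin.
- move=> x _ a b ab; rewrite lee_wpmul2r ?lee_fin//.
  exact/lefP/nd_nnsfun_approx.
Qed.

End Density.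

Section ExponentialLaw.
Context (R : realType).
Local Notation mu := (@lebesgue_measure R).

Lemma exponential_tail (rate h : R) : 0 < rate -> 0 <= h ->
  (\int[mu]_(x in `[h, +oo[) (exponential_pdf rate x)%:E = (expR (- rate * h))%:E)%E.
Proof.
move=> rate0 h0.
have cexpNM : continuous (fun z : R^o => expR (- rate * z)).
  move=> z; apply: continuous_comp; last exact: continuous_expR.
  by apply: continuousM => //; apply: (@continuousN _ R^o); exact: cst_continuous.
rewrite (@ge0_continuous_FTC2y _ _
  (fun x => - (expR (- rate * x))) _ 0)//.
- by rewrite EFinN oppeK add0e.
- by move=> x _; apply: exponential_pdf_ge0; exact: ltW.
- apply: continuous_subspaceW (@within_continuous_exponential_pdf R rate).
  by move=> x /=; rewrite !in_itv/= !andbT; exact: le_trans.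
- rewrite -oppr0; apply: cvgN.
  rewrite (_ : (fun x => expR (- rate * x)) =
               (fun z => expR (- z)) \o (fun z => rate * z)); last first.
    by apply: eq_fun => x; rewrite mulNr.
  apply: (@cvg_comp _ _ _ _ _ _ (pinfty_nbhs R)); last exact: cvgr_expR.
  exact: gt0_cvgMry.
- by apply: cvgN; apply/cvg_at_right_filter; exact: cexpNM.
- move=> x; rewrite in_itv/= andbT => hx; apply: derive1_exponential_pdf => //.
  by rewrite in_itv/= andbT; exact: le_lt_trans hx.
Qed.

End ExponentialLaw.

Lemma measurable_natb d (T : measurableType d) (R : realType) (b : T -> bool) :
  measurable_fun setT b -> measurable_fun setT (fun x => (b x)%:R : R).
Proof.
move=> mb; have mnat : measurable_fun setT (fun b : bool => b%:R : R).
  by move=> _ V mV; rewrite setTI.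
exact: (measurableT_comp mnat mb).
Qed.

Section ExpMoment.
Context d (Omega : measurableType d) (R : realType) (P : probability Omega R).

(** Tilting turns the density of rate [rate] into a multiple of the density of rate
    [rate * (1 + y)], whose tail beyond [h] is explicit. The result is the probability of exceeding
    [h] times [(1 + y)^-1], the moment of a fresh exponential variable. Values of [y] between [-1]
    and [0] serve for late arrivals. *)
Lemma exp_memoryless (Y : Omega -> R) (rate h y : R) :
  measurable_fun setT Y ->
  (forall V, measurable V -> P (Y @^-1` V) = exponential_prob rate V) ->
  0 < rate -> 0 <= h -> 0 < 1 + y ->
  (\int[P]_w ((h <= Y w)%R%:R * expR (- (y * rate) * (Y w - h)))%:E =
   (expR (- rate * h) / (1 + y))%:E)%E.
Proof.
move=> mY lawY rate0 h0 y1.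
pose pY : {mfun Omega >-> measurableTypeR R} :=
  HB.pack (Y : Omega -> measurableTypeR R)
    (isMeasurableFun.Build _ _ _ (measurableTypeR R) Y mY).
pose f x : R := (h <= x)%R%:R * expR (- (y * rate) * (x - h)).
have f0 x : 0 <= f x by rewrite mulr_ge0 ?expR_ge0.
have mf : measurable_fun setT f.
  apply: measurable_funM.
    by apply: measurable_natb; exact: measurable_fun_ler.
  apply: measurableT_comp => //; apply: measurable_funM => //.
  exact: measurable_funB.
transitivity (\int[distribution P pY]_x (f x)%:E)%E.
  by rewrite ge0_integral_distribution//; exact/measurable_EFinP.
have pdf0 x : 0 <= exponential_pdf rate x by apply: exponential_pdf_ge0; exact: ltW.
have mpdf := @measurable_exponential_pdf R rate.
transitivity (\int[@lebesgue_measure R]_x (f x * exponential_pdf rate x)%:E)%E.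
  exact: (@ge0_integral_density _ _ _ lebesgue_measure (distribution P pY) _
            pdf0 mpdf lawY f mf f0).
have -> : (fun x => (f x * exponential_pdf rate x)%:E) =
    (fun x => (expR (y * rate * h) / (1 + y))%:E *
      (((fun x => (exponential_pdf (rate * (1 + y)) x)%:E) \_ `[h, +oo[) x))%E.
    apply/funext => x; rewrite patchE mem_setE/= in_itv/= andbT /f.
    case: ifPn => hx; last by rewrite mule0 mul0r mul0r.
    have x0 : 0 <= x by exact: le_trans hx.
    rewrite -EFinM !exponential_pdfE// mul1r; congr EFin.
    have -> : expR (- (y * rate) * (x - h)) = expR (y * rate * h) * expR (- (y * rate) * x).
      by rewrite -expRD; congr expR; ring.
    have -> : expR (- (rate * (1 + y)) * x) = expR (- (y * rate) * x) * expR (- rate * x).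
      by rewrite -expRD; congr expR; ring.
    by field; rewrite gt_eqF.
rewrite ge0_integralZl//.
- rewrite -integral_mkcond exponential_tail//; last exact: mulr_gt0.
  rewrite -EFinM mulrAC -expRD; congr (_ / _)%:E; congr expR; ring.
- apply/(measurable_restrictT _ _).1 => //.
  apply/measurable_EFinP/measurable_funTS.
  by apply: measurable_exponential_pdf.
- move=> x _; rewrite patchE; case: ifP => // _.
  by rewrite lee_fin exponential_pdf_ge0// mulr_ge0// ltW.
- by rewrite lee_fin divr_ge0 ?expR_ge0// ltW.
Qed.

Lemma exp_mgf (Y : Omega -> R) (rate y : R) :
  measurable_fun setT Y ->
  (forall V, measurable V -> P (Y @^-1` V) = exponential_prob rate V) ->
  0 < rate -> 0 < 1 + y ->
  (\int[P]_w (expR (- (y * rate) * Y w))%:E = ((1 + y)^-1)%:E)%E.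
Proof.
move=> mY lawY rate0 y1.
have := exp_memoryless mY lawY rate0 (lexx 0) y1.
rewrite mulr0 expR0 div1r => <-.
apply: ae_eq_integral => //.
- apply/measurable_EFinP; apply: measurableT_comp => //; exact: measurable_funM.
- apply/measurable_EFinP; apply: measurable_funM.
    by apply: measurable_natb; exact: measurable_fun_ler.
  apply: measurableT_comp => //; apply: measurable_funM => //.
  exact: measurable_funB.
- exists (Y @^-1` [set` `]-oo, 0[%R]); split.
  + rewrite -[X in measurable X]setTI; apply: mY => //.
  + apply: etrans (lawY _ _) _ => //.
    rewrite /exponential_prob; apply: integral0_eq => x /=.
    by rewrite in_itv/= => x0; rewrite lt0_exponential_pdf.
  + move=> w /=; rewrite in_itv/= => H; rewrite ltNge; apply/negP => Y0.
    by apply: H => _; rewrite Y0 mul1r subr0.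
Qed.

End ExpMoment.

Lemma integral_natb d (T : measurableType d) (R : realType)
    (P : {measure set T -> \bar R}) (b : T -> bool) :
  measurable_fun setT b -> (\int[P]_w (b w)%:R%:E = P [set w | b w])%E.
Proof.
move=> mb; have mB : measurable [set w | b w].
  by rewrite -[X in measurable X]setTI; apply: (mb measurableT [set true]).
rewrite -[in RHS](setIT [set w | b w]) -integral_indic//.
apply: eq_integral => w _; rewrite indicE; congr (_%:R%:E).
by case: (boolP (b w)) => bw; [rewrite mem_set|rewrite memNset//=; exact/negP].
Qed.

Section Chain.
Context d (Omega : measurableType d) (R : realType) (P : probability Omega R).
Context (I : eqType) (X : I -> Omega -> R).
Hypothesis indX : mut_indep P X.

Let mX i : measurable_fun setT (X i). Proof. by have [] := indX. Qed.

Lemma indep_off_sub (S S' : pred I) W : (forall i, S i -> S' i) ->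
  indep_off P X S W -> indep_off P X S' W.
Proof.
move=> SS' [mW H]; split => // s B B0 us sS'; apply: H => // i /sS'.
by apply: contra; exact: SS'.
Qed.

Lemma indep_mul_step (S : pred I) W i (phi : R -> R) (c : R) :
  indep_off P X S W -> (forall w, 0 <= W w) -> ~~ S i ->
  measurable_fun setT phi -> (forall x, 0 <= phi x) ->
  (\int[P]_w (phi (X i w))%:E = c%:E)%E ->
  indep_off P X (fun k => S k || (k == i)) (fun w => W w * phi (X i w)) /\
  (\int[P]_w (W w * phi (X i w))%:E = (\int[P]_w (W w)%:E) * c%:E)%E.
Proof.
move=> iW W0 Si mphi phi0 Ec.
have [mW _] := iW.
have mg : measurable_fun setT (fun z : R * R => z.1 * phi z.2).
  by apply: measurable_funM => //; exact: measurableT_comp.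
split; first exact: (indep_off_step indX iW Si mg).
(* The absolute value makes the integrand nonnegative on the whole plane; it changes nothing on the
   values of [W]. *)
have mg' : measurable_fun setT (fun z : R * R => `|z.1| * phi z.2).
  apply: measurable_funM => //; last exact: measurableT_comp.
  exact: measurableT_comp.
have := joint_expectation indX iW Si mg' (fun z => mulr_ge0 (normr_ge0 _) (phi0 _)).
under eq_integral do rewrite /= ger0_norm//.
move=> ->.
have c0 : 0 <= c by rewrite -lee_fin -Ec; apply: integral_ge0 => w _; rewrite lee_fin.
rewrite -ge0_integralZr//; [|exact/measurable_EFinP|by move=> w _; rewrite lee_fin].
apply: eq_integral => w _.
under eq_integral do rewrite /= EFinM.
rewrite ge0_integralZl ?Ec ?ger0_norm ?lee_fin//.
- by apply/measurable_EFinP; exact: measurableT_comp.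
- by move=> w' _; rewrite lee_fin.
Qed.

(** The product formula behind a Chernoff bound, taken relative to a weight [W] that depends on the
    past. *)
Lemma indep_prod (S : pred I) W (idx : nat -> I) (phi : R -> R) (c : R) :
  indep_off P X S W -> (forall w, 0 <= W w) -> (forall k, ~~ S (idx k)) ->
  injective idx ->
  measurable_fun setT phi -> (forall x, 0 <= phi x) ->
  (forall k, \int[P]_w (phi (X (idx k) w))%:E = c%:E)%E ->
  forall k, (\int[P]_w (W w * \prod_(i < k) phi (X (idx i) w))%:E =
             (\int[P]_w (W w)%:E) * (c ^+ k)%:E)%E.
Proof.
move=> iW W0 Sidx inj mphi phi0 Ec k.
suff [] : indep_off P X (fun i => S i || (i \in [seq idx l | l <- iota 0 k]))
    (fun w => W w * \prod_(i < k) phi (X (idx i) w)) /\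
   (\int[P]_w (W w * \prod_(i < k) phi (X (idx i) w))%:E =
             (\int[P]_w (W w)%:E) * (c ^+ k)%:E)%E by [].
elim: k => [|k [IH1 IH2]].
  have e0 : (fun w => W w * \prod_(i < 0) phi (X (idx i) w)) = W.
    by apply/funext => w; rewrite big_ord0 mulr1.
  split; first by rewrite e0; apply: indep_off_sub iW => i ->.
  by rewrite mule1; under eq_integral do rewrite big_ord0 mulr1.
have e1 : (fun w => W w * \prod_(i < k.+1) phi (X (idx i) w)) =
  (fun w => (W w * \prod_(i < k) phi (X (idx i) w)) * phi (X (idx k) w)).
  by apply/funext => w; rewrite big_ord_recr/= mulrA.
have [||H1 H2] := indep_mul_step IH1 _ _ mphi phi0 (Ec k).
- by move=> w; rewrite mulr_ge0// prodr_ge0.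
- rewrite negb_or Sidx/= mem_map// mem_iota/= add0n ltnn.
  by [].
split.
  rewrite e1; apply: indep_off_sub H1 => i.
  rewrite -addn1 iotaD map_cat mem_cat/= inE.
  by rewrite orbA.
under eq_integral do rewrite big_ord_recr/= mulrA.
by rewrite H2 IH2 -muleA -EFinM exprSr.
Qed.

End Chain.

(** The arrival of index [k] occurs at [psum x k.+1]; [psum x 0] is the origin of time. *)
Definition psum (R : realType) (x : nat -> R) (a : nat) : R := \sum_(i < a) x i.

(* [a] is the index of the first arrival at or after time [s]; the case [a = 0]
   uses a large inequality so that it is not void at [s = 0]. *)
Definition first_after (R : realType) (x : nat -> R) (s : R) (a : nat) : bool :=
  (if a == 0%N then psum x a <= s else psum x a < s) && (s <= psum x a.+1).

Section FirstArrival.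
Context d (Omega : measurableType d) (R : realType) (P : probability Omega R).
Context (I : eqType) (X : I -> Omega -> R).
Hypothesis indX : mut_indep P X.
Variables (ie : nat -> I) (rate : R).
Hypothesis ie_inj : injective ie.
Hypothesis rate0 : 0 < rate.
Hypothesis law_ie : forall k V, measurable V ->
  P (X (ie k) @^-1` V) = exponential_prob rate V.
Variable s : R.

Let mX i : measurable_fun setT (X i). Proof. by have [] := indX. Qed.

Let Y (w : Omega) (k : nat) : R := X (ie k) w.

Lemma measurable_psum a : measurable_fun setT (fun w => psum (Y w) a).
Proof. by apply: (@measurable_sum _ _ _ _ _ _ (fun i : 'I_a => X (ie i))) => i; exact: mX. Qed.

Lemma measurable_first_after a :
  measurable_fun setT (fun w => first_after (Y w) s a).
Proof.
apply: measurable_and; last first.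
  by apply: measurable_fun_ler => //; exact: measurable_psum.
case: (a == 0%N).
  by apply: measurable_fun_ler => //; exact: measurable_psum.
by apply: measurable_fun_ltr => //; exact: measurable_psum.
Qed.

Definition used (a : nat) : pred I := fun i => i \in [seq ie k | k <- iota 0 a].

Lemma usedN a k : (a <= k)%N -> ~~ used a (ie k).
Proof. by move=> ak; rewrite /used mem_map// mem_iota/= add0n -leqNgt. Qed.

Lemma usedS a i : used a i || (i == ie a) -> used a.+1 i.
Proof. by rewrite /used -addn1 iotaD map_cat mem_cat/= inE. Qed.

Lemma indep_psum a : indep_off P X (used a) (fun w => psum (Y w) a).
Proof.
elim: a => [|a IH].
  have -> : (fun w => psum (Y w) 0) = (fun=> 0).
    by apply/funext => w; rewrite /psum big_ord0.
  exact: indep_off_cst.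
have -> : (fun w => psum (Y w) a.+1) =
          (fun w => (fun z : R * R => z.1 + z.2) (psum (Y w) a, X (ie a) w)).
  by apply/funext => w; rewrite /psum big_ord_recr.
apply: (indep_off_sub (S := fun i => used a i || (i == ie a)) (@usedS a)).
apply: (@indep_off_step _ _ _ _ _ _ indX _ _ _ IH (usedN (leqnn a)) (fun z => z.1 + z.2)).
exact: measurable_funD.
Qed.

(** The indicator that [a] is the first index after [s], times the tilt of the residual waiting
    time. It is a function of the pair formed by the preceding arrival time and the next
    inter-arrival time, so that the latter can be integrated out. *)
Definition fa_weight (y : R) (a : nat) (z : R * R) : R :=
  ((if a == 0%N then z.1 <= s else z.1 < s)%R && (s <= z.1 + z.2)%R)%:R *
  expR (- (y * rate) * (z.1 + z.2 - s)).

Lemma measurable_fa_weight y a : measurable_fun setT (fa_weight y a).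
Proof.
apply: measurable_funM.
  apply: measurable_natb; apply: measurable_and.
    case: (a == 0%N); first exact: measurable_fun_ler.
    exact: measurable_fun_ltr.
  by apply: measurable_fun_ler => //; exact: measurable_funD.
apply: measurableT_comp => //; apply: measurable_funM => //.
by apply: measurable_funB => //; exact: measurable_funD.
Qed.

Lemma fa_weightE y a w : fa_weight y a (psum (Y w) a, X (ie a) w) =
  (first_after (Y w) s a)%:R * expR (- (y * rate) * (psum (Y w) a.+1 - s)).
Proof. by rewrite /fa_weight /first_after /psum big_ord_recr. Qed.

(* Memorylessness: the residual time until the next arrival is again exponential. *)
Lemma fa_weight_mean y a : 0 < 1 + y ->
  (\int[P]_w (fa_weight y a (psum (Y w) a, X (ie a) w))%:E =
   P [set w | first_after (Y w) s a] * ((1 + y)^-1)%:E)%E.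
Proof.
move=> y1.
pose cond (v : R) : bool := if a == 0%N then (v <= s)%R else (v < s)%R.
have conds v : cond v -> v <= s by rewrite /cond; case: ifP => // _ /ltW.
pose H v : R := (cond v)%:R * expR (- rate * (s - v)).
have mH : measurable_fun setT H.
  apply: measurable_funM.
    apply: measurable_natb; rewrite /cond; case: (a == 0%N).
      exact: measurable_fun_ler.
    exact: measurable_fun_ltr.
  apply: measurableT_comp => //; apply: measurable_funM => //.
  exact: measurable_funB.
have E y' : 0 < 1 + y' ->
  (\int[P]_w (fa_weight y' a (psum (Y w) a, X (ie a) w))%:E =
   (\int[P]_w (H (psum (Y w) a))%:E) * ((1 + y')^-1)%:E)%E.
  move=> y'1.
  rewrite (joint_expectation indX (indep_psum a) (usedN (leqnn a)) (measurable_fa_weight y' a)); last first.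
    by move=> z; rewrite mulr_ge0 ?expR_ge0.
  rewrite -ge0_integralZr//; last 3 first.
  - apply/measurable_EFinP; apply: measurableT_comp => //; exact: measurable_psum.
  - by move=> w _; rewrite lee_fin mulr_ge0 ?expR_ge0.
  - by rewrite lee_fin invr_ge0 ltW.
  apply: eq_integral => w _; rewrite /H /fa_weight /= -/(cond _).
  have [cw|cw] := boolP (cond _); last first.
    by rewrite mul0r mul0e; apply: integral0_eq => w' _; rewrite mul0r.
  rewrite mul1r -EFinM -(exp_memoryless (mX (ie a)) (law_ie a) rate0)//; last first.
    by rewrite subr_ge0 conds.
  apply: eq_integral => w' _; rewrite lerBlDl; congr (_ * expR _)%:E.
  ring.
rewrite E//.
(* [H] does not depend on the tilt. At tilt [0] the weight is the plain indicator, which identifies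
   the integral of [H] with the probability of [first_after]. *)
have := E 0; rewrite addr0 invr1 mule1 => <-//.
congr (_ * _)%E; rewrite -integral_natb//; last exact: measurable_first_after.
by apply: eq_integral => w _; rewrite fa_weightE mul0r oppr0 mul0r expR0 mulr1.
Qed.

Lemma indep_fa y a :
  indep_off P X (used a.+1) (fun w => fa_weight y a (psum (Y w) a, X (ie a) w)).
Proof.
apply: (indep_off_sub (S := fun i => used a i || (i == ie a)) (@usedS a)).
exact: (@indep_off_step _ _ _ _ _ _ indX _ _ _ (indep_psum a) (usedN (leqnn a)) (fa_weight y a) (measurable_fa_weight y a)).
Qed.

(** The residual waiting time and the [k] inter-arrival times that follow contribute the same factor
    [(1 + y)^-1], hence the exponent [k.+1]. Positive [y] serves for arrivals that come too early,
    negative [y] for those that come too late; [C] carries the time limit. *)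
Lemma fa_chernoff (y C : R) (a k : nat) (F : Omega -> bool) :
  measurable_fun setT F -> 0 < 1 + y -> 0 <= C ->
  (forall w, F w -> 1 <= C * expR (- (y * rate) * (psum (Y w) (a + k).+1 - s))) ->
  (P [set w | first_after (Y w) s a && F w] <=
   P [set w | first_after (Y w) s a] * (C / (1 + y) ^+ k.+1)%:E)%E.
Proof.
move=> mF y1 C0 FC.
pose phi (x : R) := expR (- (y * rate) * x).
have mphi : measurable_fun setT phi.
  by apply: measurableT_comp => //; exact: measurable_funM.
have Ephi l : (\int[P]_w (phi (X (ie (a.+1 + l)) w))%:E = ((1 + y)^-1)%:E)%E.
  exact: exp_mgf (mX _) (law_ie _) rate0 y1.
have inj : injective (fun l => ie (a.+1 + l)) by move=> l l' /ie_inj /addnI.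
have HP := indep_prod indX (indep_fa y a)
  (fun w => mulr_ge0 (ler0n _ _) (expR_ge0 _))
  (fun l => usedN (leq_addr l a.+1)) inj mphi (fun=> expR_ge0 _) Ephi k.
rewrite fa_weight_mean// -muleA -EFinM -exprS in HP.
rewrite -integral_natb; last by apply: measurable_and => //; exact: measurable_first_after.
rewrite (mulrC C) -exprVn EFinM muleA -HP muleC.
have mW : measurable_fun setT (fun w => fa_weight y a (psum (Y w) a, X (ie a) w) *
     \prod_(i < k) phi (X (ie (a.+1 + i)) w)).
  apply: measurable_funM; first by have [] := indep_fa y a.
  by apply: measurable_prod => i _; exact: measurableT_comp.
have W0 w : 0 <= fa_weight y a (psum (Y w) a, X (ie a) w) *
     \prod_(i < k) phi (X (ie (a.+1 + i)) w).
  apply: mulr_ge0; first exact: mulr_ge0 (ler0n _ _) (expR_ge0 _).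
  by apply: prodr_ge0 => i _; exact: expR_ge0.
rewrite -ge0_integralZl//; [|exact/measurable_EFinP|by move=> w _; rewrite lee_fin].
apply: ge0_le_integral => //.
- apply/measurable_EFinP/measurable_natb/measurable_and => //.
  exact: measurable_first_after.
- by apply/measurable_EFinP; exact: measurable_funM.
move=> w _; rewrite -EFinM lee_fin.
have [/= /andP[fw Fw]|_] := boolP (_ && _); last by rewrite mulr_ge0.
apply: le_trans (FC w Fw) _; rewrite ler_wpM2l// fa_weightE fw mul1r.
rewrite -expR_sum -expRD ler_expR -mulr_sumr -mulrDr.
have -> : psum (Y w) (a + k).+1 =
   psum (Y w) a.+1 + \sum_(i < k) X (ie (a.+1 + i)) w.
  by rewrite /psum -addSn big_split_ord.
by rewrite addrAC.
Qed.

End FirstArrival.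

(** * Pathwise comparison with the hindsight optimum *)

Section TimeScale.
Context (R : realType) (T : nat).
Hypothesis T1 : (1 <= T)%N.
Local Notation tau := (tau_irt R T).
Local Notation ts := (tstar R T).

Lemma T1R : 1 <= T%:R :> R. Proof. by rewrite (ler_nat R 1). Qed.

Lemma tau_gt0 u : 0 < tau u.
Proof. by rewrite /tau_irt powR_gt0// (lt_le_trans ltr01 T1R). Qed.

Lemma tau0 : tau 0 = T%:R.
Proof. by rewrite /tau_irt expr0 powRr1// (le_trans ler01 T1R). Qed.

Lemma tauS_le u : tau u.+1 <= tau u.
Proof.
rewrite /tau_irt ler_powR ?T1R// exprS ler_piMl ?exprn_ge0//; lra.
Qed.

Lemma tau_le u v : (u <= v)%N -> tau v <= tau u.
Proof.
move=> uv; rewrite -(subnKC uv); elim: (v - u)%N => [|i IH]; first by rewrite addn0.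
by rewrite addnS; apply: le_trans IH; exact: tauS_le.
Qed.

Lemma ts_le u v : (u <= v)%N -> ts u <= ts v.
Proof. by move=> uv; rewrite /tstar lerD2l lerN2 tau_le. Qed.

Lemma ts0 : ts 0 = 0. Proof. by rewrite /tstar tau0 subrr. Qed.

Lemma ts_ge0 u : 0 <= ts u. Proof. by rewrite -ts0 ts_le. Qed.

(* With [sigma = tau_u ^ (1/12)] all the scales of an epoch are integer powers:
   [tau_u = sigma^12], [tau_(u+1) = sigma^10] and [tau_u^(-1/4) = sigma^(-3)];
   the deviations of the good event are of order [sigma^7]. *)
Definition sigma_irt (u : nat) : R := tau u `^ (12^-1).

Lemma sigma_gt0 u : 0 < sigma_irt u.
Proof. by rewrite powR_gt0// tau_gt0. Qed.

Lemma sigmaX u k : sigma_irt u ^+ k = tau u `^ (12^-1 * k%:R).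
Proof. by rewrite powRrM powR_mulrn ?powR_ge0. Qed.

Lemma sigma12 u : sigma_irt u ^+ 12 = tau u.
Proof. by rewrite sigmaX mulVf// powRr1// ltW// tau_gt0. Qed.

Lemma sigma10 u : sigma_irt u ^+ 10 = tau u.+1.
Proof.
rewrite sigmaX [in RHS]/tau_irt exprSr [in RHS]powRrM; congr (_ `^ _).
by field.
Qed.

Lemma sigma3 u : tau u `^ (- (1 / 4)) = sigma_irt u ^- 3.
Proof. by rewrite powRN sigmaX; congr (_ `^ _)^-1; field. Qed.

Lemma epoch_leK (s : R) : (epoch T s <= K_irt R T)%N.
Proof. by apply/bigmax_leqP => i _; rewrite -ltnS; exact: ltn_ord. Qed.

(** Since [tstar] is nondecreasing, the indices with [tstar R T u <= s] form an initial segment. It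
    contains [0] because [0 <= s], so the maximum defining [epoch] is over a nonempty set. *)
Lemma epoch_ge (s : R) u : 0 <= s -> (u <= K_irt R T)%N ->
  (u <= epoch T s)%N = (ts u <= s).
Proof.
move=> s0 uK; apply/idP/idP => [|tus]; last first.
  exact: (@leq_bigmax_cond _ _ _ (Ordinal (uK : (u < (K_irt R T).+1)%N))).
have [->|u0] := posnP u; first by rewrite ts0.
move=> ue; rewrite leNgt; apply/negP => su.
suff : (epoch T s <= u.-1)%N by lia.
apply/bigmax_leqP => i tis; rewrite -ltnS prednK// ltnNge; apply/negP => ui.
by have := le_trans (ts_le ui) tis; rewrite leNgt su.
Qed.

Lemma epoch_mono (s t : R) : s <= t -> (epoch T s <= epoch T t)%N.
Proof.
move=> st; apply/bigmax_leqP => i tis.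
by apply: (@leq_bigmax_cond _ _ _ i); exact: le_trans st.
Qed.

End TimeScale.

(** Separates the current epoch from the later ones: in a sorted list the arrivals of the current
    epoch come first. *)
Lemma filter_geq_split (I : eqType) (f : I -> nat) (s : seq I) u :
  sorted (fun a b => f a <= f b)%N s ->
  [seq a <- s | u <= f a]%N = [seq a <- s | f a == u] ++ [seq a <- s | u < f a]%N.
Proof.
elim: s => [//|a s IH] /= ps.
have /IH {}IH : sorted (fun a b => f a <= f b)%N s by exact: path_sorted ps.
have tr : transitive (fun a b => f a <= f b)%N.
  by move=> y x z; exact: leq_trans.
have /allP fa := order_path_min tr ps.
case: (ltngtP (f a) u) => [au|ua|au]; rewrite IH//.
have -> // : [seq a <- s | f a == u] = [::].
apply/eqP; rewrite -(negbK (_ == _)) -has_filter; apply/hasPn => b /fa ab.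
by rewrite gtn_eqF// (leq_trans ua).
Qed.

Section Gap.
Context (R : realType) (m n : nat) (r lam : 'I_n -> R) (A : 'M[R]_(m, n)).
Variable sol : nat -> ('I_m -> R) -> 'I_n -> R.
Variables (T : nat) (E U : 'I_n -> nat -> R).
Hypothesis A0 : forall l j, 0 <= A l j.

Local Notation step := (irt_step r lam A sol T E U).
Local Notation ep a := (epoch T (arr_time E a.1 a.2)).
Local Notation K := (K_irt R T).

Let blk u := [seq a <- arrivals E T%:R | ep a == u].
Let rest u := [seq a <- arrivals E T%:R | u <= ep a]%N.
Let D u j : R := (class_count (rest u) j)%:R.

Lemma arrivals_sorted : sorted (fun a b => ep a <= ep b)%N (arrivals E T%:R).
Proof.
apply: (@sub_sorted _ (fun a b => arr_time E a.1 a.2 <= arr_time E b.1 b.2)).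
  by move=> a b; exact: epoch_mono.
by apply: sort_sorted => a b; exact: le_total.
Qed.

Lemma rest_split u : rest u = blk u ++ rest u.+1.
Proof. exact: (filter_geq_split u arrivals_sorted). Qed.

Lemma D_split u j : D u j = (class_count (blk u) j)%:R + D u.+1 j.
Proof. by rewrite /D rest_split /class_count count_cat natrD. Qed.

(** In each epoch either the loss pays for all that is left, or every feasible solution can be
    improved to one that accepts what the coins accept and leaves the rest to later epochs. *)
Variable loss : nat -> R.
Hypothesis loss_ok : forall u, (u <= K)%N -> 0 <= loss u /\
  (2 * \sum_j `|r j| * D u j <= loss u \/
   forall (c : 'I_m -> R) (y : 'I_n -> R), (forall l, 0 <= c l) -> ho_feasible A c (D u) y ->
   let z j : R := (coins U (blk u) (p_irt lam T u (sol u (fun l => c l / tau_irt R T u))) j)%:R in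
   exists y', [/\ ho_feasible A c (D u) y', \sum_j r j * y j <= \sum_j r j * y' j &
    forall j, z j <= y' j /\ y' j - z j <= D u.+1 j]).

(** In a good epoch the improved solution [y'] dominates the acceptances [z], and [y' - z] is
    feasible for what remains, so its value is at most the later hindsight optimum. In a bad one the
    loss pays for the hindsight value and for a possibly negative revenue of the policy. *)
Lemma gap_step u (c : 'I_m -> R) : (u <= K)%N -> (forall l, 0 <= c l) ->
  let q := p_irt lam T u (sol u (fun l => c l / tau_irt R T u)) in
  forall z : 'I_n -> nat,
  (forall l, 0 <= c l - \sum_j A l j * (z j)%:R) ->
  (forall j, (z j <= class_count (blk u) j)%N) ->
  ((forall l, \sum_j A l j * (coins U (blk u) q j)%:R <= c l) -> forall j, z j = coins U (blk u) q j) ->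
  VH r A c (D u) <= \sum_j r j * (z j)%:R +
     VH r A (fun l => c l - \sum_j A l j * (z j)%:R) (D u.+1) + loss u.
Proof.
move=> uK c0 q z cz zle zcoin.
have D0 v j : 0 <= D v j by rewrite ler0n.
have V0 := VH_ge0 r A cz (D0 u.+1).
have [l0 [bad|good]] := loss_ok uK.
  apply: VH_le => // y yf; apply: le_trans (ho_value_le r yf) _.
  have : - (\sum_j `|r j| * D u j) <= \sum_j r j * (z j)%:R.
    rewrite -sumrN; apply: ler_sum => j _.
    have zD : (z j)%:R <= D u j.
      by rewrite D_split (le_trans (_ : _ <= (class_count (blk u) j)%:R)) ?ler_nat// lerDl.
    have h : `|r j| * (z j)%:R <= `|r j| * D u j by rewrite ler_wpM2l.
    have := ler_norm (- (r j * (z j)%:R)); rewrite normrN normrM normr_nat; lra.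
  lra.
(* Applied to the zero solution, the completion property shows that the coin acceptances fit into
   the capacity, so the policy realizes them. *)
have zE : forall j, z j = coins U (blk u) q j.
  apply: zcoin => l.
  have [y' [[y'A _] _ zy']] := good c _ c0 (ho_feasible0 A c0 (D0 u)).
  apply: le_trans (y'A l); apply: ler_sum => j _; rewrite ler_wpM2l//.
  by have [] := zy' j.
apply: VH_le => // y yf.
have [y' [y'f ry zy']] := good c y c0 yf.
apply: le_trans ry _.
have -> : \sum_j r j * y' j = \sum_j r j * (z j)%:R + \sum_j r j * (y' j - (z j)%:R).
  by rewrite -big_split/=; apply: eq_bigr => j _; ring.
rewrite -addrA lerD2l -[X in X <= _]addr0 lerD//.
apply: VH_ge; split => [l|j].
  under eq_bigr do rewrite mulrBr.
  by rewrite sumrB lerD2r; exact: y'f.1.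
by have [h1 h2] := zy' j; rewrite zE subr_ge0 h1.
Qed.

(** Summation of [gap_step] over the epochs, by induction on their remaining number. The condition
    on [cur] makes each block start with a fresh solution. *)
Lemma gap_rec i u : (u + i = K.+1)%N -> forall (c : 'I_m -> R) (rho : R) cur (p : 'I_n -> R),
  (forall l, 0 <= c l) -> (forall v, (u <= v)%N -> cur != Some v) ->
  VH r A c (D u) <= (foldl step (c, rho, cur, p) (rest u)).1.1.2 - rho +
    \sum_(u <= v < K.+1) loss v.
Proof.
elim: i u => [|i IH] u.
  rewrite addn0 => -> c rho cur p c0 _.
  have -> : rest K.+1 = [::].
    apply/eqP; rewrite -(negbK (_ == _)) -has_filter; apply/hasPn => a _.
    by rewrite -leqNgt epoch_leK.
  rewrite big_geq//= subrr addr0; apply: VH_le => //.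
  move=> z [_ zD]; rewrite big1// => j _.
  have := zD j; rewrite /D.
  have -> : rest K.+1 = [::].
    apply/eqP; rewrite -(negbK (_ == _)) -has_filter; apply/hasPn => a _.
    by rewrite -leqNgt epoch_leK.
  by rewrite /class_count/= => /le_anti <-; rewrite mulr0.
rewrite addnS => -[uiK] c rho cur p c0 curu.
have uK : (u <= K)%N by rewrite -uiK leq_addr.
have blk_ep a : a \in blk u -> ep a = u by rewrite mem_filter => /andP[/eqP].
have [z [cur' [p' [Hf [Hcur Hc] Hz Hcoin]]]] :=
  irt_block r lam sol U A0 rho p blk_ep c0 (curu u (leqnn u)).
rewrite rest_split foldl_cat Hf big_ltn ?ltnS//.
have H1 := gap_step uK c0 Hc Hz Hcoin.
have cur'u v : (u.+1 <= v)%N -> cur' != Some v.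
  move=> uv; case: Hcur => ->; first by apply: curu; exact: ltnW.
  by apply/eqP => -[uv']; rewrite uv' ltnn in uv.
have H2 := IH u.+1 _ _ (rho + \sum_j r j * (z j)%:R) cur' p' Hc cur'u.
have {}H2 := H2 (etrans (addSnnS u i) (etrans (addnS u i) (congr1 S uiK))).
lra.
Qed.

End Gap.

Section Counts.
Context (R : realType) (n : nat) (E U : 'I_n -> nat -> R).

Lemma arr_boundP (t : R) : (exists N, forall j k, (N <= k)%N -> t < arr_time E j k) ->
  forall j k, (arr_bound E t <= k)%N -> t < arr_time E j k.
Proof. by move=> H; exact: (xgetPex 0%N H). Qed.

Lemma count_arrivals (t : R) (Q : pred ('I_n * nat)) j :
  count (fun a => (a.1 == j) && Q a) (arrivals E t) =
  count (fun k => (arr_time E j k <= t)%R && Q (j, k)) (iota 0 (arr_bound E t)).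
Proof.
rewrite /arrivals; have /permP -> := permEl (perm_sort
  (fun a b : 'I_n * nat => arr_time E a.1 a.2 <= arr_time E b.1 b.2)
  [seq (j, k) | j <- enum 'I_n,
     k <- [seq k <- iota 0 (arr_bound E t) | arr_time E j k <= t]]).
rewrite count_flatten -map_comp sumnE big_map big_enum/= (bigD1 j)//= big1.
  rewrite addn0 count_map count_filter; apply: eq_count => k /=.
  by rewrite eqxx andbC.
move=> i ij; rewrite count_map; apply/eqP; rewrite -leqn0 leqNgt -has_count.
by apply/hasPn => k _ /=; rewrite (negbTE ij).
Qed.

End Counts.

Section PathwiseGap.
Context (R : realType) (m n : nat) (r lam : 'I_n -> R) (A : 'M[R]_(m, n)).
Variable sol : nat -> ('I_m -> R) -> 'I_n -> R.
Variables (T : nat) (E U : 'I_n -> nat -> R) (k : R).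
Hypothesis A0 : forall l j, 0 <= A l j.
Hypothesis lam0 : forall j, 0 < lam j.
Hypothesis T1 : (1 <= T)%N.
Hypothesis E0 : forall j k, 0 <= E j k.
Hypothesis U01 : forall j k, 0 <= U j k < 1.
Hypothesis Hsol : lp_selector r lam A sol.
Hypothesis stab : forall (U U' : 'I_n -> R) (c : 'I_m -> R) (d : R) (X y : 'I_n -> R),
    0 <= d -> lp_optimal r U A c X -> ho_feasible A c U' y ->
    (forall j, `|U j - U' j| <= d) ->
    exists y', [/\ ho_feasible A c U' y',
      \sum_j r j * y j <= \sum_j r j * y' j & forall j, `|y' j - X j| <= k * d].

Local Notation K := (K_irt R T).
Local Notation tau := (tau_irt R T).
Local Notation ts := (tstar R T).
Local Notation sg := (sigma_irt R T).

(** The counts are spelled with a starting time and a length, the form in which they are estimated.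
    The window of [cntD] is closed at the horizon; those of [cntL] and [cntZ] are half open, like
    the epochs. *)
Definition cntD (u : nat) (j : 'I_n) : nat :=
  count (fun k => (ts u <= psum (E j) k.+1)%R && (psum (E j) k.+1 <= ts u + tau u)%R)
    (iota 0 (arr_bound E T%:R)).
Definition cntL (u : nat) (j : 'I_n) : nat :=
  count (fun k => (ts u <= psum (E j) k.+1)%R &&
     (psum (E j) k.+1 < ts u + (tau u - tau u.+1))%R)
    (iota 0 (arr_bound E T%:R)).
Definition cntZ (u : nat) (j : 'I_n) (p : R) : nat :=
  count (fun k => [&& ts u <= psum (E j) k.+1,
     psum (E j) k.+1 < ts u + (tau u - tau u.+1) & U j k < p]%R)
    (iota 0 (arr_bound E T%:R)).

(** The condition on [(k + 3) * d] is the one that [epoch_complete] consumes. The last epoch is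
    excluded, as there the policy does not threshold. *)
Definition good_epoch (u : nat) : Prop :=
  [/\ (u < K)%N, 2 <= sg u &
   exists2 d : R, 0 <= d & forall j,
   [/\ (k + 3) * d <= lam j * sg u ^+ 7,
     `|(cntD u j)%:R - lam j * tau u| <= d,
     `|(cntL u j)%:R - lam j * (tau u - tau u.+1)| <= d &
     forall p, 0 <= p <= 1 ->
     `|(cntZ u j p)%:R - p * (lam j * (tau u - tau u.+1))| <= d]].

Let arr0 j i : 0 <= arr_time E j i.
Proof. by apply: sumr_ge0. Qed.

Let tsT u : ts u + tau u = T%:R.
Proof. by rewrite /tstar subrK. Qed.

Let tsS u : ts u + (tau u - tau u.+1) = ts u.+1.
Proof. by rewrite /tstar addrA subrK. Qed.

Let ts_leT u : ts u <= T%:R.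
Proof. by rewrite -(tsT u) lerDl ltW// tau_gt0. Qed.

Let ep (a : 'I_n * nat) := epoch T (arr_time E a.1 a.2).
Let blk u := [seq a <- arrivals E T%:R | ep a == u].
Let rest u := [seq a <- arrivals E T%:R | u <= ep a]%N.

Lemma cntD_rest u j : (u <= K)%N -> class_count (rest u) j = cntD u j.
Proof.
move=> uK; rewrite /class_count count_filter.
rewrite (count_arrivals E T%:R (fun a => u <= ep a)%N).
by apply: eq_count => i /=; rewrite /ep/= epoch_ge// tsT andbC.
Qed.

Let ep_eq u j i : (u < K)%N ->
  (epoch T (arr_time E j i) == u) =
  (ts u <= psum (E j) i.+1) && (psum (E j) i.+1 < ts u.+1).
Proof.
move=> uK; rewrite -(epoch_ge (R := R) T1 (arr0 j i) (ltnW uK)).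
rewrite ltNge -(epoch_ge (R := R) T1 (arr0 j i) uK).
by rewrite eqn_leq andbC -ltnNge ltnS.
Qed.

Lemma coins_blk u (q : 'I_n -> R) j : (u < K)%N -> coins U (blk u) q j = cntZ u j (q j).
Proof.
move=> uK; rewrite /coins count_filter.
transitivity (count (fun a => (a.1 == j) && ((U a.1 a.2 < q a.1)%R && (ep a == u)))
  (arrivals E T%:R)).
  by apply: eq_count => a /=; rewrite andbA.
rewrite (count_arrivals E T%:R (fun a => (U a.1 a.2 < q a.1)%R && (ep a == u))).
apply: eq_count => i /=; rewrite /ep/= ep_eq// tsS.
have [lt|_] := ltP (psum (E j) i.+1) (ts u.+1); last by rewrite !andbF.
rewrite (_ : arr_time E j i <= T%:R); last first.
  by apply: le_trans (ts_leT u.+1); exact: ltW.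
by case: (U j i < q j); case: (ts u <= _).
Qed.

Lemma class_blk u j : (u < K)%N -> class_count (blk u) j = cntL u j.
Proof.
(* All coins lie below [1], so counting coins at probability [1] counts every arrival. *)
move=> uK; transitivity (coins U (blk u) (fun=> 1) j).
  by apply: eq_count => a; have /andP[_ ->] := U01 a.1 a.2; rewrite andbT.
rewrite coins_blk//; apply: eq_count => i; have /andP[_ ->] := U01 j i.
by rewrite andbT.
Qed.

(* In a bad epoch at most [sum_j |r_j| D_j] is lost by the policy and at most as
   much is gained by the hindsight optimum, whence the factor [2]. *)
Lemma V_gap (C : 'I_m -> R) (loss : nat -> R) : (forall l, 0 <= C l) ->
  (forall u, (u <= K)%N -> 0 <= loss u /\
    (2 * \sum_j `|r j| * (cntD u j)%:R <= loss u \/ good_epoch u)) ->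
  V_HO r lam A C T E <= V_IRT r lam A C sol T E U + \sum_(u < K.+1) loss u.
Proof.
move=> C0 Hloss.
have restE : rest 0 = arrivals E T%:R by rewrite /rest filter_predT.
have HLam j : Lam E j T%:R = class_count (rest 0) j.
  rewrite restE; transitivity (count (fun a => (a.1 == j) && predT a) (arrivals E T%:R)).
    by rewrite count_arrivals /Lam; apply: eq_count => i; rewrite andbT.
  by apply: eq_count => a; rewrite andbT.
have -> : V_HO r lam A C T E = VH r A C (fun j => (class_count (rest 0) j)%:R).
  rewrite /V_HO /VH; congr (sup _); apply/funext => v /=.
  have -> // : (fun j => (Lam E j T%:R)%:R) =
    (fun j => (class_count (rest 0) j)%:R) :> ('I_n -> R).
  by apply/funext => j; rewrite HLam.
have Hok u : (u <= K)%N -> 0 <= loss u /\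
  (2 * \sum_j `|r j| * (class_count (rest u) j)%:R <= loss u \/
   forall (c : 'I_m -> R) (y : 'I_n -> R), (forall l, 0 <= c l) ->
   ho_feasible A c (fun j => (class_count (rest u) j)%:R) y ->
   let z j : R := (coins U (blk u) (p_irt lam T u (sol u (fun l => c l / tau_irt R T u))) j)%:R in
   exists y', [/\ ho_feasible A c (fun j => (class_count (rest u) j)%:R) y',
     \sum_j r j * y j <= \sum_j r j * y' j &
    forall j, z j <= y' j /\ y' j - z j <= (class_count (rest u.+1) j)%:R]).
  move=> uK; have [l0 H] := Hloss u uK; split=> //.
  case: H => [bad|[uK' sg2 [dl d0 Hg]]]; [left|right].
    by under eq_bigr => j _ do rewrite (cntD_rest j uK).
  move=> c y c0 yf z.
  pose x := sol u (fun l => c l / tau u).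
  have t0 := tau_gt0 R T1 u.
  have xopt : lp_optimal r lam A (fun l => c l / sg u ^+ 12) x.
    by rewrite sigma12//; apply: Hsol => l; rewrite divr_ge0// ltW.
  have [||||y' [y'f ry zy]] := @epoch_complete _ _ _ _ _ k lam c (sg u) dl x
    (fun j => (class_count (rest u) j)%:R) (fun j => (class_count (blk u) j)%:R) z y stab sg2 d0 lam0 _ xopt _ _ _ yf.
  - by move=> j; have [] := Hg j.
  - by move=> j; rewrite cntD_rest// sigma12//; have [] := Hg j.
  - by move=> j; rewrite class_blk// sigma12// sigma10//; have [] := Hg j.
  - move=> j; have [_ _ _ HZ] := Hg j.
    have lj := lam0 j; have /andP[x0 x1] := xopt.1.2 j.
    rewrite /z coins_blk// /p_irt uK' -/x sigma3//.
    (* Probability [0] accepts nobody because coins are nonnegative; probability [1] accepts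
       everybody because they are below [1]. *)
    have [xs|xs] := ltP (x j) (lam j * sg u ^- 3).
      apply: Or31; split=> //; apply/eqP; rewrite pnatr_eq0 -leqn0 leqNgt -has_count; apply/hasPn => i _.
      by have /andP[u0 _] := U01 j i; rewrite [U j i < 0]ltNge u0 !andbF.
    have [xs2|xs2] := ltP (lam j * (1 - sg u ^- 3)) (x j).
      apply: Or32; split=> //; congr (_%:R); rewrite class_blk//.
      by apply: eq_count => i; have /andP[_ ->] := U01 j i; rewrite andbT.
    apply: Or33; split=> //.
    have p01 : 0 <= x j / lam j <= 1.
      by rewrite divr_ge0 ?(ltW lj)//= ler_pdivrMr// mul1r.
    have := HZ _ p01; rewrite sigma12// sigma10//.
    by rewrite mulrA divfK// gt_eqF.
  exists y'; split=> // j; have [zy1 zy2] := zy j; split=> //.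
  by apply: le_trans zy2 _; rewrite (D_split T E u j) addrAC subrr add0r.
have Kp : (0 + K.+1 = K.+1)%N by [].
have := gap_rec A0 Hok Kp 0 (cur := None) (fun=> 0) C0 (fun v _ => isT).
rewrite big_mkord subr0 => H.
by rewrite /V_IRT -[arrivals E _]restE; exact: H.
Qed.

End PathwiseGap.

(** * Concentration of the counts in one epoch *)

Section ExpBounds.
Context (R : realType).
Implicit Types y th p : R.

(** One inequality for both signs: early arrivals use it at [th], late ones at [- th]. *)
Lemma inv1D_le_expR y : - (1/2) <= y -> (1 + y)^-1 <= expR (- y + 2 * y ^+ 2).
Proof.
move=> hy; have y1 : 0 < 1 + y by lra.
rewrite invf_ple ?posrE ?expR_gt0// -expRN opprD opprK.
have := expR_ge1Dx (- y + 2 * y ^+ 2).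
have H : 1 <= (1 + (- y + 2 * y ^+ 2)) * (1 + y) by nra.
have -> : y - 2 * y ^+ 2 = - (- y + 2 * y ^+ 2) by ring.
rewrite expRN => H2; rewrite invf_ple ?posrE ?expR_gt0//.
apply: le_trans H2.
by rewrite -(ler_pM2r y1) mulVf ?gt_eqF.
Qed.

(** From [expR th <= (1 - th)^-1] one gets [expR th - 1 <= th + 2 * th ^ 2]. The first-order term
    [p * th] is exact, so that it cancels against the mean. *)
Lemma coin_mgf_le p th : 0 <= p -> 0 <= th <= 1/2 ->
  1 + (expR th - 1) * p <= expR (p * (th + 2 * th ^+ 2)).
Proof.
move=> p0 /andP[th0 th1].
apply: le_trans (expR_ge1Dx _); rewrite lerD2l mulrC ler_wpM2l//.
rewrite lerBlDl.
have := @inv1D_le_expR (- th); rewrite lerN2 => /(_ th1).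
have := expR_ge1Dx (- th); rewrite expRN => H _.
have e0 := expR_gt0 th.
have : (1 - th) * expR th <= 1.
  by rewrite -(@ler_pM2r _ (expR th)^-1) ?invr_gt0// mulfK ?gt_eqF// mul1r.
by nra.
Qed.

End ExpBounds.

Section UniformLaw.
Context d (Omega : measurableType d) (R : realType) (P : probability Omega R).

Lemma uniform_lt (Y : Omega -> R) (p : R) : measurable_fun setT Y ->
  (forall V, measurable V -> P (Y @^-1` V) = uniform_prob (@ltr01 R) V) ->
  0 <= p <= 1 -> P [set w | Y w < p] = p%:E.
Proof.
move=> mY lawY /andP[p0 p1].
have -> : [set w | Y w < p] = Y @^-1` [set` `]-oo, p[%R].
  by apply/seteqP; split => w /=; rewrite in_itv.
rewrite lawY// /uniform_prob integral_uniform_pdf.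
have -> : [set` `]-oo, p[%R] `&` [set` `[0, 1]%R] = [set` `[0, p[%R].
  apply/seteqP; split => x /=; rewrite !in_itv/=.
    by move=> [-> /andP[->]].
  by move=> /andP[-> xp]; rewrite xp; split => //; lra.
rewrite (eq_integral (fun=> 1%E)); last first.
  move=> x; rewrite inE/= in_itv/= => /andP[x0 xp].
  by rewrite /uniform_pdf x0 subr0 invr1 ifT//; lra.
rewrite integral_cst//= mul1e lebesgue_measure_itv/= lte_fin.
case: ltP => [_|p0']; first by rewrite oppr0 addr0.
by have -> : p = 0 by lra.
Qed.

End UniformLaw.

Section ArrivalBounds.
Context d (Omega : measurableType d) (R : realType) (P : probability Omega R).
Context (I : eqType) (X : I -> Omega -> R).
Hypothesis indX : mut_indep P X.
Variables (ie iu : nat -> I) (rate : R).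
Hypothesis ie_inj : injective ie.
Hypothesis iu_inj : injective iu.
Hypothesis ie_iu : forall k l, ie k != iu l.
Hypothesis rate0 : 0 < rate.
Hypothesis law_ie : forall k V, measurable V ->
  P (X (ie k) @^-1` V) = exponential_prob rate V.
Hypothesis law_iu : forall k V, measurable V ->
  P (X (iu k) @^-1` V) = uniform_prob (@ltr01 R) V.
Variable s : R.
Hypothesis s0 : 0 <= s.

Let mX i : measurable_fun setT (X i). Proof. by have [] := indX. Qed.

Let Y (w : Omega) (k : nat) : R := X (ie k) w.
Let Z (w : Omega) (k : nat) : R := X (iu k) w.
Let fa a := [set w | first_after (Y w) s a].

(** On nonnegative inter-arrival times the event says that at least [k + 1] arrivals fall in the
    window from [s] to [s + h]. *)
Lemma early_arrival (y h : R) a k : 0 <= y ->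
  (P [set w | first_after (Y w) s a && (psum (Y w) (a + k).+1 <= s + h)%R] <=
   P (fa a) * (expR (y * rate * h) / (1 + y) ^+ k.+1)%:E)%E.
Proof.
move=> y0; apply: (fa_chernoff indX ie_inj rate0 law_ie (y := y)).
- by apply: measurable_fun_ler => //; exact: (measurable_psum indX).
- by lra.
- exact: expR_ge0.
- move=> w Fw; rewrite -expRD -[X in X <= _]expR0 ler_expR.
  have -> : y * rate * h + - (y * rate) * (psum (Y w) (a + k).+1 - s) =
    y * rate * (s + h - psum (Y w) (a + k).+1) by ring.
  by rewrite !mulr_ge0 ?subr_ge0 ?(ltW rate0).
Qed.

Lemma late_arrival (y h : R) a k : 0 <= y < 1 ->
  (P [set w | first_after (Y w) s a && (s + h <= psum (Y w) (a + k).+1)%R] <=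
   P (fa a) * (expR (- (y * rate * h)) / (1 - y) ^+ k.+1)%:E)%E.
Proof.
move=> /andP[y0 y1]; apply: (fa_chernoff indX ie_inj rate0 law_ie (y := - y)).
- by apply: measurable_fun_ler => //; exact: (measurable_psum indX).
- by lra.
- exact: expR_ge0.
- move=> w Fw; rewrite -expRD -[X in X <= _]expR0 ler_expR.
  have -> : - (y * rate * h) + - (- y * rate) * (psum (Y w) (a + k).+1 - s) =
    y * rate * (psum (Y w) (a + k).+1 - (s + h)) by ring.
  by rewrite !mulr_ge0 ?subr_ge0 ?(ltW rate0).
Qed.

(** The coins from index [a] on are independent of the event that [a] is the first index after [s].
    The success test [cB] is left general so that rejections can be counted too: few acceptances are
    many rejections. *)
Lemma coin_chernoff (cB : R -> bool) (p th b : R) a l :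
  measurable_fun setT cB -> (forall k, P [set w | cB (Z w k)] = p%:E) ->
  0 <= th <= 1/2 ->
  (P [set w | first_after (Y w) s a &&
        (b <= \sum_(i < l) (cB (Z w (a + i)))%:R)%R] <=
   P (fa a) * (expR (l%:R * (p * (th + 2 * th ^+ 2)) - th * b))%:E)%E.
Proof.
move=> mB PB /andP[th0 th1].
pose phi x : R := expR (th * (cB x)%:R).
have mphi : measurable_fun setT phi.
  apply: measurableT_comp => //; apply: measurable_funM => //.
  exact: measurable_natb.
have p0 : 0 <= p by rewrite -lee_fin -(PB 0%N).
have Ephi k : (\int[P]_w (phi (X (iu (a + k)) w))%:E = (1 + (expR th - 1) * p)%:E)%E.
  have mBk : measurable_fun setT (fun w => cB (Z w (a + k))).
    exact: (measurableT_comp mB (mX _)).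
  under eq_integral => w _.
    have -> : phi (X (iu (a + k)) w) = 1 + (expR th - 1) * (cB (Z w (a + k)))%:R.
      rewrite /phi /Z; case: (cB _); rewrite ?mulr1 ?mulr0 ?expR0 ?addr0//.
      by ring.
    rewrite EFinD EFinM; over.
  rewrite ge0_integralD//.
  - rewrite integral_cst// mul1e [in RHS]EFinD [in RHS]EFinM; congr (_ + _)%E.
      exact: probability_setT.
    rewrite ge0_integralZl//.
    + by congr (_ * _)%E; exact: etrans (integral_natb P mBk) (PB _).
    + exact/measurable_EFinP/measurable_natb.
    + by rewrite lee_fin subr_ge0 -[X in X <= _]expR0 ler_expR.
  - move=> w _; rewrite mule_ge0 ?lee_fin//.
    by rewrite subr_ge0 -[X in X <= _]expR0 ler_expR.
  - by apply/measurable_EFinP; apply: measurable_funM => //; exact: measurable_natb.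
(* At tilt [0] the weight is the indicator of [first_after]. *)
have iW : indep_off P X (used ie a.+1)
  (fun w => fa_weight rate s 0 a (psum (Y w) a, X (ie a) w)).
  exact: (indep_fa indX rate ie_inj s 0 a).
have W0 w : 0 <= fa_weight rate s 0 a (psum (Y w) a, X (ie a) w).
  exact: mulr_ge0 (ler0n _ _) (expR_ge0 _).
have nused k : ~~ used ie a.+1 (iu (a + k)).
  by apply/mapP => -[k' _ /eqP]; rewrite eq_sym (negbTE (ie_iu _ _)).
have inj : injective (fun k => iu (a + k)) by move=> k k' /iu_inj /addnI.
have := indep_prod indX iW W0 nused inj mphi (fun=> expR_ge0 _) Ephi l.
rewrite (fa_weight_mean indX ie_inj rate0 law_ie) ?addr0// invr1 mule1.
set c := 1 + _ => HP.
have c0 : 0 <= c.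
  by rewrite addr_ge0// mulr_ge0// subr_ge0 -[X in X <= _]expR0 ler_expR.
have step : (P [set w | first_after (Y w) s a &&
        (b <= \sum_(i < l) (cB (Z w (a + i)))%:R)%R] <=
   (expR (- (th * b)))%:E * (P (fa a) * (c ^+ l)%:E))%E.
  rewrite -HP -integral_natb; last first.
    apply: measurable_and; first exact: (measurable_first_after indX).
    apply: measurable_fun_ler => //.
    apply: measurable_sum => i; apply: measurable_natb; exact: (measurableT_comp mB (mX _)).
  have mW : measurable_fun setT (fun w =>
     fa_weight rate s 0 a (psum (Y w) a, X (ie a) w) *
     \prod_(i < l) phi (X (iu (a + i)) w)).
    apply: measurable_funM; first by have [] := iW.
    by apply: measurable_prod => i _; exact: (measurableT_comp mphi (mX _)).
  have W0' w : 0 <= fa_weight rate s 0 a (psum (Y w) a, X (ie a) w) *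
     \prod_(i < l) phi (X (iu (a + i)) w).
    by apply: mulr_ge0 => //; apply: prodr_ge0 => i _; exact: expR_ge0.
  rewrite -ge0_integralZl//; [|exact/measurable_EFinP|by move=> w _; rewrite lee_fin].
  apply: ge0_le_integral => //.
  - apply/measurable_EFinP/measurable_natb/measurable_and.
      exact: (measurable_first_after indX).
    apply: measurable_fun_ler => //.
    apply: measurable_sum => i; apply: measurable_natb; exact: (measurableT_comp mB (mX _)).
  - by apply/measurable_EFinP; exact: measurable_funM.
  move=> w _; rewrite -EFinM lee_fin.
  have [/= /andP[fw Fw]|_] := boolP (_ && _); last by rewrite mulr_ge0 ?expR_ge0.
  rewrite fa_weightE fw mul1r mul0r oppr0 mul0r expR0 mul1r.
  rewrite -expR_sum -expRD -[X in X <= _]expR0 ler_expR -mulr_sumr addrC subr_ge0.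
  by rewrite ler_wpM2l.
apply: le_trans step _; rewrite muleCA -EFinM lee_wpmul2l//.
rewrite lee_fin addrC expRD expRM_natl ler_wpM2l ?expR_ge0// lerXn2r ?nnegrE ?expR_ge0//.
by apply: coin_mgf_le => //; rewrite th0.
Qed.

End ArrivalBounds.

(** * From arrival times to counts *)

Section Counting.
Context (R : realType) (x : nat -> R).
Hypothesis x0 : forall k, 0 <= x k.

Lemma psum_le a b : (a <= b)%N -> psum x a <= psum x b.
Proof.
move=> ab; rewrite -(subnKC ab) /psum big_split_ord/= lerDl.
by apply: sumr_ge0.
Qed.

Lemma first_after_inj s a b : first_after x s a -> first_after x s b -> a = b.
Proof.
wlog ab : a b / (a <= b)%N => [H fa fb|].
  by case/orP: (leq_total a b) => h; [|apply: esym]; apply: H.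
move: ab; rewrite leq_eqVlt => /orP[/eqP//|ab].
move=> /andP[_ sa] /andP[]; rewrite (gtn_eqF (leq_ltn_trans (leq0n a) ab)).
by move=> /(le_lt_trans (psum_le ab)) /(le_lt_trans sa); rewrite ltxx.
Qed.

Lemma first_after_ex s k : 0 <= s -> s <= psum x k -> exists a, first_after x s a.
Proof.
move=> s0 sk; pose Q k := s <= psum x k.+1.
have exQ : exists k, Q k.
  by exists k; apply: le_trans sk _; exact: psum_le.
case: (ex_minnP exQ) => a Qa mina; exists a; rewrite /first_after -/(Q a) Qa andbT.
case: a Qa mina => [|a] Qa mina; first by rewrite /psum big_ord0.
by rewrite /= ltNge; apply/negP => /mina; rewrite ltnn.
Qed.

Lemma count_le_sub (s1 s2 : seq nat) (P Q : pred nat) : uniq s1 ->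
  (forall k, k \in s1 -> P k -> (k \in s2) && Q k) ->
  (count P s1 <= count Q s2)%N.
Proof.
move=> u H; rewrite -!size_filter; apply: uniq_leq_size.
  exact: filter_uniq.
move=> k; rewrite !mem_filter => /andP[Pk /H/(_ Pk)/andP[-> ->]].
by [].
Qed.

(** No arrival of index below [a] can be counted, as it precedes [s], and none of index [a + c] or
    more, as it follows [t]. *)
Lemma count_upper s t a c M (Q P : pred nat) : first_after x s a ->
  t < psum x (a + c).+1 ->
  (forall k, P k -> [/\ s <= psum x k.+1, psum x k.+1 <= t & Q k]) ->
  (count P (iota 0 M) <= count Q (iota a c))%N.
Proof.
move=> /andP[fa _] tc HP; apply: count_le_sub; first exact: iota_uniq.
move=> k _ /HP[sk kt ->]; rewrite andbT mem_iota; apply/andP; split.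
  rewrite leqNgt; apply/negP => ka; move: fa.
  rewrite (gtn_eqF (leq_ltn_trans (leq0n k) ka)).
  by move=> /(le_lt_trans (psum_le ka)) /(le_lt_trans sk); rewrite ltxx.
rewrite ltnNge; apply/negP => ack.
have /psum_le : ((a + c).+1 <= k.+1)%N by [].
by move=> /(lt_le_trans tc); rewrite ltNge kt.
Qed.

(** If arrival [a + c - 1] comes before [t], all indices from [a] to [a + c - 1] lie in the window,
    and [M] is beyond them. *)
Lemma count_lower s t a c M (Q P : pred nat) : first_after x s a ->
  (0 < c)%N -> psum x (a + c.-1).+1 < t ->
  (forall k, (M <= k)%N -> t <= psum x k.+1) ->
  (forall k, s <= psum x k.+1 -> psum x k.+1 < t -> Q k -> P k) ->
  (count Q (iota a c) <= count P (iota 0 M))%N.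
Proof.
move=> /andP[_ fa] c0 tc HM HP; apply: count_le_sub; first exact: iota_uniq.
move=> k; rewrite mem_iota => /andP[ak kac] Qk.
have kt : psum x k.+1 < t.
  by apply: le_lt_trans tc; apply: psum_le; lia.
rewrite HP//; last by apply: le_trans fa _; exact: psum_le.
rewrite andbT mem_iota /= add0n ltnNge; apply/negP => /HM.
by rewrite leNgt kt.
Qed.

End Counting.

Lemma sum_natb_count (R : realType) (Q : pred nat) a l :
  \sum_(i < l) (Q (a + i)%N)%:R = (count Q (iota a l))%:R :> R.
Proof.
elim: l => [|l IH]; first by rewrite big_ord0.
by rewrite big_ord_recr IH -[in RHS](addn1 l) iotaD count_cat natrD /= addn0.
Qed.

Section Unions.
Context d (Omega : measurableType d) (R : realType) (P : probability Omega R).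

Lemma measure_seqU (I : eqType) (F : I -> set Omega) (s : seq I) (q : R) :
  (forall i, i \in s -> measurable (F i) /\ (P (F i) <= q%:E)%E) ->
  measurable (\big[setU/set0]_(i <- s) F i) /\
  (P (\big[setU/set0]_(i <- s) F i) <= ((size s)%:R * q)%:E)%E.
Proof.
elim: s => [_|i s IH H]; first by rewrite big_nil measure0 mul0r.
have [mB PB] := H i (mem_head _ _).
have [|ms Ps] := IH; first by move=> j js; apply: H; rewrite inE js orbT.
rewrite big_cons; split; first exact: measurableU.
apply: (@le_trans _ _ (P (F i) + P (\big[setU/set0]_(j <- s) F j))%E).
  exact: measureU2.
by rewrite /= -add1n natrD mulrDl mul1r EFinD leeD.
Qed.

Lemma notin_seqU (I : eqType) (F : I -> set Omega) (s : seq I) w :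
  ~ (\big[setU/set0]_(i <- s) F i) w -> forall i, i \in s -> ~ F i w.
Proof.
elim: s => [//|i s IH]; rewrite big_cons => /not_orP[nB /IH H] j.
by rewrite inE => /orP[/eqP ->|/H].
Qed.

End Unions.

Section EpochBad.
Context d (Omega : measurableType d) (R : realType) (P : probability Omega R).
Context (I : eqType) (X : I -> Omega -> R).
Hypothesis indX : mut_indep P X.
Variables (ie iu : nat -> I) (rate : R).
Hypothesis ie_inj : injective ie.
Hypothesis iu_inj : injective iu.
Hypothesis ie_iu : forall k l, ie k != iu l.
Hypothesis rate0 : 0 < rate.
Hypothesis law_ie : forall k V, measurable V ->
  P (X (ie k) @^-1` V) = exponential_prob rate V.
Hypothesis law_iu : forall k V, measurable V ->
  P (X (iu k) @^-1` V) = uniform_prob (@ltr01 R) V.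

Let mX i : measurable_fun setT (X i). Proof. by have [] := indX. Qed.

Let Y (w : Omega) (k : nat) : R := X (ie k) w.
Let Z (w : Omega) (k : nat) : R := X (iu k) w.

Lemma exp_neg0 k : P [set w | Y w k < 0] = 0%E.
Proof.
have -> : [set w | Y w k < 0] = X (ie k) @^-1` [set` `]-oo, 0[%R].
  by apply/seteqP; split => w /=; rewrite in_itv.
rewrite law_ie// /exponential_prob; apply: integral0_eq => x /=.
by rewrite in_itv/= => x0; rewrite lt0_exponential_pdf.
Qed.

Lemma measurable_psum_le t k : measurable [set w | psum (Y w) k <= t].
Proof.
rewrite -[X in measurable X]setTI.
apply: (measurable_fun_ler (measurable_psum indX ie k) (measurable_cst t) measurableT (Y := [set true])).
by [].
Qed.

Variable s : R.
Hypothesis s0 : 0 <= s.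

Let fa a := [set w | first_after (Y w) s a].

Let mfaF a (F : Omega -> bool) : measurable_fun setT F ->
  measurable [set w | first_after (Y w) s a && F w].
Proof.
move=> mF; rewrite -[X in measurable X]setTI.
apply: (measurable_and (measurable_first_after indX ie s a) mF measurableT (Y := [set true])).
by [].
Qed.

Let mfa a : measurable (fa a).
Proof.
rewrite -[X in measurable X]setTI.
by apply: (measurable_first_after indX ie s a measurableT (Y := [set true])).
Qed.

(** The events are disjoint where all inter-arrival times are nonnegative, that is, outside the null
    set [Neg]. *)
Lemma sum_fa_le1 : (\sum_(0 <= a <oo) P (fa a) <= 1)%E.
Proof.
pose Neg := \bigcup_k [set w | Y w k < 0].
have mYk k : measurable [set w | Y w k < 0].
  rewrite -[X in measurable X]setTI.
  by apply: (measurable_fun_ltr (mX (ie k)) (measurable_cst (0 : R)) measurableT (Y := [set true])).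
have mNeg : measurable Neg by exact: bigcup_measurable.
have PNeg : P Neg = 0%E.
  apply/eqP; rewrite -measure_le0.
  have H : (P Neg <= \sum_(0 <= k <oo) P [set w | (Y w k < 0)%R])%E.
    exact: measure_sigma_subadditive.
  apply: (le_trans H).
  by rewrite eseries0// => k _ _; exact: exp_neg0.
pose ga a := fa a `\` Neg.
have mga a : measurable (ga a) by exact: measurableD.
have faga a : (P (fa a) <= P (ga a))%E.
  apply: (@le_trans _ _ (P (ga a `|` Neg))).
    apply: le_measure; rewrite ?inE//; first exact: measurableU.
    by move=> w fw; have [h|h] := pselect (Neg w); [right|left].
  apply: le_trans (measureU2 _ _ _) _ => //.
  by rewrite [X in (_ + X <= _)%E]PNeg adde0.
apply: (@le_trans _ _ (\sum_(0 <= a <oo) P (ga a))%E).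
  by apply: lee_nneseries => a _ //.
have mU : measurable (\bigcup_a ga a) by exact: bigcup_measurable.
have triv : trivIset setT ga.
  move=> a b _ _ [w [[fwa nw] [fwb _]]].
  apply: first_after_inj fwa fwb => k; rewrite leNgt; apply/negP => H.
  by apply: nw; exists k.
rewrite -(measure_semi_bigcup P mga triv mU).
exact: probability_le1.
Qed.

(** The hypothesis bounds [F a] by [q] conditionally on the position [a] of the first arrival.
    Averaging over [a] gives [q] again, so the infinite union costs nothing. *)
Lemma fa_union (F : nat -> Omega -> bool) (q : R) : 0 <= q ->
  (forall a, measurable_fun setT (F a)) ->
  (forall a, P [set w | first_after (Y w) s a && F a w] <= P (fa a) * q%:E)%E ->
  measurable (\bigcup_a [set w | first_after (Y w) s a && F a w]) /\
  (P (\bigcup_a [set w | first_after (Y w) s a && F a w]) <= q%:E)%E.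
Proof.
move=> q0 mF HF; split; first by apply: bigcup_measurable => a _; exact: mfaF.
apply: (@le_trans _ _ (\sum_(0 <= a <oo) P [set w | first_after (Y w) s a && F a w])%E).
  apply: measure_sigma_subadditive => //.
  - by move=> a; exact: mfaF.
  - by apply: bigcup_measurable => a _; exact: mfaF.
apply: (@le_trans _ _ (\sum_(0 <= a <oo) (q%:E * P (fa a)))%E).
  by apply: lee_nneseries => a _ //; rewrite muleC; exact: HF.
rewrite nneseriesZl//; rewrite -[leRHS]mule1.
by apply: lee_wpmul2l; [rewrite lee_fin|exact: sum_fa_le1].
Qed.

(** The tilt [1] in [early_arrival] produces the geometric factor in [k], which makes the excess of
    arrivals in a bad epoch summable. *)
Lemma tail_event (h : R) (k : nat) : exists Ev : set Omega,
  [/\ measurable Ev, (P Ev <= (expR (rate * h) / 2 ^+ k.+1)%:E)%E &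
  forall w, (forall k, 0 <= Y w k) -> (exists k, s <= psum (Y w) k) ->
  ~ Ev w -> forall M,
  (count (fun k => (s <= psum (Y w) k.+1)%R && (psum (Y w) k.+1 <= s + h)%R) (iota 0 M) <= k)%N].
Proof.
have [|||mE PE] := @fa_union (fun a w => psum (Y w) (a + k).+1 <= s + h)
   (expR (rate * h) / 2 ^+ k.+1).
- by rewrite divr_ge0 ?expR_ge0 ?exprn_ge0.
- by move=> a; apply: measurable_fun_ler => //; exact: (measurable_psum indX).
- move=> a; have := early_arrival indX ie_inj rate0 law_ie s h a k (@ler01 R).
  by rewrite mul1r.
eexists; split; [exact: mE|exact: PE|].
move=> w Y0 [k0 hk0] nE M; have [a fwa] := first_after_ex Y0 s0 hk0.
have := @count_upper _ _ Y0 s (s + h) a k M predT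
  (fun k => (s <= psum (Y w) k.+1)%R && (psum (Y w) k.+1 <= s + h)%R) fwa.
rewrite count_predT size_iota; apply.
  rewrite ltNge; apply/negP => H; apply: nE; exists a => //=.
  by rewrite fwa.
by move=> l /andP[].
Qed.

Section Params.
Variables (h1 h2 eta th L : R) (N : nat).
Hypothesis h10 : 0 <= h1.
Hypothesis h12 : h1 <= h2.
Hypothesis eta0 : 0 <= eta.
Hypothesis th01 : 0 <= th <= 1/2.
Hypothesis hL : rate * h2 + eta + 1 <= L.
Hypothesis N0 : (0 < N)%N.

(** The Chernoff bound common to all bad events: tilt [th], deviation [eta], at most [L] variables,
    each with second-order term [2 * th ^ 2]. *)
Let q := expR (- (th * eta) + 2 * th ^+ 2 * L).
Let cU h := Num.truncn (rate * h + eta).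
Let cL h := Num.truncn (rate * h - eta).

(** [BU] and [BL] are too many and too few arrivals in a window of length [h]. [CU] and [CL] are, at
    the grid point [i / N], too many acceptances among [cU h1] coins and too many rejections among
    [cL h1] coins. The guard [0 < cL h] in [BL] removes the case where the lower bound is void and
    the predecessor would be a default value. *)
Let BU h := \bigcup_a [set w | first_after (Y w) s a &&
  (psum (Y w) (a + cU h).+1 <= s + h)].
Let BL h := \bigcup_a [set w | first_after (Y w) s a &&
  ((0 < cL h)%N && (s + h <= psum (Y w) (a + (cL h).-1).+1))].
Let pt (i : nat) : R := i%:R / N%:R.
Let CU i := \bigcup_a [set w | first_after (Y w) s a &&
  (pt i * (cU h1)%:R + eta <= \sum_(l < cU h1) (Z w (a + l) < pt i)%R%:R)].
Let CL i := \bigcup_a [set w | first_after (Y w) s a &&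
  ((1 - pt i) * (cL h1)%:R + eta <= \sum_(l < cL h1) (~~ (Z w (a + l) < pt i)%R)%:R)].

Let cUP (h : R) : 0 <= h -> ((cU h)%:R : R) <= rate * h + eta < (cU h)%:R + 1.
Proof.
move=> h0; have c0 : 0 <= rate * h + eta by rewrite addr_ge0// mulr_ge0// ltW.
by have := truncn_itv c0; rewrite natr1.
Qed.

Let cLP (h : R) : (0 < cL h)%N -> ((cL h)%:R : R) <= rate * h - eta.
Proof.
by rewrite truncn_gt0 => c0; rewrite truncn_le//; lra.
Qed.

Let cLP2 (h : R) : rate * h - eta < (cL h)%:R + 1.
Proof. by rewrite natr1; exact: truncnS_gt. Qed.

Let bBU (h : R) : 0 <= h -> h <= h2 -> measurable (BU h) /\ (P (BU h) <= q%:E)%E.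
Proof.
have := (hL, h12, h10, eta0, rate0) => -[[[[hLx h12x] h10x] eta0x] rate0x].
move=> h0 hh2; apply: fa_union; first exact: expR_ge0.
  by move=> a; apply: measurable_fun_ler => //; exact: (measurable_psum indX).
move=> a; have /andP[t0 t1] := th01.
apply: le_trans (early_arrival indX ie_inj rate0 law_ie s h a _ t0) _.
rewrite lee_wpmul2l// lee_fin.
have /andP[u1 u2] := cUP h0.
have hr : rate * h <= rate * h2 by rewrite ler_wpM2l// ltW.
rewrite -exprVn; apply: (@le_trans _ _ (expR (th * rate * h) * expR (- th + 2 * th ^+ 2) ^+ (cU h).+1)).
  rewrite ler_wpM2l ?expR_ge0// lerXn2r ?nnegrE ?expR_ge0 ?invr_ge0//; first by lra.
  by apply: inv1D_le_expR; lra.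
rewrite -expRM_natl -expRD ler_expR -natr1.
move: u1 u2 hr; set c : R := (cU h)%:R; move=> u1 u2 hr.
have cL1 : c + 1 <= L by lra.
have : th ^+ 2 * (c + 1) <= th ^+ 2 * L by rewrite ler_wpM2l ?sqr_ge0//; lra.
have : th * (rate * h + eta) <= th * (c + 1) by rewrite ler_wpM2l//; lra.
lra.
Qed.

Let bBL (h : R) : 0 <= h -> h <= h2 -> measurable (BL h) /\ (P (BL h) <= q%:E)%E.
Proof.
have := (hL, h12, h10, eta0, rate0) => -[[[[hLx h12x] h10x] eta0x] rate0x].
move=> h0 hh2; apply: fa_union; first exact: expR_ge0.
  move=> a; apply: measurable_and; first exact: measurable_cst.
  by apply: measurable_fun_ler => //; exact: (measurable_psum indX).
move=> a; have /andP[t0 t1] := th01.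
have [c0|c0] := ltnP 0 (cL h); last first.
  rewrite [X in P X](_ : _ = set0).
    by rewrite measure0 mule_ge0// lee_fin expR_ge0.
  by apply/seteqP; split => w //=; rewrite andbF.
have th1 : 0 <= th < 1 by lra.
rewrite /=; apply: le_trans (late_arrival indX ie_inj rate0 law_ie s h a _ th1) _.
rewrite lee_wpmul2l// lee_fin prednK//.
have u1 := cLP c0.
have hr : rate * h <= rate * h2 by rewrite ler_wpM2l// ltW.
rewrite -exprVn; apply: (@le_trans _ _ (expR (- (th * rate * h)) * expR (- - th + 2 * (- th) ^+ 2) ^+ (cL h))).
  rewrite ler_wpM2l ?expR_ge0// lerXn2r ?nnegrE ?expR_ge0 ?invr_ge0//; first by lra.
  by apply: inv1D_le_expR; lra.
rewrite -expRM_natl -expRD ler_expR.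
move: u1 hr; set c : R := (cL h)%:R; move=> u1 hr.
have : th ^+ 2 * c <= th ^+ 2 * L by rewrite ler_wpM2l ?sqr_ge0//; lra.
have : th * c <= th * (rate * h - eta) by rewrite ler_wpM2l//; lra.
lra.
Qed.

Let pt01 i : (i <= N)%N -> 0 <= pt i <= 1.
Proof.
move=> iN; have N0' : 0 < N%:R :> R by rewrite ltr0n.
by rewrite /pt divr_ge0//= ler_pdivrMr// mul1r ler_nat.
Qed.

Let coin_exp p (c : R) : 0 <= p <= 1 -> 0 <= c <= L ->
  expR (c * (p * (th + 2 * th ^+ 2)) - th * (p * c + eta)) <= q.
Proof.
move=> /andP[p0 p1] /andP[c0 c1]; rewrite ler_expR.
have : p * c <= L.
  by apply: le_trans c1; rewrite ler_piMl.
move=> H; have : th ^+ 2 * (p * c) <= th ^+ 2 * L by rewrite ler_wpM2l ?sqr_ge0.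
lra.
Qed.

Let ltp (p : R) : measurable_fun setT (fun x : R => x < p).
Proof. exact: measurable_fun_ltr. Qed.

Let cUL : (cU h1)%:R <= L /\ (cL h1)%:R <= L.
Proof.
have := (hL, h12, h10, eta0, rate0) => -[[[[hLx h12x] h10x] eta0x] rate0x].
have /andP[u1 u2] := cUP h10.
have hr : rate * h1 <= rate * h2 by rewrite ler_wpM2l// ltW.
split; first by lra.
have [->|c0] := posnP (cL h1); last by have := cLP c0; lra.
have : 0 <= rate * h2 by rewrite mulr_ge0 ?(ltW rate0)//; lra.
lra.
Qed.

Let bCU i : (i <= N)%N -> measurable (CU i) /\ (P (CU i) <= q%:E)%E.
Proof.
move=> iN; apply: fa_union; first exact: expR_ge0.
  move=> a; apply: measurable_fun_ler => //.
  by apply: measurable_sum => l; apply: measurable_natb; exact: (measurableT_comp (ltp _) (mX _)).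
move=> a; apply: le_trans (coin_chernoff indX ie_inj iu_inj ie_iu rate0 law_ie s _ a (cU h1) (ltp (pt i)) _ th01) _.
  by move=> k; exact: (uniform_lt (mX _) (law_iu k) (pt01 iN)).
rewrite lee_wpmul2l// lee_fin; apply: coin_exp; first exact: pt01.
by rewrite ler0n; case: cUL.
Qed.

Let bCL i : (i <= N)%N -> measurable (CL i) /\ (P (CL i) <= q%:E)%E.
Proof.
move=> iN; have mN : measurable_fun setT (fun x : R => ~~ (x < pt i)).
  by apply: measurable_neg; exact: ltp.
apply: fa_union; first exact: expR_ge0.
  move=> a; apply: measurable_fun_ler => //.
  by apply: measurable_sum => l; apply: measurable_natb; exact: (measurableT_comp mN (mX _)).
move=> a; apply: le_trans (coin_chernoff indX ie_inj iu_inj ie_iu rate0 law_ie s _ a (cL h1) mN (p := 1 - pt i) _ th01) _.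
  move=> k; have mlt : measurable [set w | Z w k < pt i].
    rewrite -[X in measurable X]setTI.
    by apply: (measurableT_comp (ltp (pt i)) (mX (iu k)) measurableT (Y := [set true])).
  have -> : [set w | ~~ (Z w k < pt i)] = ~` [set w | Z w k < pt i].
    by apply/seteqP; split => w /= /negP.
  rewrite probability_setC// EFinB; congr (_ - _)%E.
  exact: (uniform_lt (mX _) (law_iu k) (pt01 iN)).
rewrite lee_wpmul2l// lee_fin; apply: coin_exp; first by have := pt01 iN; lra.
by rewrite ler0n; case: cUL.
Qed.

(* The coin counts are controlled for all acceptance probabilities [p] at once,
   through monotonicity in [p] and the grid [i / N]: the policy picks [p] from the
   past, and uniformity makes conditioning on the past unnecessary. *)
Lemma epoch_bad : exists Bad : set Omega,
  [/\ measurable Bad, (P Bad <= ((2 * N + 6)%:R * q)%:E)%E &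
  forall w, (forall k, 0 <= Y w k) -> (exists k, s <= psum (Y w) k) ->
  ~ Bad w -> forall M, (forall k, (M <= k)%N -> s + h2 < psum (Y w) k.+1) ->
  [/\ `|(count (fun k => (s <= psum (Y w) k.+1)%R && (psum (Y w) k.+1 <= s + h2)%R) (iota 0 M))%:R
        - rate * h2| <= eta + 1,
      `|(count (fun k => (s <= psum (Y w) k.+1)%R && (psum (Y w) k.+1 < s + h1)%R) (iota 0 M))%:R
        - rate * h1| <= eta + 1 &
     forall p, 0 <= p <= 1 ->
      `|(count (fun k => [&& s <= psum (Y w) k.+1, psum (Y w) k.+1 < s + h1 & Z w k < p]%R) (iota 0 M))%:R
        - p * (rate * h1)| <= 2 * eta + 1 + L / N%:R] ].
Proof.
have := (hL, h12, h10, eta0, rate0) => -[[[[hLx h12x] h10x] eta0x] rate0x].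
pose evs : seq (nat * nat) := [:: (0, 0); (1, 0); (2, 0); (3, 0)]%N ++
  [seq (4, i)%N | i <- iota 0 N.+1] ++ [seq (5, i)%N | i <- iota 0 N.+1].
pose Ev (c : nat * nat) := match c.1 with
  | 0%N => BU h1 | 1%N => BU h2 | 2%N => BL h1 | 3%N => BL h2
  | 4%N => CU c.2 | _ => CL c.2 end.
have mem4 i : (i <= N)%N -> (4, i)%N \in evs.
  move=> iN; rewrite !mem_cat; apply/orP; right; apply/orP; left.
  by apply: map_f; rewrite mem_iota.
have mem5 i : (i <= N)%N -> (5, i)%N \in evs.
  move=> iN; rewrite !mem_cat; apply/orP; right; apply/orP; right.
  by apply: map_f; rewrite mem_iota.
have [|mBad PBad] := @measure_seqU _ _ _ P _ Ev evs q.
  have bBU2 : measurable (BU h2) /\ (P (BU h2) <= q%:E)%E.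
    by apply: bBU => //; exact: le_trans h12.
  have bBL2 : measurable (BL h2) /\ (P (BL h2) <= q%:E)%E.
    by apply: bBL => //; exact: le_trans h12.
  move=> c; rewrite mem_cat => /orP[|].
    by rewrite !inE => /or4P[] /eqP ->; [exact: bBU|exact: bBU2|exact: bBL|exact: bBL2].
  rewrite mem_cat => /orP[] /mapP[i]; rewrite mem_iota => iN ->.
    exact: bCU.
  exact: bCL.
exists (\big[setU/set0]_(c <- evs) Ev c); split => //.
  (* Four arrival events, and two coin events for each of the [N + 1] grid points. *)
  apply: le_trans PBad _; rewrite lee_fin ler_wpM2r ?expR_ge0// ler_nat.
  rewrite /evs !size_cat !size_map !size_iota/=; lia.
move=> w Y0 [k0 hk0] /notin_seqU nB M HM.
have [a fwa] := first_after_ex Y0 s0 hk0.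
have h20 : 0 <= h2 by exact: le_trans h12.
have up c h : c \in evs -> Ev c = BU h -> s + h < psum (Y w) (a + cU h).+1.
  move=> /nB H E; rewrite ltNge; apply/negP => H'; apply: H; rewrite E.
  by exists a => //=; rewrite fwa.
have low c h : c \in evs -> Ev c = BL h ->
    (0 < cL h)%N -> psum (Y w) (a + (cL h).-1).+1 < s + h.
  move=> /nB H E c0; rewrite ltNge; apply/negP => H'; apply: H; rewrite E.
  by exists a => //=; rewrite fwa c0.
have up1 := up (0, 0)%N h1 isT erefl.
have up2 := up (1, 0)%N h2 isT erefl.
have low1 := low (2, 0)%N h1 isT erefl.
have low2 := low (3, 0)%N h2 isT erefl.
have HM1 k : (M <= k)%N -> s + h1 <= psum (Y w) k.+1.
  by move=> /HM h; apply: le_trans (ltW h); rewrite lerD2l.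
have HM2 k : (M <= k)%N -> s + h2 <= psum (Y w) k.+1 by move=> /HM /ltW.
have lowc h (Q Pr : pred nat) :
    ((0 < cL h)%N -> psum (Y w) (a + (cL h).-1).+1 < s + h) ->
    (forall k, (M <= k)%N -> s + h <= psum (Y w) k.+1) ->
    (forall k, s <= psum (Y w) k.+1 -> psum (Y w) k.+1 < s + h -> Q k -> Pr k) ->
    (count Q (iota a (cL h)) <= count Pr (iota 0 M))%N.
  move=> l1 l2 l3; have [->//|c0] := posnP (cL h).
  exact: (count_lower Y0 fwa c0 (l1 c0) l2 l3).
split.
- pose Pr k := (s <= psum (Y w) k.+1) && (psum (Y w) k.+1 <= s + h2).
  have U : (count Pr (iota 0 M) <= size (iota a (cU h2)))%N.
    rewrite -count_predT.
    by apply: (@count_upper _ _ Y0 s (s + h2) a (cU h2) M predT Pr fwa up2) => k /andP[-> ->].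
  have Lo : (size (iota a (cL h2)) <= count Pr (iota 0 M))%N.
    rewrite -count_predT; apply: (lowc h2 predT Pr low2 HM2) => k k1 k2 _.
    by rewrite /Pr k1 ltW.
  rewrite size_iota -(ler_nat R) in U; rewrite size_iota -(ler_nat R) in Lo.
  have /andP[u1 u2] := cUP h20; have l1 := cLP2 h2.
  by rewrite ler_norml; apply/andP; split; lra.
- pose Pr k := (s <= psum (Y w) k.+1) && (psum (Y w) k.+1 < s + h1).
  have U : (count Pr (iota 0 M) <= size (iota a (cU h1)))%N.
    rewrite -count_predT.
    by apply: (@count_upper _ _ Y0 s (s + h1) a (cU h1) M predT Pr fwa up1) => k /andP[-> /ltW ->].
  have Lo : (size (iota a (cL h1)) <= count Pr (iota 0 M))%N.
    rewrite -count_predT; apply: (lowc h1 predT Pr low1 HM1) => k k1 k2 _.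
    by rewrite /Pr k1.
  rewrite size_iota -(ler_nat R) in U; rewrite size_iota -(ler_nat R) in Lo.
  have /andP[u1 u2] := cUP h10; have l1 := cLP2 h1.
  by rewrite ler_norml; apply/andP; split; lra.
- move=> p /andP[p0 p1].
  pose Pr k := [&& s <= psum (Y w) k.+1, psum (Y w) k.+1 < s + h1 & Z w k < p].
  have N0' : 0 < N%:R :> R by rewrite ltr0n.
  have pN0 : 0 <= p * N%:R by rewrite mulr_ge0// ltW.
  pose i := Num.truncn (p * N%:R).
  have /andP[i1 i2] := truncn_itv pN0.
  have iN : (i <= N)%N.
    by rewrite -(ler_nat R); apply: le_trans i1 _; rewrite ler_piMl// ltW.
  have iV : pt i <= p by rewrite /pt ler_pdivrMr.
  have iV2 : p <= pt i + N%:R^-1.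
    have -> : pt i + N%:R^-1 = i.+1%:R / N%:R by rewrite /pt -natr1 mulrDl div1r.
    by rewrite ler_pdivlMr// ltW.
  (* The upper grid neighbour of [p]; if [p] already sits at the last grid point, [N] itself
     serves. *)
  have [j jN [jV jV2]] : exists2 j, (j <= N)%N & p <= pt j /\ pt j <= p + N%:R^-1.
    have [iN'|iN'] := ltnP i N.
      exists i.+1 => //.
      have E : pt i.+1 = pt i + N%:R^-1 by rewrite /pt -natr1 mulrDl div1r.
      by rewrite E; split => //; rewrite lerD2r.
    have {}iN : i = N by apply/eqP; rewrite eqn_leq iN.
    exists N => //; rewrite /pt divff ?gt_eqF//; split => //.
    move: iV; rewrite iN /pt divff ?gt_eqF// => iV'.
    by apply: le_trans iV' _; rewrite lerDl invr_ge0 ltW.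
  have U1 : (count Pr (iota 0 M) <= count (fun k => Z w k < pt j)%R (iota a (cU h1)))%N.
    apply: (@count_upper _ _ Y0 s (s + h1) a (cU h1) M _ Pr fwa up1) => k /and3P[-> /ltW -> zp]; split => //.
    exact: lt_le_trans jV.
  have L1 : (count (fun k => Z w k < pt i)%R (iota a (cL h1)) <= count Pr (iota 0 M))%N.
    apply: (lowc h1 _ Pr low1 HM1) => k k1 k2 zp.
    by rewrite /Pr k1 k2/=; apply: lt_le_trans iV.
  have U2 : (count (fun k => Z w k < pt j)%R (iota a (cU h1)))%:R < pt j * (cU h1)%:R + eta.
    rewrite ltNge; apply/negP => H; apply: (nB _ (mem4 _ jN)).
    exists a => //=; rewrite fwa/=.
    by rewrite (sum_natb_count R (fun k => Z w k < pt j)).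
  have L2 : (count (fun k => ~~ (Z w k < pt i)%R) (iota a (cL h1)))%:R < (1 - pt i) * (cL h1)%:R + eta.
    rewrite ltNge; apply/negP => H; apply: (nB _ (mem5 _ iN)).
    exists a => //=; rewrite fwa/=.
    by rewrite (sum_natb_count R (fun k => ~~ (Z w k < pt i))).
  have L3 : (count (fun k => Z w k < pt i)%R (iota a (cL h1)))%:R +
    (count (fun k => ~~ (Z w k < pt i)%R) (iota a (cL h1)))%:R = (cL h1)%:R :> R.
    by rewrite -natrD (count_predC (fun k => Z w k < pt i)) size_iota.
  rewrite -(ler_nat R) in U1; rewrite -(ler_nat R) in L1.
  rewrite -/Pr.
  set cnt : R := (count Pr (iota 0 M))%:R in U1 L1 *.
  set cb : R := (count _ _)%:R in U1 U2.
  set cc : R := (count _ _)%:R in L1 L3.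
  set cd : R := (count _ _)%:R in L2 L3.
  have /andP[u1 u2] := cUP h10; have l1 := cLP2 h1.
  have [cU1 cL1] := cUL.
  set cu : R := (cU h1)%:R in U2 u1 u2 cU1.
  set cl : R := (cL h1)%:R in L2 L3 l1 cL1.
  have cu0 : 0 <= cu by rewrite ler0n.
  have cl0 : 0 <= cl by rewrite ler0n.
  have Ninv0 : 0 < N%:R^-1 :> R by rewrite invr_gt0.
  set v : R := N%:R^-1 in iV2 jV2 Ninv0 *.
  set pj : R := pt j in jV jV2 U2.
  set pi_ : R := pt i in iV iV2 L2.
  (* The error budget: one [eta] for the number of coins, one for their outcomes, [L / N] for the
     grid, and [1] for rounding in the lower bound. *)
  have B1 : pj * cu <= p * (rate * h1) + eta + L * v.
    have : pj * cu <= (p + v) * cu by rewrite ler_wpM2r.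
    have : p * cu <= p * (rate * h1 + eta) by rewrite ler_wpM2l.
    have : p * eta <= eta by rewrite ler_piMl.
    have : v * cu <= v * L by rewrite ler_wpM2l// ltW.
    lra.
  have B2 : p * (rate * h1) - eta - 1 - L * v <= pi_ * cl.
    have : (p - v) * cl <= pi_ * cl by rewrite ler_wpM2r// lerBlDr.
    have : p * (rate * h1 - eta - 1) <= p * cl by rewrite ler_wpM2l//; lra.
    have : p * eta <= eta by rewrite ler_piMl.
    have : v * cl <= v * L by rewrite ler_wpM2l// ltW.
    lra.
  by rewrite ler_norml; apply/andP; split; lra.
Qed.

End Params.
End EpochBad.

(** * Integration of the losses *)

Section LowerIntegral.
Context d (T : measurableType d) (R : realType) (mu : {measure set T -> \bar R}).
Local Open Scope ereal_scope.
Import HBNNSimple.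

(* For non-measurable functions the library integral is a lower integral:
   it is still monotone, and this is all that is used about [f] and [g] below. *)
Lemma ge0_le_lower_integral (f g : T -> \bar R) :
  (forall x, 0 <= f x) -> (forall x, f x <= g x) ->
  \int[mu]_x f x <= \int[mu]_x g x.
Proof.
move=> f0 fg; have g0 x : 0 <= g x by exact: le_trans (fg x).
rewrite !ge0_integralTE//; apply: le_ereal_sup => _ [h hf <-].
by exists h => // x; exact: le_trans (fg x).
Qed.

(** With lower integrals, additivity is available only for measurable summands. If a simple function
    [s] is at most [g^+ + l], the positive part of [s - l] is measurable and at most [g^+], which
    gives the inequality for [s]. This is used for [s = h + k] with [h] below [f] and [k] below
    [g^-], followed by suprema over [h] and [k]. Since [f] is nonnegative, [g^- <= l], so the
    subtracted integral is finite. *)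
Lemma le_integral_gap (f g : T -> R) (l : T -> \bar R) (M : R) :
  (forall x, 0 <= f x)%R -> (forall x, 0 <= l x) -> measurable_fun setT l ->
  (forall x, (f x)%:E <= (g x)%:E + l x) -> \int[mu]_x l x <= M%:E ->
  \int[mu]_x (f x)%:E <= \int[mu]_x (g x)%:E + M%:E.
Proof.
move=> f0 l0 ml fgl lM.
pose G x := (g x)%:E.
have simple_bound (s : T -> R) : measurable_fun setT s -> (forall x, 0 <= s x)%R ->
    (forall x, (s x)%:E <= G^\+ x + l x) ->
    \int[mu]_x (s x)%:E <= \int[mu]_x G^\+ x + M%:E.
  move=> /measurable_EFinP ms s0 sG.
  pose t x := maxe ((s x)%:E - l x) 0.
  have mt : measurable_fun setT t.
    by apply: measurable_maxe => //; exact: emeasurable_funB.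
  have t0 x : 0 <= t x by rewrite /t le_max lexx orbT.
  have tG x : t x <= G^\+ x.
    rewrite /t ge_max; apply/andP; split; last exact: funepos_ge0.
    have := sG x; have := l0 x; case: (l x) => [v| |] //.
      by move=> _ h; rewrite leeBlDr.
    by move=> _ _; rewrite addeNy leNye.
  have stl x : (s x)%:E <= t x + l x.
    have := l0 x; rewrite /t; case: (l x) => [v| |] //.
      by move=> _; rewrite -leeBlDr// le_max lexx.
    by move=> _; rewrite addeNy max_r ?leNye// add0e leey.
  apply: (@le_trans _ _ (\int[mu]_x (t x + l x))).
    apply: ge0_le_lower_integral; last exact: stl.
    by move=> x; rewrite lee_fin.
  rewrite ge0_integralD//.
  by apply: leeD => //; exact: ge0_le_lower_integral.
have Gneg_l x : G^\- x <= l x.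
  rewrite funenegE ge_max l0 andbT.
  have := fgl x; have := f0 x; rewrite /G -lee_fin => f0x.
  move=> /(le_trans f0x); have := l0 x; case: (l x) => [v| |]//; last by move=> _ _; rewrite leey.
  by rewrite -EFinD -EFinN !lee_fin => v0 h; lra.
have Gneg0 x : 0 <= G^\- x by exact: funeneg_ge0.
have Ineg : \int[mu]_x G^\- x <= M%:E.
  by apply: le_trans lM; exact: ge0_le_lower_integral.
have Ineg0 : 0 <= \int[mu]_x G^\- x by exact: integral_ge0.
have finneg : \int[mu]_x G^\- x \is a fin_num.
  by rewrite ge0_fin_numE//; apply: le_lt_trans Ineg _; rewrite ltry.
have -> : \int[mu]_x (g x)%:E = \int[mu]_x G^\+ x - \int[mu]_x G^\- x.
  by rewrite integralE.
have sup_bound (h : {nnsfun T >-> R}) : (forall x, (h x)%:E <= (f x)%:E) ->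
    \int[mu]_x (h x)%:E + \int[mu]_x G^\- x <= \int[mu]_x G^\+ x + M%:E.
  move=> hf.
  have [hfin|] := boolP (\int[mu]_x (h x)%:E \is a fin_num); last first.
    move=> hinf; have -> : \int[mu]_x G^\+ x + M%:E = +oo; last by rewrite leey.
    apply/eqP; rewrite -leye_eq; apply: le_trans (simple_bound h _ _ _) => //.
      have h0 : 0 <= \int[mu]_x (h x)%:E.
        by apply: integral_ge0 => x _; rewrite lee_fin.
      by move: hinf; rewrite ge0_fin_numE// -leNgt.
    move=> x; apply: le_trans (hf x) _; apply: le_trans (fgl x) _.
    by apply: leeD => //; rewrite funeposE le_max lexx.
  rewrite addeC -leeBrDr// [X in X <= _]ge0_integralTE//.
  apply: ge_ereal_sup => _ [k kG <-].
  rewrite leeBrDr// -integralT_nnsfun -ge0_integralD//; last 4 first.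
  - by move=> x _; rewrite lee_fin.
  - exact/measurable_EFinP.
  - by move=> x _; rewrite lee_fin.
  - exact/measurable_EFinP.
  apply: (simple_bound (fun x => k x + h x)%R).
  - exact: measurable_funD.
  - by move=> x; rewrite addr_ge0.
  move=> x; have := kG x; have := hf x; have := fgl x; have := l0 x.
  rewrite funenegE funeposE /G -EFinN -!EFin_max !lee_fin.
  case: (l x) => [v| |] //; last by move=> *; rewrite addey// leey.
  rewrite -!EFinD !lee_fin => v0 h1 h2.
  have [g0|g0] := leP 0%R (g x).
    by rewrite (max_r (_ : - g x <= 0)%R) ?(max_l g0); lra.
  by rewrite (max_l (_ : 0 <= - g x)%R) ?(max_r (ltW g0)); lra.
rewrite [X in X <= _]ge0_integralTE//.
apply: ge_ereal_sup => _ [h hf <-].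
rewrite addeAC leeBrDr// -integralT_nnsfun.
exact: sup_bound.
Qed.

End LowerIntegral.

(** * Time scales and numerical constants *)

Section EpochScale.
Context (R : realType).

Lemma expR_half_le2 : expR (1 / 2) <= 2 :> R.
Proof.
have := expR_ge1Dx (- (1 / 2) : R); rewrite expRN => h.
have e0 := expR_gt0 (1 / 2 : R).
have : (1 + - (1 / 2)) * expR (1 / 2) <= 1 :> R.
  by rewrite -ler_pdivlMr// [leRHS]div1r; exact: h.
lra.
Qed.

(** The origin of the threshold [4] on the horizon: [T >= 4] gives [ln T >= 1], so [ln (ln T) >= 0]
    and the clipping in [K_irt] is inactive. *)
Lemma expR1_le4 : expR 1 <= 4 :> R.
Proof.
have -> : 1 = 1 / 2 + 1 / 2 :> R by lra.
rewrite expRD; have := expR_half_le2; have := expR_gt0 (1 / 2 : R); nra.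
Qed.

Variable T : nat.
Hypothesis T4 : (4 <= T)%N.
Local Notation K := (K_irt R T).
Local Notation tau := (tau_irt R T).
Local Notation sg := (sigma_irt R T).

Let T1 : (1 <= T)%N. Proof. exact: leq_trans T4. Qed.

Let lnT1 : 1 <= ln (T%:R : R).
Proof.
rewrite -[X in X <= _]expRK ler_ln ?posrE ?expR_gt0//.
  by apply: le_trans expR1_le4 _; rewrite (ler_nat R 4).
by rewrite ltr0n.
Qed.

Let ln65 : 0 < ln (6 / 5 : R).
Proof. by apply: ln_gt0; lra. Qed.

Let ln_pow65 k : ln ((6 / 5) ^+ k) = k%:R * ln (6 / 5 : R).
Proof. by rewrite lnXn; [apply: esym; exact: mulr_natl|lra]. Qed.

Lemma ln_tau u : ln (tau u) = (5 / 6) ^+ u * ln (T%:R : R).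
Proof. by rewrite /tau_irt ln_powR. Qed.

Let Kbound : ln (ln (T%:R : R)) / ln (6 / 5 : R) <= K%:R < ln (ln (T%:R : R)) / ln (6 / 5 : R) + 1.
Proof.
have x0 : 0 <= ln (ln (T%:R : R)) / ln (6 / 5 : R).
  by rewrite divr_ge0 ?(ltW ln65)// ln_ge0.
rewrite /K_irt /=; set x : R := ln (ln (T%:R : R)) / ln (6 / 5 : R) in x0 *.
have c0 : 0 <= Num.ceil x by rewrite ceil_ge0 (lt_le_trans _ x0)// ltrN10.
rewrite c0 natr_absz ger0_norm// ceil_ge/=.
by rewrite -ltrBlDr; have := ceil_itv x; rewrite intrB => /andP[].
Qed.

Let pow65 : ln (T%:R : R) <= (6 / 5) ^+ K.
Proof.
have /andP[h _] := Kbound.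
rewrite ler_pdivrMr// in h.
rewrite -ler_ln ?posrE ?exprn_gt0//; last exact: lt_le_trans lnT1.
by rewrite ln_pow65.
Qed.

(** The ceiling in [K] gives [ln T <= (6/5) ^ K], hence [ln tau_K <= 1]. *)
Lemma tau_K_le : tau K <= 4.
Proof.
apply: le_trans expR1_le4.
rewrite -ler_ln ?posrE ?expR_gt0// ?tau_gt0// expRK ln_tau.
apply: (@le_trans _ _ ((5 / 6) ^+ K * (6 / 5) ^+ K)).
  by rewrite ler_wpM2l ?pow65// exprn_ge0//; lra.
by rewrite -exprMn (_ : 5 / 6 * (6 / 5) = 1 :> R) ?expr1n//; field.
Qed.

(** The other side of the ceiling: [(6/5) ^ (K - 1) <= ln T]. *)
Lemma ln_tau_ge u : (u < K)%N -> (6 / 5) ^+ (K.-1 - u) <= ln (tau u).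
Proof.
move=> uK; rewrite ln_tau.
have K0 : (0 < K)%N by exact: leq_ltn_trans uK.
have h : (6 / 5) ^+ K.-1 <= ln (T%:R : R).
  have /andP[_ h] := Kbound.
  rewrite -(prednK K0) -natr1 ltrD2r ltr_pdivlMr// in h.
  rewrite -ler_ln ?posrE ?exprn_gt0//; last exact: lt_le_trans lnT1.
  by rewrite ln_pow65 ltW.
apply: le_trans (_ : (5 / 6) ^+ u * (6 / 5) ^+ K.-1 <= _); last first.
  by rewrite ler_wpM2l// exprn_ge0//; lra.
have uK' : (u <= K.-1)%N by rewrite -ltnS prednK.
rewrite -[in X in _ <= X](subnKC uK') exprD mulrA -exprMn.
by rewrite (_ : 5 / 6 * (6 / 5) = 1 :> R) ?expr1n ?mul1r//; field.
Qed.

Lemma sigma_ge1 u : (u < K)%N -> 1 <= sg u.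
Proof.
move=> uK; have l1 : 0 <= ln (tau u).
  by apply: le_trans (ln_tau_ge uK); rewrite exprn_ge0//; lra.
have t1 : 1 <= tau u.
  rewrite -[tau u]lnK ?posrE ?tau_gt0//.
  by rewrite -[X in X <= _]expR0 ler_expR.
by rewrite -[X in X <= _](powRr0 (tau u)) /sigma_irt ler_powR// invr_ge0.
Qed.

(** [ln tau_u = 12 * ln sigma <= 12 * sigma]. This weakens doubly exponential decay to a geometric
    one, which suffices for the summation. *)
Lemma inv_sigma_le u : (u < K)%N -> (sg u)^-1 <= 12 * (5 / 6) ^+ (K.-1 - u).
Proof.
move=> uK; have s0 := sigma_gt0 R T1 u.
have h : ln (tau u) <= 12 * sg u.
  rewrite -(sigma12 R T1) lnXn// -[leLHS]mulr_natl ler_wpM2l//.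
  have := expR_ge1Dx (ln (sg u)); rewrite lnK//; lra.
have h2 := le_trans (ln_tau_ge uK) h.
have p0 : 0 < (5 / 6) ^+ (K.-1 - u) :> R by rewrite exprn_gt0//; lra.
have e1 : (5 / 6) ^+ (K.-1 - u) * (6 / 5) ^+ (K.-1 - u) = 1 :> R.
  by rewrite -exprMn (_ : 5 / 6 * (6 / 5) = 1 :> R) ?expr1n//; field.
move: p0 e1 h2; set p := (5 / 6) ^+ _; set q := (6 / 5) ^+ _ => p0 e1 h2.
rewrite -(ler_pM2r s0) mulVf ?gt_eqF// (mulrC 12) -mulrA -[leLHS]e1.
by rewrite ler_pM2l.
Qed.

Lemma sum_inv_sigma : \sum_(u < K) (sg u)^-1 <= 72.
Proof.
apply: (@le_trans _ _ (\sum_(u < K) 12 * (5 / 6) ^+ (K.-1 - u))).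
  by apply: ler_sum => u _; exact: inv_sigma_le.
(* [6] is the sum of the geometric series of ratio [5 / 6]. *)
rewrite -mulr_sumr (_ : 72 = 12 * 6 :> R) ?ler_wpM2l//; last by ring.
elim: K => [|k IH]; first by rewrite big_ord0.
rewrite big_ord_recr/= subnn expr0.
have -> : \sum_(i < k) (5 / 6) ^+ (k - i) = 5 / 6 * \sum_(i < k) (5 / 6) ^+ (k.-1 - i) :> R.
  rewrite mulr_sumr; apply: eq_bigr => i _; rewrite -exprS; congr (_ ^+ _).
  by have := ltn_ord i; lia.
lra.
Qed.

End EpochScale.

Section Numerics.
Context (R : realType).

Lemma expRN_le_poly (x : R) (k : nat) : 0 < x -> expR (- x) <= k.+1`!%:R / x ^+ k.+1.
Proof.
move=> x0; have := expR_ge1Dxn k (ltW x0) => h.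
have p0 : 0 < x ^+ k.+1 by rewrite exprn_gt0.
have f0 : 0 < k.+1`!%:R :> R by rewrite ltr0n fact_gt0.
rewrite expRN -[leRHS]invrK lef_pV2 ?posrE ?expR_gt0 ?invr_gt0 ?divr_gt0//.
by rewrite invf_div; apply: le_trans h; rewrite lerDr.
Qed.

(** Four times the mean number of remaining arrivals, rounded up. As [2 >= expR (1 / 2)], the power
    of [2] with this exponent is at least [expR (2 * l * sg ^ 12)], which beats the factor
    [expR (l * sg ^ 12)] of [tail_event]. *)
Definition tail_start (l sg : R) : nat := (Num.truncn (4 * l * sg ^+ 12)).+1.

Lemma tail_start_ge (l sg : R) : 0 <= l -> 0 <= sg ->
  4 * l * sg ^+ 12 <= (tail_start l sg)%:R <= 4 * l * sg ^+ 12 + 1.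
Proof.
move=> l0 s0; have x0 : 0 <= 4 * l * sg ^+ 12 by rewrite !mulr_ge0// exprn_ge0.
have /andP[h1 h2] := truncn_itv x0.
by rewrite /tail_start (ltW h2)/= -natr1 lerD2r.
Qed.

Lemma tail_sum_le (l sg : R) : 0 < l -> 0 < sg ->
  expR (l * sg ^+ 12) / 2 ^+ tail_start l sg <= expR (- (l * sg ^+ 12)).
Proof.
move=> l0 s0; have /andP[h _] := tail_start_ge (ltW l0) (ltW s0).
set B := tail_start l sg in h *.
rewrite ler_pdivrMr ?exprn_gt0//.
apply: (@le_trans _ _ (expR (- (l * sg ^+ 12)) * expR (1 / 2) ^+ B)).
  rewrite -expRM_natl -expRD ler_expR; lra.
by rewrite ler_wpM2l ?expR_ge0// lerXn2r ?nnegrE ?expR_ge0// expR_half_le2.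
Qed.

End Numerics.

Section LossRate.
Context (R : realType) (Ml eps : R).
Hypothesis Ml2 : 2 <= Ml.
Hypothesis eps01 : 0 < eps <= 1.

(** Chosen so that the grid error [L / N], with [L = Ml * sg ^ 12], is at most [eps * sg ^ 7]. *)
Definition grid_size (sg : R) : nat := (Num.truncn (Ml * sg ^+ 5 / eps)).+1.

(** With [eta = eps * sg ^ 7] and [L = Ml * sg ^ 12], the tilt is [eta / (4 * L)], the minimizer of
    [- th * eta + 2 * th ^ 2 * L]. *)
Lemma chernoff_exponent sg : 0 < sg ->
  - (eps / (4 * Ml) * sg ^- 5 * (eps * sg ^+ 7)) +
    2 * (eps / (4 * Ml) * sg ^- 5) ^+ 2 * (Ml * sg ^+ 12) =
  - (eps ^+ 2 / (8 * Ml) * sg ^+ 2).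
Proof.
move=> s0; have M0 : Ml != 0 by rewrite gt_eqF//; have := Ml2; lra.
by field; rewrite M0 gt_eqF.
Qed.

Lemma grid_size_ge sg : 0 < sg -> Ml * sg ^+ 12 / (grid_size sg)%:R <= eps * sg ^+ 7.
Proof.
move=> s0; have /andP[e0 e1] := eps01; have M2 := Ml2.
have x0 : 0 <= Ml * sg ^+ 5 / eps.
  by rewrite !mulr_ge0 ?exprn_ge0 ?invr_ge0 ?ltW//; lra.
have /andP[_ h] := truncn_itv x0.
rewrite ler_pdivrMr ?ltr0n//.
have -> : Ml * sg ^+ 12 = eps * sg ^+ 7 * (Ml * sg ^+ 5 / eps).
  by field; rewrite gt_eqF.
by rewrite ler_wpM2l ?ltW// mulr_gt0// exprn_gt0.
Qed.

Lemma grid_size_le sg : 1 <= sg ->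
  (2 * grid_size sg + 6)%:R <= (2 * Ml / eps + 8) * sg ^+ 5.
Proof.
move=> s1; have /andP[e0 e1] := eps01; have M2 := Ml2.
have s0 : 0 < sg by lra.
have x0 : 0 <= Ml * sg ^+ 5 / eps.
  by rewrite !mulr_ge0 ?exprn_ge0 ?invr_ge0 ?ltW//; lra.
have /andP[h _] := truncn_itv x0.
have s5 : 1 <= sg ^+ 5 by rewrite exprn_ege1.
rewrite /grid_size natrD natrM -natr1.
have -> : (2 * Ml / eps + 8) * sg ^+ 5 = 2 * (Ml * sg ^+ 5 / eps) + 8 * sg ^+ 5.
  by field; rewrite gt_eqF.
lra.
Qed.

Lemma tail_start_le (l sg : R) : 1 <= sg -> 0 < l <= Ml ->
  (tail_start l sg)%:R <= 5 * Ml * sg ^+ 12.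
Proof.
move=> s1 /andP[l0 lM]; have M2 := Ml2.
have /andP[_ h] := tail_start_ge (ltW l0) (le_trans ler01 s1).
have s12 : 1 <= sg ^+ 12 by rewrite exprn_ege1.
have h2 : l * sg ^+ 12 <= Ml * sg ^+ 12 by rewrite ler_wpM2r//; lra.
have h3 : 1 * 1 <= Ml * sg ^+ 12 by rewrite ler_pM//; lra.
lra.
Qed.

(** The exponential is bounded by [9! / x ^ 9] with [x] of order [sg ^ 2]. The resulting [sg ^ -18]
    outweighs [sg ^ 12] arrivals times [sg ^ 5] grid points by exactly one power of [sg]. *)
Definition loss_rate (n : nat) : R :=
  5 * Ml * (n%:R * ((2 * Ml / eps + 8) * (9`!%:R / (eps ^+ 2 / (8 * Ml)) ^+ 9))).

Lemma loss_rate_ge0 n : 0 <= loss_rate n.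
Proof.
have /andP[e0 e1] := eps01; have M2 := Ml2.
have M0 : 0 < Ml by lra.
have h1 : 0 <= 2 * Ml / eps + 8.
  by rewrite addr_ge0// divr_ge0 ?(ltW e0)// mulr_ge0// ltW.
have h2 : 0 <= 9`!%:R / (eps ^+ 2 / (8 * Ml)) ^+ 9.
  by rewrite divr_ge0// exprn_ge0// divr_ge0 ?exprn_ge0 ?mulr_ge0 ?(ltW e0) ?(ltW M0).
have h3 : 0 <= 5 * Ml by rewrite mulr_ge0// ltW.
by rewrite /loss_rate; apply: mulr_ge0 => //; apply: mulr_ge0 => //; exact: mulr_ge0.
Qed.

Lemma good_loss_le (n : nat) (l sg : R) : 1 <= sg -> 0 < l <= Ml ->
  (tail_start l sg)%:R * (n%:R * ((2 * grid_size sg + 6)%:R *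
     expR (- (eps ^+ 2 / (8 * Ml) * sg ^+ 2)))) <= loss_rate n / sg.
Proof.
move=> s1 lM; have /andP[e0 e1] := eps01; have M2 := Ml2.
have s0 : 0 < sg by lra.
have M0 : 0 < Ml by lra.
have g0 : 0 < eps ^+ 2 / (8 * Ml) by rewrite divr_gt0 ?exprn_gt0 ?mulr_gt0.
have x0 : 0 < eps ^+ 2 / (8 * Ml) * sg ^+ 2 by rewrite mulr_gt0 ?exprn_gt0.
have hQ := expRN_le_poly 8 x0.
have hN := grid_size_le s1.
have hB := tail_start_le s1 lM.
set gam := eps ^+ 2 / (8 * Ml) in g0 x0 hQ *.
apply: (@le_trans _ _ (5 * Ml * sg ^+ 12 * (n%:R * ((2 * Ml / eps + 8) * sg ^+ 5 *
    (9`!%:R / (gam * sg ^+ 2) ^+ 9))))).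
  rewrite ler_pM ?mulr_ge0 ?expR_ge0//.
  by rewrite ler_wpM2l// ler_pM ?expR_ge0.
rewrite /loss_rate -/gam; set a := 2 * Ml / eps + 8; set F : R := 9`!%:R.
rewrite le_eqVlt; apply/orP; left; apply/eqP; field.
by rewrite (gt_eqF g0) (gt_eqF s0).
Qed.

End LossRate.

Lemma exp_tail_le (R : realType) (l sg : R) : 0 < l -> 1 <= sg ->
  expR (- (l * sg ^+ 12)) <= l^-1 / sg.
Proof.
move=> l0 s1; have s0 : 0 < sg by lra.
have x0 : 0 < l * sg ^+ 12 by rewrite mulr_gt0 ?exprn_gt0.
apply: le_trans (expRN_le_poly 0 x0) _.
rewrite expr1 -invfM mul1r lef_pV2 ?posrE ?mulr_gt0// ler_pM2l//.
by rewrite -[X in X <= _]expr1; apply: ler_weXn2l.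
Qed.

(** * The loss of a bad epoch as a random variable *)

Section LossFun.
Context d (Omega : measurableType d) (R : realType) (P : probability Omega R).
Context (n : nat) (r : 'I_n -> R) (B : 'I_n -> nat) (D : 'I_n -> Omega -> nat).
Variables (Ev : 'I_n -> nat -> set Omega) (Bad : set Omega) (pb : R) (t : 'I_n -> R).
Hypothesis mEv : forall j k, measurable (Ev j k).
Hypothesis mBad : measurable Bad.
Hypothesis PBad : (P Bad <= pb%:E)%E.
Hypothesis t0 : forall j, 0 <= t j.
Hypothesis PEv : forall j k, (P (Ev j k) <= (t j / 2 ^+ k.+1)%:E)%E.
Local Open Scope ereal_scope.

(** In a bad epoch the remaining arrivals of class [j] number at most [B j] plus the number of tail
    events of index at least [B j] that occur. The tail part is charged on the whole space, so its
    expectation requires no joint estimate with [Bad]. *)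
Let lj j w : \bar R := ((B j)%:R * \1_Bad w)%:E + \sum_(0 <= i <oo) (\1_(Ev j (B j + i)) w)%:E.

Definition loss_bound (w : Omega) : \bar R := \sum_(j < n) (2 * `|r j|)%:E * lj j w.

Let ser0 j w : 0 <= \sum_(0 <= i <oo) (\1_(Ev j (B j + i)) w : R)%:E.
Proof. by apply: nneseries_ge0 => i _ _; rewrite lee_fin. Qed.

Let lj0 j w : 0 <= lj j w.
Proof. by rewrite adde_ge0 ?ser0// lee_fin mulr_ge0. Qed.

Lemma loss_bound_ge0 w : 0 <= loss_bound w.
Proof. by apply: sume_ge0 => j _; rewrite mule_ge0 ?lj0// lee_fin mulr_ge0. Qed.

Let mser j : measurable_fun setT (fun w => \sum_(0 <= i <oo) (\1_(Ev j (B j + i)) w : R)%:E).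
Proof.
apply: ge0_emeasurable_sum => [i w _ _|i _]; first by rewrite lee_fin.
by apply/measurable_EFinP; exact: measurable_indic.
Qed.

Let mcst j : measurable_fun setT (fun w => ((B j)%:R * \1_Bad w)%:E : \bar R).
Proof. by apply/measurable_EFinP; apply: measurable_funM => //; exact: measurable_indic. Qed.

Let mlj j : measurable_fun setT (lj j).
Proof. exact: emeasurable_funD. Qed.

Lemma measurable_loss_bound : measurable_fun setT loss_bound.
Proof.
apply: emeasurable_sum => j; apply: emeasurable_funM => //.
Qed.

Lemma integral_loss_bound :
  \int[P]_w loss_bound w <=
  (2 * \sum_j `|r j| * ((B j)%:R * pb + t j / 2 ^+ B j))%:E.
Proof.
rewrite ge0_integral_sum//; last 2 first.
- by move=> j; apply: emeasurable_funM.
- by move=> j w _; rewrite mule_ge0 ?lj0// lee_fin mulr_ge0.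
rewrite mulr_sumr -sumEFin; apply: lee_sum => j _.
rewrite ge0_integralZl//.
rewrite [in X in _ <= X]mulrA [X in _ <= X]EFinM lee_wpmul2l ?lee_fin ?mulr_ge0//.
rewrite ge0_integralD//.
rewrite EFinD leeD//.
  under eq_integral do rewrite EFinM.
  rewrite ge0_integralZl//; [|exact/measurable_EFinP/measurable_indic].
  rewrite integral_indic// setIT EFinM lee_wpmul2l//.
rewrite integral_nneseries//; last first.
  by move=> i; apply/measurable_EFinP; exact: measurable_indic.
apply: le_trans (_ : \sum_(0 <= i <oo) ((t j / 2 ^+ B j) / (2 ^ i.+1)%:R)%:E <= _).
  apply: lee_nneseries => i _ //; rewrite integral_indic// setIT.
  apply: le_trans (PEv _ _) _; rewrite lee_fin natrX -addnS exprD invfM mulrA.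
  by [].
by apply: epsilon_trick0; rewrite divr_ge0// exprn_ge0.
Qed.

Lemma loss_bound_ge w : Bad w -> (forall j k, ~ Ev j k w -> (D j w <= k)%N) ->
  (2 * \sum_j `|r j| * (D j w)%:R)%:E <= loss_bound w.
Proof.
move=> Badw HD; rewrite mulr_sumr -sumEFin; apply: lee_sum => j _.
rewrite mulrA EFinM lee_wpmul2l ?lee_fin ?mulr_ge0//.
rewrite /lj indicE mem_set// mulr1.
have [DB|BD] := leqP (D j w) (B j).
  by rewrite -[leLHS]adde0 leeD ?ser0// lee_fin ler_nat.
rewrite -(subnKC (ltnW BD)) natrD EFinD leeD2l//.
apply: le_trans (nneseries_lim_ge (D j w - B j) _); last first.
  by move=> i _; rewrite lee_fin.
rewrite sumEFin lee_fin big_nat (eq_bigr (fun=> 1%R)).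
  by rewrite -big_nat sumr_const_nat subn0.
move=> i /andP[_ iD]; rewrite indicE mem_set//.
by apply: contrapT => /HD; rewrite leqNgt; lia.
Qed.

End LossFun.

(** * The probabilistic model *)

Section Model.
Context d (Omega : measurableType d) (R : realType) (P : probability Omega R).
Context (n : nat) (lam : 'I_n -> R) (E U : 'I_n -> nat -> Omega -> R).
Hypothesis lam0 : forall j, 0 < lam j.
Hypothesis HM : nrm_model P lam E U.

Let X (i : 'I_n * nat * bool) : Omega -> R :=
  if i.2 then E i.1.1 i.1.2 else U i.1.1 i.1.2.
Let ie (j : 'I_n) (k : nat) : 'I_n * nat * bool := (j, k, true).
Let iu (j : 'I_n) (k : nat) : 'I_n * nat * bool := (j, k, false).

Let indX : mut_indep P X. Proof. by have [_ _] := HM. Qed.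
Let ie_inj j : injective (ie j). Proof. by move=> k k' []. Qed.
Let iu_inj j : injective (iu j). Proof. by move=> k k' []. Qed.
Let ie_iu j k l : ie j k != iu j l. Proof. by apply/eqP. Qed.
Let lawE j k V : measurable V -> P (X (ie j k) @^-1` V) = exponential_prob (lam j) V.
Proof. by have [H _ _] := HM; exact: H. Qed.
Let lawU j k V : measurable V -> P (X (iu j k) @^-1` V) = uniform_prob (@ltr01 R) V.
Proof. by have [_ H _] := HM; exact: H. Qed.
Let mX i : measurable_fun setT (X i). Proof. by have [] := indX. Qed.
Let mE j k : measurable_fun setT (E j k). Proof. exact: (mX (ie j k)). Qed.
Let mU j k : measurable_fun setT (U j k). Proof. exact: (mX (iu j k)). Qed.

Let mlt (f : Omega -> R) (x : R) : measurable_fun setT f -> measurable [set w | f w < x].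
Proof.
move=> mf; rewrite -[X in measurable X]setTI.
by apply: (measurable_fun_ltr mf (measurable_cst x) measurableT (Y := [set true])).
Qed.

Let nullU (B C : set Omega) : measurable B -> measurable C ->
  P B = 0%E -> P C = 0%E -> P (B `|` C) = 0%E.
Proof. by move=> mB mC PB PC; rewrite measureU0. Qed.

Lemma U_ge1_null j k : P [set w | ~ (U j k w < 1)] = 0%E.
Proof.
have -> : [set w | ~ (U j k w < 1)] = ~` [set w | U j k w < 1] by [].
rewrite probability_setC; last exact: mlt.
rewrite (_ : P [set w | U j k w < 1] = 1%E) ?subee//.
by apply: (uniform_lt (mX (iu j k)) (lawU j k)); rewrite ler01 lexx.
Qed.

Lemma U_lt0_null j k : P [set w | U j k w < 0] = 0%E.
Proof. by apply: (uniform_lt (mX (iu j k)) (lawU j k)); rewrite ler01 lexx. Qed.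

Let stalled j t := [set w | forall k, psum (fun i => E j i w) k <= t] `&`
     [set w | forall k, 0 <= E j k w].

Let measurable_stalled j t : measurable (stalled j t).
Proof.
apply: measurableI.
  rewrite (_ : [set w | _] = \bigcap_k [set w | psum (fun i => E j i w) k <= t]).
    by apply: bigcap_measurable => // k _; exact: (measurable_psum_le indX (ie j)).
  by apply/seteqP; split => [w H k _|w H k]; [exact: H|exact: (H k)].
rewrite (_ : [set w | _] = \bigcap_k ~` [set w | E j k w < 0]).
  by apply: bigcap_measurable => // k _; apply: measurableC; exact: mlt.
apply/seteqP; split => [w H k _ /=|w H k]; first by rewrite ltNge H.
by have /negP := H k I; rewrite -leNgt.
Qed.

(** Arrivals do not accumulate before [t]: the first [k + 1] of them would all be early, which has
    probability at most [expR (lam j * t) / 2 ^ k.+1], for every [k]. *)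
Lemma psum_bounded_null j (t : R) : P (stalled j t) = 0%E.
Proof.
set S := stalled j t; have mS : measurable S by exact: measurable_stalled.
suff key : (P S <= 0%:E)%E by apply/eqP; rewrite -measure_le0; exact: key.
have H k : (P S <= (expR (lam j * t) / 2 ^+ k.+1)%:E)%E.
  have := early_arrival indX (@ie_inj j) (lam0 j) (lawE j) 0 t 0 k (@ler01 R).
  rewrite mul1r => H; apply: (@le_trans _ _ (P [set w | first_after (fun i => E j i w) 0 0 &&
     (psum (fun i => E j i w) (0 + k).+1 <= 0 + t)%R])).
    apply: le_measure; rewrite ?inE//.
      rewrite -[X in measurable X]setTI.
      apply: (measurable_and (measurable_first_after indX (ie j) 0 0)
        (measurable_fun_ler (measurable_psum indX (ie j) (0 + k).+1) (measurable_cst (0 + t)))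
         measurableT (Y := [set true])).
      by [].
    (* At [s = 0] the index [0] is a first index thanks to the large inequality in [first_after]. *)
    move=> w [w1 w2] /=; rewrite add0r w1 andbT /first_after/= /psum big_ord0 lexx/=.
    by apply: sumr_ge0.
  apply: le_trans H _; rewrite -[leRHS]mul1e; apply: lee_wpmul2r.
    by rewrite lee_fin divr_ge0 ?expR_ge0.
  apply: probability_le1; rewrite -[X in measurable X]setTI.
  by apply: (measurable_first_after indX (ie j) 0 0 measurableT (Y := [set true])).
have finS : P S \is a fin_num by exact: fin_num_measure.
rewrite -(fineK finS) lee_fin leNgt; apply/negP => pos.
pose C := expR (lam j * t) / fine (P S).
have C0 : 0 <= C by rewrite divr_ge0 ?expR_ge0 ?ltW.
pose k := Num.truncn C.
have hk : C < k.+1%:R by exact: truncnS_gt.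
have h2 : k.+1%:R <= 2 ^+ k.+1 :> R by rewrite -natrX ler_nat ltnW// ltn_expl.
have := H k; rewrite -(fineK finS) lee_fin ler_pdivlMr ?exprn_gt0//.
rewrite mulrC -ler_pdivlMr//; apply/negP; rewrite -ltNge.
exact: lt_le_trans hk h2.
Qed.

(** The existence of [N] is what makes [arr_bound] a genuine bound in place of its default value. *)
Lemma regular_paths (t : R) : exists Nul : set Omega,
  [/\ measurable Nul, P Nul = 0%E & forall w, ~ Nul w ->
   [/\ forall j k, 0 <= E j k w, forall j k, 0 <= U j k w < 1 &
    exists N, forall j k, (N <= k)%N -> t < arr_time (fun j k => E j k w) j k]].
Proof.
pose Nk (j : 'I_n) (k : nat) : set Omega := [set w | E j k w < 0] `|`
  ([set w | U j k w < 0] `|` [set w | ~ (U j k w < 1)]).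
have mNk j k : measurable (Nk j k).
  apply: measurableU; first exact: mlt.
  apply: measurableU; first exact: mlt.
  by apply: measurableC; exact: mlt.
have PNk j k : P (Nk j k) = 0%E.
  have m1 := mlt 0 (mE j k); have m2 := mlt 0 (mU j k).
  have m3 : measurable [set w | ~ (U j k w < 1)] by apply: measurableC; exact: mlt.
  apply: nullU => //; first exact: measurableU.
    exact: (exp_neg0 (lawE j) k).
  by apply: nullU => //; [exact: U_lt0_null|exact: U_ge1_null].
pose Nj j := stalled j t `|` \bigcup_k Nk j k.
have mNj j : measurable (Nj j).
  by apply: measurableU => //; exact: bigcup_measurable.
have PNj j : (P (Nj j) <= 0%:E)%E.
  have mU' : measurable (\bigcup_k Nk j k) by exact: bigcup_measurable.
  have PU : P (\bigcup_k Nk j k) = 0%E.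
    suff h : (P (\bigcup_k Nk j k) <= 0)%E by apply/eqP; rewrite -measure_le0; exact: h.
    have H : (P (\bigcup_k Nk j k) <= \sum_(0 <= k <oo) P (Nk j k))%E.
      exact: measure_sigma_subadditive.
    by apply: le_trans H _; rewrite eseries0// => k _ _; exact: PNk.
  rewrite (nullU _ mU' _ PU)//; exact: psum_bounded_null.
have [|mN PN] := @measure_seqU _ _ _ P _ Nj (enum 'I_n) 0.
  by move=> j _; split; [exact: mNj|exact: PNj].
rewrite mulr0 in PN.
exists (\big[setU/set0]_(j <- enum 'I_n) Nj j); split => //.
  by apply/eqP; rewrite -measure_le0.
move=> w /notin_seqU nN.
have {}nN j : ~ Nj j w by apply: nN; rewrite mem_enum.
have E0 j k : 0 <= E j k w.
  by rewrite leNgt; apply/negP => h; apply: (nN j); right; exists k => //; left.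
split=> //.
  move=> j k; apply/andP; split.
    rewrite leNgt; apply/negP => h; apply: (nN j); right; exists k => //.
    by right; left.
  apply/negPn/negP => /negP h; apply: (nN j); right; exists k => //.
  by right; right.
have ex j : exists k, t < psum (fun i => E j i w) k.
  apply: contrapT => /forallNP H; apply: (nN j); left; split => //= k.
  by rewrite leNgt; apply/negP; exact: H.
have [f fP] := choice ex.
exists (\max_j f j)%N => j k kf; apply: lt_le_trans (fP j) _.
have := @psum_le R (fun i => E j i w) (E0 j) (f j) k.+1.
apply; apply: leq_trans (leqW kf) ; exact: leq_bigmax.
Qed.

Section EpochLoss.
Context (m : nat) (r : 'I_n -> R) (T : nat) (k Ml eps : R).
Hypothesis T4 : (4 <= T)%N.
Hypothesis k1 : 1 <= k.
Hypothesis eps01 : 0 < eps <= 1.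
Hypothesis lamMl : forall j, lam j + 2 <= Ml.
Hypothesis Ml2 : 2 <= Ml.
Hypothesis epslam : forall j, (k + 3) * (4 * eps) <= lam j.
Local Notation K := (K_irt R T).
Local Notation tau := (tau_irt R T).
Local Notation ts := (tstar R T).
Local Notation sg := (sigma_irt R T).
Local Notation path w := (fun j i => E j i w).
Local Notation coin w := (fun j i => U j i w).

Let T1 : (1 <= T)%N. Proof. exact: leq_trans T4. Qed.

Definition regular w := [/\ forall j k, 0 <= E j k w, forall j k, 0 <= U j k w < 1 &
    exists N, forall j k, (N <= k)%N -> T%:R < arr_time (path w) j k].

Let tsT u : ts u + tau u = T%:R.
Proof. by rewrite /tstar subrK. Qed.

Let regular_ex w j u : regular w -> exists i, ts u <= psum (path w j) i.
Proof.
move=> [_ _ [N HN]]; exists N.+1; apply: le_trans (ltW (HN j N (leqnn N))).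
by rewrite -(tsT u) lerDl ltW// tau_gt0.
Qed.

Let regular_bound w j i : regular w -> (arr_bound (path w) T%:R <= i)%N ->
  T%:R < psum (path w j) i.+1.
Proof. by move=> [_ _ H]; exact: (arr_boundP H). Qed.

Lemma tail_events u : exists Ev : 'I_n -> nat -> set Omega,
  [/\ forall j i, measurable (Ev j i),
      forall j i, (P (Ev j i) <= (expR (lam j * sg u ^+ 12) / 2 ^+ i.+1)%:E)%E &
      forall w, regular w -> forall j i, ~ Ev j i w -> (cntD T (path w) u j <= i)%N].
Proof.
have [f fP] := choice (fun jk : 'I_n * nat =>
  tail_event indX (@ie_inj jk.1) (lam0 jk.1) (lawE jk.1) (ts_ge0 R T1 u) (tau u) jk.2).
exists (fun j i => f (j, i)); split.
- by move=> j i; have [] := fP (j, i).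
- by move=> j i; rewrite sigma12//; have [] := fP (j, i).
- move=> w rw j i; have [_ _ H] := fP (j, i) => nE.
  apply: H => //; last exact: regular_ex.
  by have [H0 _ _] := rw; exact: H0.
Qed.

Lemma bad_event u : (u < K)%N -> 2 + eps^-1 <= sg u ->
  exists Bad : set Omega,
  [/\ measurable Bad,
     (P Bad <= (n%:R * ((2 * grid_size Ml eps (sg u) + 6)%:R *
          expR (- (eps ^+ 2 / (8 * Ml) * sg u ^+ 2))))%:E)%E &
     forall w, regular w -> ~ Bad w -> good_epoch lam T (path w) (coin w) k u].
Proof.
move=> uK sgu; have /andP[e0 e1] := eps01; have M2 := Ml2; have kk := k1.
set g := sg u in sgu *.
have ei0 : 0 < eps^-1 by rewrite invr_gt0.
have g2 : 2 <= g by lra.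
have g0 : 0 < g by lra.
have M0 : 0 < Ml by lra.
(* The lower bound on [sg u] serves here: the deviation [eps * g ^ 7] has to cover rounding errors
   of size [1]. It also gives [2 <= g]. *)
have e7 : 1 <= eps * g ^+ 7.
  have h1 : eps^-1 <= g ^+ 7.
    apply: (@le_trans _ _ g); first by lra.
    by rewrite -[X in X <= _]expr1; apply: ler_weXn2l => //; lra.
  by rewrite -(mulfV (lt0r_neq0 e0)) ler_pM2l.
pose c := eps / (4 * Ml).
pose th := c * g ^- 5.
have c0 : 0 <= c by rewrite divr_ge0 ?mulr_ge0 ?(ltW e0) ?(ltW M0).
have c1 : c <= 1 / 2.
  by rewrite /c ler_pdivrMr ?mulr_gt0//; lra.
have g5 : 0 <= g ^- 5 <= 1.
  rewrite invr_ge0 exprn_ge0 ?(ltW g0)//= invf_le1 ?exprn_gt0// exprn_ege1//; lra.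
have th01 : 0 <= th <= 1 / 2.
  have /andP[h1 h2] := g5; apply/andP; split; first exact: mulr_ge0.
  by apply: le_trans c1; rewrite ler_piMr.
have h10 : 0 <= tau u - tau u.+1 by rewrite subr_ge0 tauS_le.
have h12 : tau u - tau u.+1 <= tau u by rewrite gerBl ltW// tau_gt0.
have eta0 : 0 <= eps * g ^+ 7 by lra.
have N0 : (0 < grid_size Ml eps g)%N by [].
have g12 : g ^+ 7 <= g ^+ 12 by apply: ler_weXn2l => //; lra.
have g121 : 1 <= g ^+ 12 by rewrite exprn_ege1//; lra.
(* [Ml] exceeds [lam j] by [2]: one unit covers the deviation, the other the rounding. *)
have hL j : lam j * tau u + eps * g ^+ 7 + 1 <= Ml * g ^+ 12.
  rewrite -(sigma12 R T1) -/g.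
  have h1 : (lam j + 2) * g ^+ 12 <= Ml * g ^+ 12 by rewrite ler_wpM2r//; lra.
  have h2 : eps * g ^+ 7 <= g ^+ 12 by apply: le_trans g12; rewrite ler_piMl// exprn_ge0 ?(ltW g0).
  lra.
have [f fP] := choice (fun j =>
  epoch_bad indX (@ie_inj j) (@iu_inj j) (@ie_iu j) (lam0 j) (lawE j) (lawU j)
    (ts_ge0 R T1 u) h10 h12 eta0 th01 (hL j) N0).
have qE : expR (- (th * (eps * g ^+ 7)) + 2 * th ^+ 2 * (Ml * g ^+ 12)) =
   expR (- (eps ^+ 2 / (8 * Ml) * g ^+ 2)).
  by congr expR; exact: chernoff_exponent.
have [|mB PB] := @measure_seqU _ _ _ P _ f (enum 'I_n)
  ((2 * grid_size Ml eps g + 6)%:R * expR (- (eps ^+ 2 / (8 * Ml) * g ^+ 2))).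
  by move=> j _; have [h1 h2 _] := fP j; rewrite -qE.
exists (\big[setU/set0]_(j <- enum 'I_n) f j); split => //.
  by rewrite size_enum_ord in PB.
move=> w rw /notin_seqU nB; split => //.
(* The coin counts deviate by at most [2 * eta + 1 + L / N], where both [1] and [L / N] are at most
   [eta = eps * g ^ 7]. *)
exists (4 * (eps * g ^+ 7)) => [|j]; first by lra.
have [_ _ H] := fP j.
have [|||| D1 D2 D3] := H w _ _ _ (arr_bound (path w) T%:R).
- by have [H0 _ _] := rw; exact: H0.
- exact: regular_ex.
- by apply: nB; rewrite mem_enum.
- by move=> i; rewrite tsT; exact: regular_bound.
have hN := grid_size_ge Ml2 eps01 g0.
have eta1 : eps * g ^+ 7 + 1 <= 4 * (eps * g ^+ 7) by lra.
split.
- have -> : (k + 3) * (4 * (eps * g ^+ 7)) = (k + 3) * (4 * eps) * g ^+ 7 by ring.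
  by rewrite ler_wpM2r ?exprn_ge0 ?(ltW g0).
- exact: le_trans D1 eta1.
- exact: le_trans D2 eta1.
- move=> p p01; apply: le_trans (D3 p p01) _; lra.
Qed.

(** The three terms are the bad event of a long epoch, the geometric tail, and the epochs with
    [sg u < 2 + eps^-1]. The latter count as bad on every path; at most [5 * Ml * sg ^ 12] arrivals
    are charged, and one more power of [2 + eps^-1] pays for the division by [sg]. *)
Definition epoch_rate : R :=
  loss_rate Ml eps n + \sum_j (lam j)^-1 + 5 * Ml * (2 + eps^-1) ^+ 13.

Lemma epoch_loss u : (u <= K)%N -> exists l : Omega -> \bar R,
  [/\ measurable_fun setT l, forall w, (0 <= l w)%E,
   (\int[P]_w l w <= ((2 * \sum_j `|r j|) *
      (if (u < K)%N then epoch_rate / sg u else 16 * Ml + 2))%:E)%E &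
   forall w, regular w -> exists loss : R, [/\ 0 <= loss, (loss%:E <= l w)%E &
     2 * \sum_j `|r j| * (cntD T (path w) u j)%:R <= loss \/
     good_epoch lam T (path w) (coin w) k u]].
Proof.
move=> uK; have /andP[e0 e1] := eps01; have M2 := Ml2.
have [Ev [mEv PEv HEv]] := tail_events u.
have g0 : 0 < sg u by exact: sigma_gt0.
pose B j := tail_start (lam j) (sg u).
have lM j : 0 < lam j <= Ml by have := lamMl j; have := lam0 j; lra.
have tail j : expR (lam j * sg u ^+ 12) / 2 ^+ B j <= expR (- (lam j * sg u ^+ 12)).
  exact: tail_sum_le.
have [Bad [pb [mBad PBad HBad Hnum]]] : exists (Bad : set Omega) (pb : R),
   [/\ measurable Bad, (P Bad <= pb%:E)%E,
    forall w, regular w -> ~ Bad w -> good_epoch lam T (path w) (coin w) k u &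
    forall j, (B j)%:R * pb + expR (lam j * sg u ^+ 12) / 2 ^+ B j <=
      (if (u < K)%N then epoch_rate / sg u else 16 * Ml + 2)].
  have lsum j : (lam j)^-1 <= \sum_j (lam j)^-1.
    rewrite (bigD1 j)//= lerDl; apply: sumr_ge0 => i _.
    by rewrite invr_ge0 ltW.
  (* The last epoch is declared bad on every path. As [tau_K <= 4], the tail starts at most at
     [16 * Ml + 1], and the tail series adds at most [1]. *)
  have [uK'|uK'] := ltnP u K; last first.
    have {}uK : u = K by apply/eqP; rewrite eqn_leq uK.
    exists setT, 1; split => //; [exact: probability_le1|by move=> w _ /(_ I)|].
    move=> j; have /andP[l0 l1] := lM j.
    have t4 : sg u ^+ 12 <= 4 by rewrite sigma12// uK; exact: tau_K_le.
    have /andP[_ h] := tail_start_ge (ltW l0) (ltW g0).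
    have h2 : lam j * sg u ^+ 12 <= Ml * 4.
      by rewrite ler_pM ?exprn_ge0 ?(ltW l0) ?(ltW g0).
    have h3 : expR (- (lam j * sg u ^+ 12)) <= 1.
      rewrite -[leRHS]expR0 ler_expR oppr_le0 mulr_ge0 ?exprn_ge0 ?(ltW l0) ?(ltW g0)//.
    rewrite mulr1; apply: le_trans (lerD h (le_trans (tail j) h3)) _; lra.
  have g1 : 1 <= sg u by exact: (sigma_ge1 T4).
  have R0 : 0 <= loss_rate Ml eps n by exact: loss_rate_ge0 Ml2 eps01 n.
  have S0 : 0 <= 5 * Ml * (2 + eps^-1) ^+ 13.
    have ei0 : 0 < eps^-1 by rewrite invr_gt0.
    by rewrite !mulr_ge0 ?exprn_ge0//; lra.
  have gi0 : 0 < (sg u)^-1 by rewrite invr_gt0.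
  have [sgu|sgu] := leP (2 + eps^-1) (sg u).
    have [Bad [mBad PBad HBad]] := bad_event uK' sgu.
    exists Bad, (n%:R * ((2 * grid_size Ml eps (sg u) + 6)%:R *
          expR (- (eps ^+ 2 / (8 * Ml) * sg u ^+ 2)))); split => //.
    move=> j; have h1 := good_loss_le Ml2 eps01 n g1 (lM j).
    have h2 := exp_tail_le (lam0 j) g1.
    have h3 : (lam j)^-1 / sg u <= (\sum_j (lam j)^-1) / sg u by rewrite ler_wpM2r// ltW.
    have h4 : 0 <= 5 * Ml * (2 + eps^-1) ^+ 13 / sg u by rewrite mulr_ge0// ltW.
    apply: le_trans (lerD h1 (le_trans (tail j) h2)) _.
    rewrite /epoch_rate 2!mulrDl -addrA lerD2l; apply: le_trans h3 _.
    by rewrite lerDl.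
  exists setT, 1; split => //; [exact: probability_le1|by move=> w _ /(_ I)|].
  move=> j; have h1 := tail_start_le Ml2 g1 (lM j).
  have h2 := exp_tail_le (lam0 j) g1.
  have h3 : (lam j)^-1 / sg u <= (\sum_j (lam j)^-1) / sg u by rewrite ler_wpM2r// ltW.
  have h4 : 5 * Ml * sg u ^+ 12 <= 5 * Ml * (2 + eps^-1) ^+ 13 / sg u.
    rewrite ler_pdivlMr//.
    have -> : 5 * Ml * sg u ^+ 12 * sg u = 5 * Ml * sg u ^+ 13 by ring.
    rewrite ler_wpM2l//; first by lra.
    by rewrite lerXn2r ?nnegrE ?(ltW g0)//; lra.
  have h5 : 0 <= loss_rate Ml eps n / sg u by rewrite mulr_ge0// ltW.
  rewrite mulr1; apply: le_trans (lerD h1 (le_trans (tail j) h2)) _.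
  have -> : epoch_rate / sg u = loss_rate Ml eps n / sg u +
      (5 * Ml * (2 + eps^-1) ^+ 13 / sg u + (\sum_j (lam j)^-1) / sg u).
    by rewrite addrCA addrC -!mulrDl.
  by rewrite -[leLHS]add0r; apply: lerD h5 (lerD h4 h3).
have t0 j : 0 <= expR (lam j * sg u ^+ 12) by exact: expR_ge0.
exists (loss_bound r B Ev Bad); split.
- exact: measurable_loss_bound.
- by move=> w; exact: loss_bound_ge0.
- apply: le_trans (integral_loss_bound r B mEv mBad PBad t0 PEv) _.
  rewrite lee_fin -mulrA ler_wpM2l// mulr_suml; apply: ler_sum => j _.
  by rewrite ler_wpM2l.
- move=> w rw; have [Bw|nBw] := pselect (Bad w).
    exists (2 * \sum_j `|r j| * (cntD T (path w) u j)%:R); split.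
    + by rewrite mulr_ge0// sumr_ge0// => j _; rewrite mulr_ge0.
    + pose D j w := cntD T (path w) u j.
      exact: (@loss_bound_ge _ _ _ P n r B D Ev Bad pb PBad w Bw (HEv w rw)).
    + by left.
  exists 0; split => //; first by rewrite loss_bound_ge0.
  by right; exact: HBad.
Qed.

End EpochLoss.
End Model.

Theorem theorem1 (R : realType) (m n : nat) (lam r : 'I_n -> R)
    (A : 'M[R]_(m, n)) :
  (forall j, 0 < lam j) -> (forall l j, 0 <= A l j) ->
  exists M : R, 0 < M /\
  exists T1 : nat, forall T : nat, (T1 <= T)%N ->
  forall C : 'I_m -> R, (forall l, 0 <= C l) ->
  forall sol : nat -> ('I_m -> R) -> 'I_n -> R, lp_selector r lam A sol ->
  forall (d : measure_display) (Omega : measurableType d)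
         (P : probability Omega R) (E U : 'I_n -> nat -> Omega -> R),
  nrm_model P lam E U ->
  (\int[P]_w (V_HO r lam A C T (fun j k => E j k w))%:E
   <= \int[P]_w (V_IRT r lam A C sol T (fun j k => E j k w)
                               (fun j k => U j k w))%:E + M%:E)%E.
Proof.
move=> lam0 A0; have [k k1 stab] := lp_stability A.
(* [Ml] exceeds every rate by at least [2], and [eps] is small enough that [4 * (k + 3) * eps] is at
   most every rate, because [1 <= lam j * S]. Both are functions of the rates and, through [k], of
   [A]. *)
pose Ml := 2 + \sum_j lam j.
pose S := \sum_j (lam j)^-1.
have S0 : 0 <= S by apply: sumr_ge0 => j _; rewrite invr_ge0 ltW.
have Ml2 : 2 <= Ml by rewrite lerDl; apply: sumr_ge0 => j _; rewrite ltW.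
have lamMl j : lam j + 2 <= Ml.
  rewrite addrC lerD2l (bigD1 j)//= lerDl; apply: sumr_ge0 => i _.
  by rewrite ltW.
have kS0 : 0 <= 4 * (k + 3) * S by rewrite !mulr_ge0//; lra.
pose eps := (1 + 4 * (k + 3) * S)^-1.
have eps0 : 0 < eps by rewrite invr_gt0; lra.
have eps01 : 0 < eps <= 1 by rewrite eps0 invf_le1; lra.
have epslam j : (k + 3) * (4 * eps) <= lam j.
  rewrite mulrA /eps ler_pdivrMr; last by lra.
  have lS : 1 <= lam j * S.
    rewrite -(mulfV (lt0r_neq0 (lam0 j))) ler_pM2l//.
    rewrite /S (bigD1 j)//= lerDl; apply: sumr_ge0 => i _.
    by rewrite invr_ge0 ltW.
  have : 4 * (k + 3) * 1 <= 4 * (k + 3) * (lam j * S).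
    by rewrite ler_wpM2l//; lra.
  by have := lam0 j; lra.
pose rho := 2 * \sum_j `|r j|.
have rho0 : 0 <= rho by rewrite mulr_ge0// sumr_ge0.
pose C0 := epoch_rate lam Ml eps.
have C00 : 0 <= C0.
  have M0 : 0 <= 5 * Ml by lra.
  have e0 : 0 <= (2 + eps^-1) ^+ 13.
    by rewrite exprn_ge0// addr_ge0// invr_ge0 ltW.
  have l0 := loss_rate_ge0 Ml2 eps01 n.
  rewrite /C0 /epoch_rate; apply: addr_ge0; last exact: mulr_ge0.
  by apply: addr_ge0 => //; exact: loss_rate_ge0.
(* [72] bounds the sum of the inverses of [sigma] over all epochs but the last, [16 * Ml + 2] is the
   cost of the last one, and the final [1] makes the constant positive. *)
exists (rho * (C0 * 72 + (16 * Ml + 2)) + 1); split.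
  rewrite ltr_pwDr// mulr_ge0// !addr_ge0 ?mulr_ge0//; lra.
exists 4%N => T T4 C HC sol Hsol d Omega P E U HM.
have T1 : (1 <= T)%N by exact: leq_trans T4.
have [Nul [mNul PNul HNul]] := regular_paths lam0 HM T%:R.
have [l lP] := choice (fun u : 'I_(K_irt R T).+1 =>
  epoch_loss lam0 HM r T4 k1 eps01 lamMl Ml2 epslam (ltn_ord u : (u <= K_irt R T)%N)).
(* Infinite on the null set of irregular paths, so that the pathwise inequality holds everywhere
   while the expectation does not change. *)
pose lN : Omega -> \bar R := (cst +oo%E) \_ Nul.
have lN0 w : (0 <= lN w)%E by rewrite /lN patchE; case: ifP => _; rewrite ?lexx// /cst leey.
have l0 u w : (0 <= l u w)%E by have [_ H _ _] := lP u; exact: H.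
have ml u : measurable_fun setT (l u) by have [] := lP u.
have mlN : measurable_fun setT lN.
  by apply/(measurable_restrictT _ _).1 => //; exact: measurable_cst.
pose L w := (\sum_u l u w + lN w)%E.
have suml0 w : (0 <= \sum_u l u w)%E by apply: sume_ge0.
apply: (@le_integral_gap _ _ _ P _ _ L).
- move=> w; apply: VH_ge0 => // j; exact: ler0n.
- by move=> w; rewrite adde_ge0.
- by apply: emeasurable_funD => //; exact: emeasurable_sum.
- move=> w; have [Nw|nNw] := pselect (Nul w).
    rewrite /L /lN patchE mem_set// addey; last first.
      by rewrite -ltNye (lt_le_trans _ (suml0 w)).
    by rewrite addey ?leey.
  have rw : regular E U T w by exact: HNul.
  have [E0 U01 _] := rw.
  have ex (u : 'I_(K_irt R T).+1) : exists loss : R, [/\ 0 <= loss, (loss%:E <= l u w)%E &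
     2 * \sum_j `|r j| * (cntD T (fun j k => E j k w) u j)%:R <= loss \/
     good_epoch lam T (fun j k => E j k w) (fun j k => U j k w) k u].
    by have [_ _ _ H] := lP u; exact: H.
  have [f fP] := choice ex.
  pose loss u := f (inord u).
  have H := @V_gap R m n r lam A sol T (fun j k => E j k w) (fun j k => U j k w) k
    A0 lam0 T1 E0 U01 Hsol (stab r) C loss HC.
  apply: (@le_trans _ _ ((V_IRT r lam A C sol T (fun j k => E j k w)
                               (fun j k => U j k w) + \sum_(u < (K_irt R T).+1) loss u)%:E)).
    rewrite lee_fin; apply: H => u uK.
    have [h1 h2 h3] := fP (inord u); split=> //.
    by rewrite inordK in h3.
  rewrite EFinD leeD2l// -sumEFin /L -[leLHS]adde0 leeD//.
  apply: lee_sum => u _; have [_ h _] := fP u.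
  by rewrite /loss inord_val.
- rewrite ge0_integralD//; last exact: emeasurable_sum.
  have -> : (\int[P]_w lN w = 0)%E.
    rewrite -integral_mkcond integral_cst// [X in (_ * X)%E](_ : _ = 0%E) ?mule0//.
  rewrite adde0 ge0_integral_sum//.
  apply: (@le_trans _ _ (\sum_(u < (K_irt R T).+1)
     (rho * (if (u < K_irt R T)%N then C0 / sigma_irt R T u else 16 * Ml + 2))%:E)%E).
    by apply: lee_sum => u _; have [_ _ h _] := lP u.
  rewrite sumEFin lee_fin -mulr_sumr big_ord_recr/= ltnn.
  rewrite -[leLHS]addr0 lerD// ler_wpM2l// lerD2r.
  rewrite (eq_bigr (fun u : 'I__ => C0 * (sigma_irt R T u)^-1)); last first.
    by move=> u _; rewrite ltn_ord.
  by rewrite -mulr_sumr ler_wpM2l// sum_inv_sigma.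
Qed.
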